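(* Let $T$ be a maximal elliptic torus of $Sp(W)$, with $W=W_1\oplus\cdots\oplus W_n$, $T=T_1\times\cdots\times T_n$, lattices $B_i\subset A_i\subset B_i^*$ in $W_i$, $B=\bigoplus B_i$, $A=\bigoplus A_i$, and lifts of $T$, $T_i$ to $Mp(W)$, $Mp(W_i)$ by $s_B$, $s_{B_i}$, as in the context. (i) A character $\chi$ of $T$ occurs in the restriction to $T$ of the Weil representation $S_{W,\psi}$ if and only if, for each $1\le i\le n$, the character $\chi_{|T_i}$ of $T_i$ occurs in the restriction to $T_i$ of the Weil representation $S_{W_i,\psi}$. (ii) Let $\chi$ be a character of $T$ satisfying the equivalent conditions of (i). For $1\le i\le n$ let $\chi_i=\chi_{|T_i}$ and choose an eigenfunction $\varphi_{\chi_i}\in\mathcal{H}^{A_i}_\psi$ of weight $\chi_i$ for the restriction of $S_{W_i,\psi}$ to $T_i$. Then $$\varphi_\chi:=\varphi_{\chi_1}\otimes\cdots\otimes\varphi_{\chi_n}$$ is an eigenfunction of weight $\chi$ in $\mathcal{H}^A_\psi$ for the restriction of $S_{W,\psi}$ to $T$.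
   Context: $k$ is a non-archimedean local field of characteristic $0$ with ring of integers $\mathcal{O}$, uniformizer $\varpi$, residue field $\mathbb{F}_q$ of characteristic $p\neq2$; $\psi$ is a non-trivial unitary character of $(k,+)$ with conductor $\lambda_\psi$ (trivial on $\varpi^{\lambda_\psi}\mathcal{O}$, not on $\varpi^{\lambda_\psi-1}\mathcal{O}$); $\overline\psi$ is the character of $\mathbb{F}_q$ with $\overline\psi(x\bmod\varpi)=\psi(\varpi^{\lambda_\psi-1}x)$. $(W,\beta)$ is a non-zero finite-dimensional symplectic $k$-space. A torus of $Sp(W)$ is elliptic if it is anisotropic (equivalently compact). For a maximal elliptic torus $T$, $W$ decomposes uniquely as an orthogonal direct sum of symplectic $T$-submodules $W_i$ irreducible over $k$; the image $T_i$ of $T$ under $x\mapsto x_{|W_i}$ is a maximal torus of $Sp(W_i)$ acting irreducibly, and $T\cong\prod T_i$ via $x\mapsto(x_{|W_i})_i$. **Lattices.** A lattice is a compact open $\mathcal{O}$-submodule; $L^*=\{v:\beta(v,b)\in\varpi^{\lambda_\psi}\mathcal{O}\ \forall b\in L\}$; $L$ is good if $\varpi L^*\subset L\subset L^*$, self-dual if $L=L^*$. $K_L$ is the stabilizer of $L$ in the symplectic group. **Choice of $B_i,A_i$.** Each $(W_i,T_i)$ is (isomorphic to, and identified with) the following: an extension $k'/k$ of degree $\frac12\dim W_i$, a quadratic extension $k''/k'$ with Galois involution $\tau$, rings of integers $\mathcal{O}',\mathcal{O}''$, uniformizers $\varpi',\varpi''$ with $\varpi''^2=\varpi'$ if $k''/k'$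 is ramified and $\varpi''=\varpi'$ otherwise, an element $u\in k''^\times$ of trace $0$ over $k'$ with $u=\varpi''$ if ramified and $v''(u)\in\{0,1\}$ otherwise ($v''$ the normalized valuation); $W_i=k''$ with form $\frac12\mathrm{tr}_{k''/k}(ux^\tau y)$, $T_i=\{t\in k''^\times: tt^\tau=1\}$. With $e$ the ramification index and $\varpi'^\delta\mathcal{O}'$ the different of $k'/k$, $\mu=e\lambda_\psi-\delta-v''(u)$, one puts $B_i=\varpi''^\mu\mathcal{O}''$ if ramified, $B_i=\varpi'^{[(\mu+1)/2]}\mathcal{O}''$ if unramified; $B_i$ is a $T_i$-invariant good lattice. If $B_i$ is self-dual, $A_i=B_i$; otherwise ($k''/k'$ unramified, $\mu$ odd) $A_i=\varpi'^{\frac{\mu-1}2}(\mathcal{O}'+\mathcal{O}'\varpi'\nu)$ where $u=\varpi'^{v''(u)}\nu$; $A_i$ is self-dual with $B_i\subset A_i\subset B_i^*$. Then $B$ is a $T$-invariant good lattice and $A$ a self-dual lattice of $W$ with $B\subset A\subset B^*$. **Weil representations and sections.** $H(W)=W\times k$ with $(w,t)(w',t')=(w+w',t+t'+\frac12\beta(w,w'))$. $\mathcal{H}^A_\psi$ is the Hilbert space of functions $\varphi:W\to\mathbb{C}$ with $\varphi(a+w)=\psi(\frac12\beta(w,a))\varphi(w)$ ($a\in A$), $\int_{W/A}|\varphi|^2<\infty$, with $\rho_\psi^A(w,t)\varphi(w')=\psi(t+\frac12\beta(w',w))\varphi(w'+w)$. $Mp(W)$ is the unique subgroup of $\{(g,U)\in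 Sp(W)\times U(\mathcal{H}^A_\psi):U\rho^A_\psi(w,t)U^{-1}=\rho^A_\psi(gw,t)\}$ projecting onto $Sp(W)$ with kernel of order $2$; the Weil representation $S_{W,\psi}$ is $(g,U)\mapsto U$. $\mathrm{b}^*=B^*/B$ has the $\mathbb{F}_q$-symplectic form $\varpi^{1-\lambda_\psi}\beta\bmod\varpi$ and dimension $2l$; $\mathrm{x}=A/B$ is a Lagrangian; for $g\in K_B$ let $\bar g$ be its image in $Sp(\mathrm{b}^* )$. Put $j(h)=l-\dim(\mathrm{x}\cap h\mathrm{x})$ for $h\in Sp(\mathrm b^* )$, $\omega(a)=q^{-1/2}\sum_{t\in\mathbb{F}_q}\overline\psi(\frac12at^2)$, and let $\theta:Sp(\mathrm{b}^* )\to\mathbb{F}_q^\times/(\mathbb{F}_q^\times)^2$ be the function with $\theta(p_1hp_2)=\theta(p_1)\theta(h)\theta(p_2)$ for $p_1,p_2$ in the stabilizer $P$ of $\mathrm{x}$, $\theta(p)=\det(p_{|\mathrm{x}})$ for $p\in P$, $\theta(\tau_S)=1$ for $S\subset\{1,\dots,l\}$, where, for a symplectic basis $(\epsilon_i,\phi_i)$ with the $\epsilon_i$ spanning $\mathrm{x}$, $\tau_S\epsilon_i=\phi_i$, $\tau_S\phi_i=-\epsilon_i$ for $i\in S$ and $\tau_S$ fixes the other basis vectors. Put $m(h)=\omega(\theta(h))^{-1}\omega(1)^{1-j(h)}$. The section $s_B:K_B\to Mp(W)$ is the homomorphism $g\mapsto(g,S^A_\psi(g))$, $$S^A_\psi(g)\varphi(w)=m(\bar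 g)q^{j(\bar g)/2}[A:A\cap gA]^{-1}\sum_{a\in A/(A\cap gA)}\psi(\tfrac12\beta(a,w))\varphi(g^{-1}(a+w)).$$ The same definitions with $(W_i,B_i,A_i)$ give $\mathcal{H}^{A_i}_\psi$, $Mp(W_i)$, $S_{W_i,\psi}$, $s_{B_i}$. For $\varphi_i\in\mathcal{H}^{A_i}_\psi$, $\varphi_1\otimes\cdots\otimes\varphi_n\in\mathcal{H}^A_\psi$ is $(\varphi_1\otimes\cdots\otimes\varphi_n)(w_1+\cdots+w_n)=\varphi_1(w_1)\cdots\varphi_n(w_n)$, $w_i\in W_i$. *)

(* Defs.v *)
From HB Require Import structures.
From mathcomp Require Import all_boot all_order all_algebra all_field.
From mathcomp Require Import finmap.
From mathcomp Require Import boolp classical_sets functions cardinality fsbigop.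
From mathcomp Require Import reals constructive_ereal ereal esum.
From mathcomp Require Import complex.

Set Implicit Arguments.
Unset Strict Implicit.
Unset Printing Implicit Defensive.

Import Order.TTheory GRing.Theory Num.Theory.
Local Open Scope classical_set_scope.
Local Open Scope ring_scope.

(** ** Valuations and local fields *)

(* Normalized discrete valuation; the value [v 0] is irrelevant. *)
Definition normalized_valuation (F : fieldType) (v : F -> int) : Prop :=
  [/\ forall x y, x != 0 -> y != 0 -> v (x * y) = v x + v y,
      forall x y, x != 0 -> y != 0 -> x + y != 0 ->
        Num.min (v x) (v y) <= v (x + y)
    & exists2 x, x != 0 & v x = 1].

(* The fractional ideal of elements of valuation at least [m]; the ring of
   integers is [videal v 0]. *)
Definition videal (F : fieldType) (v : F -> int) (m : int) : set F :=
  [set x | x = 0 \/ m <= v x].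

Definition vcomplete (F : fieldType) (v : F -> int) : Prop :=
  forall x : nat -> F,
    (forall m : int, exists N : nat, forall i j : nat,
       (N <= i)%N -> (N <= j)%N -> videal v m (x i - x j)) ->
    exists l : F, forall m : int, exists N : nat, forall i : nat,
      (N <= i)%N -> videal v m (x i - l).

(* A non-archimedean local field of characteristic 0 and odd residual
   characteristic, with a fixed uniformizer and an identification of the residue
   field with [Fq]. The reduction [lf_red] is meaningful on the integers only. *)
Record localField (k : fieldType) (Fq : finFieldType) := LocalField {
  lf_val : k -> int;
  lf_unif : k;
  lf_red : k -> Fq;
  lf_char0 : [pchar k] =i pred0;
  lf_odd : (2 \notin [pchar Fq])%N;
  lf_valP : normalized_valuation lf_val;
  lf_complete : vcomplete lf_val;
  lf_unifP : lf_unif != 0 /\ lf_val lf_unif = 1;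
  lf_redD : {in videal lf_val 0 &, {morph lf_red : x y / x + y}};
  lf_redM : {in videal lf_val 0 &, {morph lf_red : x y / x * y}};
  lf_red1 : lf_red 1 = 1;
  lf_red_surj : forall y, exists2 x, videal lf_val 0 x & lf_red x = y;
  lf_red_ker : forall x, videal lf_val 0 x ->
    (lf_red x = 0 <-> videal lf_val 1 x) }.

Definition lf_int (k : fieldType) (Fq : finFieldType) (K : localField k Fq) :
  set k := videal (lf_val K) 0.

(* Continuity and non-triviality follow from the existence of a conductor. *)
Definition unitary_character (R : realType) (k : fieldType) (Fq : finFieldType)
    (K : localField k Fq) (psi : k -> R[i]) (lam : int) : Prop :=
  [/\ forall x y, psi (x + y) = psi x * psi y,
      forall x, `|psi x| = 1,
      forall x, videal (lf_val K) lam x -> psi x = 1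
    & exists2 x, videal (lf_val K) (lam - 1) x & psi x != 1].

(** ** Symplectic spaces and tori *)

Section Symplectic.
Variables (k : fieldType) (W : vectType k).
Implicit Types (beta : W -> W -> k) (T Z : set 'End(W)).

Definition symplectic_form beta : Prop :=
  [/\ forall a x y z, beta (a *: x + y) z = a * beta x z + beta y z,
      forall a x y z, beta z (a *: x + y) = a * beta z x + beta z y,
      forall x, beta x x = 0
    & forall x, (forall y, beta x y = 0) -> x = 0].

Definition Sp beta : set 'End(W) :=
  [set g | forall x y, beta (g x) (g y) = beta x y].

(* Polynomial functions on End(W): the algebra generated by the linear forms. *)
Inductive polyfun : ('End(W) -> k) -> Prop :=
| polyfun_lin (l : {linear 'End(W) -> k^o}) : polyfun (fun g => l g)
| polyfun_cst (c : k) : polyfun (fun=> c)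
| polyfun_add f1 f2 : polyfun f1 -> polyfun f2 -> polyfun (fun g => f1 g + f2 g)
| polyfun_mul f1 f2 : polyfun f1 -> polyfun f2 ->
    polyfun (fun g => f1 g * f2 g).

Definition zariski_closed Z : Prop :=
  exists2 S : set ('End(W) -> k), S `<=` [set f | polyfun f]
    & Z = [set g | forall f, S f -> f g = 0].

Definition zariski_connected T : Prop :=
  forall Z1 Z2, zariski_closed Z1 -> zariski_closed Z2 ->
    T `<=` Z1 `|` Z2 -> T `&` Z1 `&` Z2 = set0 -> T `<=` Z1 \/ T `<=` Z2.

Definition subgroup T : Prop :=
  [/\ T \1%VF, forall g h, T g -> T h -> T (g \o h)%VF
    & forall g, T g -> T (g^-1)%VF].

Definition codiag_over (F : fieldType) (f : {rmorphism k -> F}) T : Prop :=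
  exists2 P : 'M[F]_(\dim {:W}), P \in unitmx
    & forall g, T g ->
        is_diag_mx (P *m map_mx f (passmx.mxof (vbasis {:W}) (vbasis {:W}) g)
                      *m invmx P).

(* A torus of Sp(W) is represented by its group of k-rational points, which is
   Zariski dense in it since k is perfect and infinite: a Zariski-closed
   connected subgroup, diagonalizable over a finite extension. *)
Definition torus beta T : Prop :=
  [/\ T `<=` Sp beta, subgroup T, zariski_closed T, zariski_connected T
    & exists L : fieldExtType k, codiag_over (in_alg L) T].

Definition split_torus beta T : Prop :=
  torus beta T /\ codiag_over idfun T.

(* Elliptic means anisotropic: there is no non-trivial split subtorus. *)
Definition elliptic beta T : Prop :=
  forall S, split_torus beta S -> S `<=` T -> S = [set \1%VF].

Definition maximal_torus beta T : Prop :=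
  torus beta T /\ forall T', torus beta T' -> T `<=` T' -> T' = T.

Definition maximal_elliptic_torus beta T : Prop :=
  maximal_torus beta T /\ elliptic beta T.

(* Continuous homomorphisms from [T] to the non-zero complex numbers, for the
   topology of End(W) given by the valuation of the coordinates. *)
Definition character (R : realType) (v : k -> int) T (chi : 'End(W) -> R[i]) :
  Prop :=
  [/\ chi \1%VF = 1,
      forall g h, T g -> T h -> chi (g \o h)%VF = chi g * chi h
    & forall g, T g -> forall eps : R[i], 0 < eps -> exists m : int,
        forall h, T h ->
          (forall i, videal v m (coord (vbasis {:'End(W)}) i (h - g))) ->
          `|chi h - chi g| < eps].

End Symplectic.

(** ** Lattices and the Weil representation on functions on W *)

Section Weil.
Variables (R : realType) (k : fieldType) (Fq : finFieldType).
Variables (K : localField k Fq) (psi : k -> R[i]) (lam : int).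
Variables (W : vectType k) (beta : W -> W -> k).
Local Notation C := R[i].
Implicit Types (L A B : set W) (g : 'End(W)) (phi : W -> C).

Definition dual_lattice L : set W :=
  [set v | forall b, L b -> videal (lf_val K) lam (beta v b)].

Definition self_dual L : Prop := L = dual_lattice L.

Definition stabilizer L : set 'End(W) := Sp beta `&` [set g | g @` L = L].

(* A system of representatives of [M / L]. *)
Definition reps (M L : set W) : set W :=
  [set xget 0 [set x | M x /\ L (x - a)] | a in M].

Definition lat_index (M L : set W) : nat := #|` fset_set (reps M L)|%fset.

(* The squared norm: [|phi|^2] integrated over the discrete space [W / A]. *)
Definition sqnorm A phi : \bar R :=
  \esum_(w in reps setT A) (complex.Re (`|phi w| ^+ 2))%:E.

Definition hilbert A : set (W -> C) :=
  [set phi | (forall a w, A a ->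
                phi (a + w) = psi (2^-1 * beta w a) * phi w)
             /\ (sqnorm A phi < +oo)%E].

Definition heisenberg (w : W) (t : k) phi : W -> C :=
  fun w' => psi (t + 2^-1 * beta w' w) * phi (w' + w).

(* Operators are only considered through their values on [hilbert A]. *)
Local Notation operator := ((W -> C) -> (W -> C)).

Definition unitary A (U : operator) : Prop :=
  [/\ forall phi, hilbert A phi -> hilbert A (U phi),
      forall (c : C) phi phi', hilbert A phi -> hilbert A phi' ->
        U (fun w => c * phi w + phi' w) = (fun w => c * U phi w + U phi' w),
      forall phi, hilbert A phi -> sqnorm A (U phi) = sqnorm A phi
    & forall phi, hilbert A phi -> exists2 phi', hilbert A phi' & U phi' = phi].

Definition intertwiners A : set ('End(W) * operator) :=
  [set x | [/\ Sp beta x.1, unitary A x.2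
     & forall w t phi, hilbert A phi ->
         x.2 (heisenberg w t phi) = heisenberg (x.1 w) t (x.2 phi)]].

Definition same_op A (U V : operator) : Prop :=
  forall phi, hilbert A phi -> U phi = V phi.

(* [M] is the group Mp(W), realized on [hilbert A]; it contains the image of
   [weil_section]. *)
Definition metaplectic A (M : set ('End(W) * operator)) : Prop :=
  [/\ M `<=` intertwiners A,
      (forall g U V, M (g, U) -> same_op A U V -> M (g, V)),
      [/\ M (\1%VF, id),
          forall g h U V, M (g, U) -> M (h, V) -> M ((g \o h)%VF, U \o V)
        & forall g U, M (g, U) -> exists2 V, M ((g^-1)%VF, V)
            & same_op A (U \o V) id],
      (forall g, Sp beta g -> exists U, M (g, U))
    & exists2 U0, M (\1%VF, U0) /\ ~ same_op A U0 id
        & forall U, M (\1%VF, U) -> same_op A U id \/ same_op A U U0].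

(* The Weil representation of Mp(W). *)
Definition weil (x : 'End(W) * operator) : operator := x.2.

(* The residual symplectic space [B^* / B], presented by a projection of [B^*]
   onto an [Fq]-vector space with kernel [B], together with its reduced form and
   its Lagrangian [A / B]. The map [rs_pr] is meaningful on [B^*] only. *)
Record residualSpace A B := ResidualSpace {
  rs_space : vectType Fq;
  rs_pr : W -> rs_space;
  rs_form : rs_space -> rs_space -> Fq;
  rs_lagr : {vspace rs_space};
  rs_prD : {in dual_lattice B &, {morph rs_pr : x y / x + y}};
  rs_prZ : forall c x, lf_int K c -> dual_lattice B x ->
    rs_pr (c *: x) = lf_red K c *: rs_pr x;
  rs_pr_surj : forall y, exists2 x, dual_lattice B x & rs_pr x = y;
  rs_pr_ker : forall x, dual_lattice B x -> (rs_pr x = 0 <-> B x);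
  rs_formE : forall x y, dual_lattice B x -> dual_lattice B y ->
    rs_form (rs_pr x) (rs_pr y) = lf_red K (lf_unif K ^ (1 - lam) * beta x y);
  rs_lagrE : forall y, y \in rs_lagr <-> exists2 a, A a & rs_pr a = y }.
Arguments rs_form {A B} _ _ _.

Section Residual.
Variables (A B : set W) (Q : residualSpace A B).
Local Notation b := (rs_space Q).
Local Notation x := (rs_lagr Q).
Implicit Types (h p : 'End(b)) (theta : 'End(b) -> Fq).

(* The image in Sp(B^* / B) of an element of the stabilizer of [B]. *)
Definition reduction g : 'End(b) :=
  linfun (fun y =>
    rs_pr Q (g (xget 0 [set w | dual_lattice B w /\ rs_pr Q w = y]))).

Definition rs_l : nat := (\dim {: b})./2.

Definition rs_j h : nat := rs_l - \dim (x :&: (h @: x)).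

Definition siegel : set 'End(b) :=
  Sp (rs_form Q) `&` [set p | (p @: x)%VS = x].

Definition det_on (U : {vspace b}) p : Fq :=
  \det (\matrix_(i < \dim U, j < \dim U)
          coord (vbasis U) j (p (vbasis U)`_i)).

Definition eq_mod_squares (c d : Fq) : Prop := exists2 s, s != 0 & c = d * s ^+ 2.

Definition symplectic_basis (e f : 'I_rs_l -> b) : Prop :=
  [/\ <<codom e>>%VS = x, <<codom e ++ codom f>>%VS = {: b}%VS,
      forall i j, rs_form Q (e i) (f j) = (i == j)%:R,
      forall i j, rs_form Q (e i) (e j) = 0
    & forall i j, rs_form Q (f i) (f j) = 0].

(* [theta] takes values in representatives of classes modulo squares. *)
Definition theta_function theta : Prop :=
  [/\ forall h, Sp (rs_form Q) h -> theta h != 0,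
      forall p1 h p2, siegel p1 -> Sp (rs_form Q) h -> siegel p2 ->
        eq_mod_squares (theta (p1 \o h \o p2)%VF)
                       (theta p1 * theta h * theta p2),
      forall p, siegel p -> eq_mod_squares (theta p) (det_on x p)
    & exists e f, symplectic_basis e f /\
        forall (S : {set 'I_rs_l}) (tau : 'End(b)),
          (forall i, i \in S -> tau (e i) = f i /\ tau (f i) = - e i) ->
          (forall i, i \notin S -> tau (e i) = e i /\ tau (f i) = f i) ->
          eq_mod_squares (theta tau) 1].

Definition psibar (y : Fq) : C :=
  psi (lf_unif K ^ (lam - 1) * xget 0 [set z | lf_int K z /\ lf_red K z = y]).

Definition omega (a : Fq) : C :=
  (sqrtC #|Fq|%:R)^-1 * \sum_(t : Fq) psibar (2^-1 * a * t ^+ 2).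

Definition mfactor theta h : C :=
  (omega (theta h))^-1 * omega 1 ^ (1 - (rs_j h)%:Z).

Definition weil_op theta g phi : W -> C := fun w =>
  mfactor theta (reduction g) * sqrtC #|Fq|%:R ^+ rs_j (reduction g)
  * ((lat_index A (A `&` g @` A))%:R)^-1
  * \sum_(a \in reps A (A `&` g @` A))
      psi (2^-1 * beta a w) * phi ((g^-1)%VF (a + w)).

(* The section, meaningful over [stabilizer B]. *)
Definition weil_section theta g : 'End(W) * operator := (g, weil_op theta g).

(* [phi] is an eigenfunction of weight [chi] for the restriction to [T] of the
   Weil representation, [T] being lifted to Mp(W) by the section. *)
Definition eigenfunction theta (T : set 'End(W)) (chi : 'End(W) -> C) phi :
  Prop :=
  [/\ hilbert A phi, phi <> (fun=> 0)
    & forall t, T t ->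
        weil (weil_section theta t) phi = (fun w => chi t * phi w)].

Definition occurs theta (T : set 'End(W)) (chi : 'End(W) -> C) : Prop :=
  exists phi, eigenfunction theta T chi phi.

End Residual.
End Weil.

(** ** Irreducible tori and their lattices *)

Definition ext_trace (F : fieldType) (L : fieldExtType F) (x : L) : F :=
  \sum_(i < \dim {:L}) coord (vbasis {:L}) i (x * (vbasis {:L})`_i).

(* The identification of (W, T) with a quadratic extension k''/k' and its group
   of norm one elements; k' is given as a subfield [it_k1] of k'' = [it_k2]. *)
Record irreducibleTorus (k : fieldType) (Fq : finFieldType)
    (K : localField k Fq) (W : vectType k) (beta : W -> W -> k)
    (T : set 'End(W)) := IrreducibleTorus {
  it_k2 : fieldExtType k;
  it_k1 : {subfield it_k2};
  it_tau : {rmorphism it_k2 -> it_k2};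
  it_v1 : subvs_of it_k1 -> int;
  it_v2 : it_k2 -> int;
  it_e : nat;
  it_e2 : nat;
  it_delta : int;
  it_unif1 : subvs_of it_k1;
  it_unif2 : it_k2;
  it_u : it_k2;
  it_iso : 'Hom(W, it_k2);
  it_dim1 : (2 * \dim it_k1 = \dim {:W})%N;
  it_dim2 : (\dim {: it_k2} = 2 * \dim it_k1)%N;
  it_tauK : involutive it_tau;
  it_tau_fix : forall x, x \in it_k1 <-> it_tau x = x;
  it_v1P : normalized_valuation it_v1;
  it_v2P : normalized_valuation it_v2;
  it_eP : (0 < it_e)%N /\ forall c : k, c != 0 ->
    it_v1 (c%:A) = it_e%:Z * lf_val K c;
  it_e2P : (0 < it_e2)%N /\ forall x : subvs_of it_k1, x != 0 ->
    it_v2 (vsval x) = it_e2%:Z * it_v1 x;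
  (* Automatic, by uniqueness of the extension of a complete valuation. *)
  it_v2_tau : forall x, it_v2 (it_tau x) = it_v2 x;
  (* The inverse different is the dual of the integers for the trace. *)
  it_deltaP : forall x : subvs_of it_k1,
    (forall y, videal it_v1 0 y -> lf_int K (ext_trace (x * y)))
    <-> videal it_v1 (- it_delta) x;
  it_unif1P : it_unif1 != 0 /\ it_v1 it_unif1 = 1;
  it_unif2P : it_unif2 != 0 /\ it_v2 it_unif2 = 1;
  it_unif : if it_e2 == 1%N then it_unif2 = vsval it_unif1
            else it_unif2 ^+ 2 = vsval it_unif1;
  it_uP : it_u != 0 /\ it_u + it_tau it_u = 0;
  it_u_val : if it_e2 == 1%N then it_v2 it_u = 0 \/ it_v2 it_u = 1
             else it_u = it_unif2;
  it_isoP : bijective it_iso;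
  it_formE : forall x y,
    beta x y = 2^-1 * ext_trace (it_u * it_tau (it_iso x) * it_iso y);
  it_torusE : forall g, T g <->
    exists2 t, t * it_tau t = 1 & forall x, it_iso (g x) = t * it_iso x }.
Arguments it_v1 {k Fq K W beta T} _ _.
Arguments it_v2 {k Fq K W beta T} _ _.

Section TorusLattices.
Variables (k : fieldType) (Fq : finFieldType) (K : localField k Fq).
Variables (lam : int) (W : vectType k) (beta : W -> W -> k).
Variables (T : set 'End(W)) (D : irreducibleTorus K beta T).

Definition it_ramified : bool := it_e2 D != 1%N.

Definition it_mu : int := (it_e D)%:Z * lam - it_delta D - it_v2 D (it_u D).

(* The lattices, transported to [W] along the identification. *)
Definition it_B : set W :=
  [set w | exists2 y, videal (it_v2 D) 0 y &
     it_iso D w =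
       (if it_ramified then it_unif2 D ^ it_mu
        else vsval (it_unif1 D) ^ ((it_mu + 1) %/ 2)%Z) * y].

Definition it_nu : it_k2 D :=
  it_u D * vsval (it_unif1 D) ^ (- it_v2 D (it_u D)).

Definition it_A : set W :=
  [set w | (self_dual K lam beta it_B /\ it_B w) \/
     (~ self_dual K lam beta it_B /\
      exists y z : subvs_of (it_k1 D),
        [/\ videal (it_v1 D) 0 y, videal (it_v1 D) 0 z
          & it_iso D w = vsval (it_unif1 D) ^ ((it_mu - 1) %/ 2)%Z
              * (vsval y + vsval z * vsval (it_unif1 D) * it_nu)])].

End TorusLattices.

(** ** Orthogonal decompositions *)

Section Decomposition.
Variables (k : fieldType) (W : vectType k) (beta : W -> W -> k).
Variables (T : set 'End(W)) (n : nat) (Ws : 'I_n -> {vspace W}).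

Definition sub_form (i : 'I_n) (x y : subvs_of (Ws i)) : k :=
  beta (vsval x) (vsval y).

Definition restr (i : 'I_n) (g : 'End(W)) : 'End(subvs_of (Ws i)) :=
  linfun (fun x => vsproj (Ws i) (g (vsval x))).

Definition sub_torus (i : 'I_n) : set 'End(subvs_of (Ws i)) :=
  restr i @` T.

Definition component (i : 'I_n) (w : W) : subvs_of (Ws i) :=
  vsproj (Ws i) (sumv_pi (\sum_(j < n) Ws j)%VS i w).

(* The embedding of [T_i] in [T]: the identity on the other summands. *)
Definition embed (i : 'I_n) (t : 'End(subvs_of (Ws i))) : 'End(W) :=
  linfun (fun w => w - vsval (component i w) + vsval (t (component i w))).

Definition torus_decomposition : Prop :=
  [/\ (\sum_(i < n) Ws i)%VS = {:W}%VS /\ directv (\sum_(i < n) Ws i),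
      (forall i j, i != j -> forall x y, x \in Ws i -> y \in Ws j ->
         beta x y = 0),
      (forall i, symplectic_form (@sub_form i)),
      (forall i, [/\ Ws i != 0%VS, (forall t, T t -> (t @: Ws i <= Ws i)%VS)
         & forall U : {vspace W}, (U <= Ws i)%VS ->
             (forall t, T t -> (t @: U <= U)%VS) -> U = 0%VS \/ U = Ws i])
      (* restriction identifies [T] with the product of the [T_i] *)
    & forall t : forall i, 'End(subvs_of (Ws i)),
        (forall i, @sub_torus i (t i)) ->
        exists2 g, T g & forall i, restr i g = t i].

Definition sum_lattice (L : forall i, set (subvs_of (Ws i))) : set W :=
  [set w | forall i, L i (component i w)].

Definition tensor (R : realType) (phi : forall i, subvs_of (Ws i) -> R[i]) :
  W -> R[i] := fun w => \prod_(i < n) phi i (component i w).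

End Decomposition.

Arguments sub_form {k W} beta {n} Ws i x y.
Arguments sub_torus {k W} T {n} Ws i _.
Arguments component {k W n} Ws i w.
Arguments embed {k W n} Ws i t.

(* Main.v *)
Require Import Defs.
From HB Require Import structures.
From mathcomp Require Import all_boot all_order all_algebra all_field.
From mathcomp Require Import finmap.
From mathcomp Require Import boolp classical_sets functions cardinality fsbigop.
From mathcomp Require Import reals constructive_ereal ereal esum.
From mathcomp Require Import complex.
From mathcomp Require Import zify ring.
Set Implicit Arguments.
Unset Strict Implicit.
Unset Printing Implicit Defensive.
Import Order.TTheory GRing.Theory Num.Theory.
Local Open Scope classical_set_scope.
Local Open Scope ring_scope.

(** Everything rests on the factorization S(g) (phi_1 (x) ... (x) phi_n) =
    S_1(g_1) phi_1 (x) ... (x) S_n(g_n) phi_n for g = (g_1, ..., g_n) in T. The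
    sum over A / (A n gA) splits because A and gA are direct sums of lattices
    of the W_i, so the point is the factorization of the scalar. Over the finite
    field, omega(a) / omega(1) is multiplicative on classes modulo squares,
    hence it suffices that j is additive and that theta is multiplicative for
    the decomposition of B^* / B. Both invariants are read off the Bruhat
    decomposition: every isometry h of B^* / B admits a symplectic basis (E, G),
    with E spanning x, such that h maps E to the columns of a matrix C in the
    family obtained from E by replacing E_s by G_s for s in a set S, and then
    theta(h) = det C modulo squares and j(h) = #|S|. Such normal forms add up.

    Weights are multiplicative over the T_i, so a tensor product of
    eigenfunctions is an eigenfunction. Conversely, if phi(w_0) <> 0,
    restricting an eigenfunction phi to the coset w_0 + W_i gives an
    eigenfunction for T_i. *)

(** * Families of vectors and matrices *)

Lemma det_mxdiag (R : comNzRingType) n (l : 'I_n -> nat)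
    (C : forall i, 'M[R]_(l i)) :
  \det (\mxdiag_i C i) = \prod_i \det (C i).
Proof.
elim: n l C => [|n IHn] l C.
  rewrite [RHS]big_ord0; move: (\mxdiag_i C i); rewrite big_ord0 => M.
  exact: det_mx00.
rewrite mxdiag_recl [RHS]big_ord_recl -IHn -(det_ublock _ 0).
by case: _ / mxsize_recl; rewrite castmx_id.
Qed.

Lemma linfunE (F : fieldType) (V V' : vectType F) (f : V -> V') :
  linear f -> linfun f =1 f.
Proof.
move=> fL v; pose g : {linear V -> V'} :=
  HB.pack f (GRing.isLinear.Build F V V' *:%R f fL).
by rewrite (lfunE g).
Qed.

Section LinearCombinations.
Variables (F : comNzRingType) (V : lmodType F).

Definition lincomb m n (X : 'I_m -> V) (C : 'M[F]_(m, n)) (j : 'I_n) : V :=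
  \sum_i C i j *: X i.

Lemma lincomb1 m (X : 'I_m -> V) : lincomb X 1%:M = X.
Proof.
apply/funext=> j; rewrite /lincomb (bigD1 j) //= mxE eqxx scale1r.
rewrite big1 ?addr0 //.
by move=> i /negPf ij; rewrite mxE ij scale0r.
Qed.

Lemma lincombB m n (X : 'I_m -> V) (C D : 'M_(m, n)) j :
  lincomb X (C - D) j = lincomb X C j - lincomb X D j.
Proof.
by rewrite /lincomb -sumrB; apply: eq_bigr => i _; rewrite !mxE scalerBl.
Qed.

Lemma lincombDl m n (X Y : 'I_m -> V) (C : 'M_(m, n)) :
  lincomb (X \+ Y) C = lincomb X C \+ lincomb Y C.
Proof.
apply/funext=> j; rewrite /lincomb /= -big_split.
by apply: eq_bigr => i _; rewrite scalerDr.
Qed.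

Lemma lincombDr m n (X : 'I_m -> V) (C D : 'M_(m, n)) :
  lincomb X (C + D) = lincomb X C \+ lincomb X D.
Proof.
apply/funext=> j; rewrite /lincomb /= -big_split.
by apply: eq_bigr => i _; rewrite mxE scalerDl.
Qed.

Lemma lincombM m n p (X : 'I_m -> V) (C : 'M_(m, n)) (D : 'M_(n, p)) :
  lincomb (lincomb X C) D = lincomb X (C *m D).
Proof.
apply/funext=> j; rewrite /lincomb; under eq_bigr do rewrite scaler_sumr.
rewrite exchange_big; apply: eq_bigr => i _ /=.
by rewrite mxE scaler_suml; apply: eq_bigr => h _; rewrite scalerA mulrC.
Qed.

End LinearCombinations.

Lemma comp_lincomb (F : comNzRingType) (V V' : lmodType F)
    (f : {linear V -> V'}) m n (X : 'I_m -> V) (C : 'M_(m, n)) :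
  f \o lincomb X C = lincomb (f \o X) C.
Proof.
apply/funext=> j; rewrite /= linear_sum.
by apply: eq_bigr => i _; rewrite linearZ.
Qed.

Section SpansAndCoordinates.
Variables (F : fieldType) (V : vectType F).
Implicit Types (U : {vspace V}).

Lemma span_codomP m (X : 'I_m -> V) v :
  reflect (exists c : 'cV_m, v = lincomb X c 0) (v \in <<codom X>>%VS).
Proof.
apply: (iffP idP) => [/(coord_span (X := [tuple X i | i < m])) vE|[c ->]].
  exists (\col_i coord [tuple X i | i < m] i v); rewrite {1}vE.
  by apply: eq_bigr => i _; rewrite mxE -tnth_nth tnth_mktuple.
by apply: memv_suml => i _; apply/memvZ/memv_span/codom_f.
Qed.

Lemma span_lincombP m n (X : 'I_m -> V) (Y : 'I_n -> V) :
  (<<codom Y>> <= <<codom X>>)%VS <-> exists C, Y = lincomb X C.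
Proof.
split=> [sYX|[C YE]]; last first.
  apply/span_subvP=> _ /codomP[j ->]; apply/span_codomP.
  by exists (col j C); rewrite YE; apply: eq_bigr => i _; rewrite mxE.
have /fin_all_exists[c cE] j : exists c : 'cV_m, Y j = lincomb X c 0.
  by apply/span_codomP/(subvP sYX)/memv_span/codom_f.
exists (\matrix_(i, j) c j i 0); apply/funext=> j; rewrite cE.
by apply: eq_bigr => i _; rewrite mxE.
Qed.

Lemma span_lincomb_unit m (X : 'I_m -> V) (P : 'M_m) : P \in unitmx ->
  <<codom (lincomb X P)>>%VS = <<codom X>>%VS.
Proof.
move=> Pu; apply/eqP; rewrite eqEsubv; apply/andP; split; apply/span_lincombP.
  by exists P.
by exists (invmx P); rewrite lincombM mulmxV // lincomb1.
Qed.

Lemma free_codomP m (X : 'I_m -> V) :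
  free (codom X) <-> forall c : 'cV_m, lincomb X c 0 = 0 -> c = 0.
Proof.
split=> [/(@freeP _ _ _ [tuple X i | i < m]) freeX c c0|freeX].
  apply/colP=> i; rewrite mxE; move: i; apply: freeX; rewrite -[RHS]c0.
  by apply: eq_bigr => i _; rewrite -tnth_nth tnth_mktuple.
apply/(@freeP _ _ _ [tuple X i | i < m]) => k k0 i.
have /colP/(_ i) : \col_i k i = 0; last by rewrite !mxE.
apply: freeX; rewrite -[RHS]k0; apply: eq_bigr => h _.
by rewrite mxE -tnth_nth tnth_mktuple.
Qed.

Lemma lincomb_inj m n (X : 'I_m -> V) (C D : 'M_(m, n)) :
  free (codom X) -> lincomb X C = lincomb X D -> C = D.
Proof.
move=> /free_codomP freeX CD; apply/eqP; rewrite -subr_eq0; apply/eqP/matrixP.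
move=> i j; have /freeX/colP/(_ i) : lincomb X (col j (C - D)) 0 = 0.
  rewrite -[RHS](subrr (lincomb X C j)) {2}CD -lincombB.
  by apply: eq_bigr => h _; rewrite mxE.
by rewrite !mxE.
Qed.

Definition vbasis_family U (i : 'I_(\dim U)) : V := (vbasis U)`_i.

Lemma codom_vbasis_family U : codom (vbasis_family (U := U)) = vbasis U.
Proof.
apply: (@eq_from_nth _ 0) => [|i]; rewrite size_codom card_ord ?size_tuple //.
move=> iU; rewrite (nth_map (Ordinal iU)) ?size_enum_ord //.
by rewrite /vbasis_family nth_enum_ord.
Qed.

Lemma free_vbasis_family U : free (codom (vbasis_family (U := U))).
Proof. by rewrite codom_vbasis_family (basis_free (vbasisP U)). Qed.

Lemma span_vbasis_family U : <<codom (vbasis_family (U := U))>>%VS = U.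
Proof. by rewrite codom_vbasis_family (span_basis (vbasisP U)). Qed.

(* The coordinates of [f] on [vbasis U] form the rows of the matrix below, hence
   the transpose. *)
Lemma coord_vbasis_conj U m (X : 'I_m -> V) (f : 'End(V)) (C : 'M_m) :
  free (codom X) -> <<codom X>>%VS = U -> f \o X = lincomb X C ->
  exists M N, [/\ M *m N = 1%:M, N *m M = 1%:M &
    (\matrix_(i < \dim U, j < \dim U)
       coord (vbasis U) j (f (vbasis U)`_i))^T = N *m C *m M].
Proof.
move=> freeX XU fX; pose Y := vbasis_family (U := U).
have [freeY YU] := (free_vbasis_family U, span_vbasis_family U).
have [M YM] : exists M, Y = lincomb X M.
  by apply/span_lincombP; rewrite XU YU.
have [N XN] : exists N, X = lincomb Y N.
  by apply/span_lincombP; rewrite XU YU.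
exists M, N; split.
- by apply: lincomb_inj freeX _; rewrite -lincombM -YM -XN lincomb1.
- by apply: lincomb_inj freeY _; rewrite -lincombM -XN -YM lincomb1.
have fY : f \o Y = lincomb Y (N *m C *m M).
  by rewrite -mulmxA -lincombM -XN -lincombM -fX {1}YM comp_lincomb.
apply: lincomb_inj freeY _; rewrite -fY; apply/funext=> j /=.
have YinU i : Y i \in U by rewrite -YU; apply/memv_span/codom_f.
have fYU : f (Y j) \in U.
  by rewrite -[f _]/((f \o Y) j) fY memv_suml // => i _; apply: memvZ.
rewrite [RHS](coord_basis (vbasisP U) fYU).
by apply: eq_bigr => i _; rewrite !mxE.
Qed.

Lemma det_coord_vbasis U m (X : 'I_m -> V) (f : 'End(V)) (C : 'M_m) :
  free (codom X) -> <<codom X>>%VS = U -> f \o X = lincomb X C ->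
  \det (\matrix_(i < \dim U, j < \dim U)
          coord (vbasis U) j (f (vbasis U)`_i)) = \det C.
Proof.
move=> freeX XU fX; have [M [N [MN _ E]]] := coord_vbasis_conj freeX XU fX.
have Um : m = \dim U by rewrite -XU (eqP freeX) size_codom card_ord.
subst m; rewrite -det_tr E !det_mulmx mulrC mulrA -det_mulmx MN.
by rewrite det1 mul1r.
Qed.

Lemma trace_coord_vbasis U m (X : 'I_m -> V) (f : 'End(V)) (C : 'M_m) :
  free (codom X) -> <<codom X>>%VS = U -> f \o X = lincomb X C ->
  \sum_(i < \dim U) coord (vbasis U) i (f (vbasis U)`_i) = \tr C.
Proof.
move=> freeX XU fX; have [M [N [MN _ E]]] := coord_vbasis_conj freeX XU fX.
rewrite -[C in RHS]mulmx1 -MN mulmxA mxtrace_mulC mulmxA -E mxtrace_tr.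
by apply: eq_bigr => i _; rewrite mxE.
Qed.

End SpansAndCoordinates.

(** * Darboux bases *)

Definition skew_bilinear (F : comNzRingType) (V : lmodType F)
    (form : V -> V -> F) : Prop :=
  (forall a x y z, form (a *: x + y) z = a * form x z + form y z) /\
  (forall x y, form x y = - form y x).

Section SkewBilinear.
Variables (F : comNzRingType) (V : lmodType F) (form : V -> V -> F).
Hypothesis formP : skew_bilinear form.

Lemma skewC x y : form x y = - form y x.
Proof. by case: formP => _; apply. Qed.

Lemma skewDl x y z : form (x + y) z = form x z + form y z.
Proof. by case: formP => formL _; rewrite -[x]scale1r formL mul1r scale1r. Qed.

Lemma skew0l z : form 0 z = 0.
Proof. by apply: (addrI (form 0 z)); rewrite -skewDl !addr0. Qed.

Lemma skewZl a x z : form (a *: x) z = a * form x z.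
Proof.
by case: formP => formL _; rewrite -[a *: x]addr0 formL skew0l addr0.
Qed.

Lemma skewNl x z : form (- x) z = - form x z.
Proof. by rewrite -scaleN1r skewZl mulN1r. Qed.

Lemma skewDr x y z : form z (x + y) = form z x + form z y.
Proof. by rewrite skewC skewDl opprD -!skewC. Qed.

Lemma skew0r z : form z 0 = 0.
Proof. by rewrite skewC skew0l oppr0. Qed.

Lemma skewZr a x z : form z (a *: x) = a * form z x.
Proof. by rewrite skewC skewZl -mulrN -skewC. Qed.

Lemma skewNr x z : form z (- x) = - form z x.
Proof. by rewrite skewC skewNl -skewC. Qed.

Lemma skew_suml I r (P : pred I) (X : I -> V) z :
  form (\sum_(i <- r | P i) X i) z = \sum_(i <- r | P i) form (X i) z.
Proof. exact: (big_morph (form^~ z) (fun x y => skewDl x y z) (skew0l z)). Qed.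

Lemma skew_sumr I r (P : pred I) (X : I -> V) z :
  form z (\sum_(i <- r | P i) X i) = \sum_(i <- r | P i) form z (X i).
Proof. exact: (big_morph (form z) (fun x y => skewDr x y z) (skew0r z)). Qed.

Definition gram m n (X : 'I_m -> V) (Y : 'I_n -> V) : 'M_(m, n) :=
  \matrix_(i, j) form (X i) (Y j).

Lemma gramC m n (X : 'I_m -> V) (Y : 'I_n -> V) : gram X Y = - (gram Y X)^T.
Proof. by apply/matrixP=> i j; rewrite !mxE skewC. Qed.

Lemma gramDr m n (X : 'I_m -> V) (Y Z : 'I_n -> V) :
  gram X (Y \+ Z) = gram X Y + gram X Z.
Proof. by apply/matrixP=> i j; rewrite !mxE skewDr. Qed.

Lemma gramDl m n (X Y : 'I_m -> V) (Z : 'I_n -> V) :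
  gram (X \+ Y) Z = gram X Z + gram Y Z.
Proof. by apply/matrixP=> i j; rewrite !mxE skewDl. Qed.

Lemma gram_lincombl m n p (X : 'I_m -> V) (C : 'M_(m, n)) (Y : 'I_p -> V) :
  gram (lincomb X C) Y = C^T *m gram X Y.
Proof.
apply/matrixP=> i j; rewrite !mxE skew_suml.
by apply: eq_bigr => h _; rewrite !mxE skewZl.
Qed.

Lemma gram_lincombr m n p (X : 'I_m -> V) (C : 'M_(n, p)) (Y : 'I_n -> V) :
  gram X (lincomb Y C) = gram X Y *m C.
Proof. by rewrite gramC gram_lincombl trmx_mul trmxK -mulNmx -gramC. Qed.

End SkewBilinear.

Section DarbouxBases.
Variables (F : fieldType) (V : vectType F) (form : V -> V -> F).
Hypothesis formP : skew_bilinear form.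
Local Notation gram := (gram form).

Lemma free_gram m (X Y : 'I_m -> V) : gram X Y \in unitmx -> free (codom X).
Proof.
move=> gu; apply/free_codomP => c c0; apply: trmx_inj; rewrite trmx0.
apply: (can_inj (mulmxK gu)); rewrite mul0mx -(gram_lincombl formP).
by apply/matrixP=> i j; rewrite !mxE ord1 c0 (skew0l formP).
Qed.

Definition darboux_family l (e f : 'I_l -> V) : Prop :=
  [/\ gram e f = 1%:M, gram e e = 0 & gram f f = 0].

Definition darboux_basis l (e f : 'I_l -> V) : Prop :=
  darboux_family e f /\ <<codom e ++ codom f>>%VS = {:V}%VS.

Section OneFamily.
Variables (l : nat) (e f : 'I_l -> V).
Hypothesis ef : darboux_family e f.

Lemma darboux_gramC : gram f e = - 1%:M.
Proof. by case: ef => efE _ _; rewrite (gramC formP) efE trmx1. Qed.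

Lemma darboux_freel : free (codom e).
Proof.
by case: ef => efE _ _; apply: (@free_gram _ _ f); rewrite efE unitmx1.
Qed.

Lemma darboux_freer : free (codom f).
Proof.
apply: (@free_gram _ _ e).
by rewrite darboux_gramC -scaleN1r unitmxZ ?unitmx1 // unitrN1.
Qed.

Lemma darboux_forml v i : v \in <<codom e>>%VS -> form (e i) v = 0.
Proof.
case: ef => _ ee _ /span_codomP[c ->].
have /matrixP/(_ i 0) : gram e (lincomb e c) = 0.
  by rewrite (gram_lincombr formP) ee mul0mx.
by rewrite !mxE.
Qed.

Lemma darboux_formr v i : v \in <<codom f>>%VS -> form v (f i) = 0.
Proof.
case: ef => _ _ ff /span_codomP[c ->].
have /matrixP/(_ 0 i) : gram (lincomb f c) f = 0.
  by rewrite (gram_lincombl formP) ff mulmx0.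
by rewrite !mxE.
Qed.

Lemma darboux_coordl (c : 'cV_l) i : form (lincomb e c 0) (f i) = c i 0.
Proof.
case: ef => efE _ _; have /matrixP/(_ 0 i) : gram (lincomb e c) f = c^T.
  by rewrite (gram_lincombl formP) efE mulmx1.
by rewrite !mxE.
Qed.

Lemma darboux_coordr (c : 'cV_l) i : form (e i) (lincomb f c 0) = c i 0.
Proof.
case: ef => efE _ _; have /matrixP/(_ i 0) : gram e (lincomb f c) = c.
  by rewrite (gram_lincombr formP) efE mul1mx.
by rewrite !mxE.
Qed.

Lemma darboux_span_expand v : v \in <<codom e ++ codom f>>%VS ->
  v = \sum_i form v (f i) *: e i + \sum_i form (e i) v *: f i.
Proof.
rewrite span_cat => /memv_addP[a ae [b bf ->]].
have [/span_codomP[ca aE] /span_codomP[cb bE]] := (ae, bf).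
congr (_ + _); [rewrite {1}aE | rewrite {1}bE];
    apply: eq_bigr => i _; congr (_ *: _).
  by rewrite (skewDl formP) (darboux_formr _ bf) addr0 aE darboux_coordl.
by rewrite (skewDr formP) (darboux_forml _ ae) add0r bE darboux_coordr.
Qed.

Lemma gram_darboux m n (a b : 'M_(l, m)) (c d : 'M_(l, n)) :
  gram (lincomb e a \+ lincomb f b) (lincomb e c \+ lincomb f d)
    = a^T *m d - b^T *m c.
Proof.
have [efE ee ff] := ef; rewrite (gramDl formP) !(gramDr formP).
rewrite !(gram_lincombl formP) !(gram_lincombr formP) efE ee ff darboux_gramC.
by rewrite !mul0mx !mulmx0 mul1mx mulNmx mul1mx mulmxN add0r addr0.
Qed.

Lemma dim_lagrangian : \dim <<codom e>>%VS = l.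
Proof. by rewrite (eqP darboux_freel) size_codom card_ord. Qed.

Lemma dim_darboux_span : \dim <<codom e ++ codom f>>%VS = l.*2.
Proof.
rewrite span_cat dimv_disjoint_sum.
  by rewrite dim_lagrangian (eqP darboux_freer) size_codom card_ord addnn.
apply/eqP; rewrite -subv0; apply/subvP=> v; rewrite memv_cap memv0.
case/andP=> ve vf; rewrite [v]darboux_span_expand; last first.
  by rewrite span_cat; apply: (subvP (addvSl _ _)).
rewrite !big1 ?addr0 // => i _; first by rewrite darboux_forml ?scale0r.
by rewrite darboux_formr ?scale0r.
Qed.

End OneFamily.

Lemma darboux_family_basis l (e f X Y : 'I_l -> V) :
  darboux_basis e f -> darboux_family X Y -> darboux_basis X Y.
Proof.
move=> [ef efV] XY; split=> //; apply/eqP.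
by rewrite eqEdim subvf -efV (dim_darboux_span ef) (dim_darboux_span XY) leqnn.
Qed.

Section OneBasis.
Variables (l : nat) (e f : 'I_l -> V).
Hypothesis ef : darboux_basis e f.

Lemma darboux_expand v :
  v = \sum_i form v (f i) *: e i + \sum_i form (e i) v *: f i.
Proof.
by case: ef => efP efV; apply: darboux_span_expand; rewrite // efV memvf.
Qed.

Lemma dim_darboux : \dim {:V} = l.*2.
Proof. by case: ef => efP <-; apply: dim_darboux_span. Qed.

Lemma darboux_nondegenerate v : (forall w, form v w = 0) -> v = 0.
Proof.
move=> v0; rewrite (darboux_expand v) !big1 ?addr0 // => i _.
  by rewrite (skewC formP) v0 oppr0 scale0r.
by rewrite v0 scale0r.
Qed.

Lemma darboux_formE v w :
  form v w = \sum_i form v (f i) * form (e i) w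
             - \sum_i form (e i) v * form w (f i).
Proof.
rewrite {1}(darboux_expand v) (skewDl formP) !(skew_suml formP).
rewrite -sumrN; congr (_ + _); apply: eq_bigr => i _; rewrite (skewZl formP) //.
by rewrite (skewC formP (f i)) mulrN.
Qed.

Lemma lker0_isometry (g : 'End(V)) : Sp form g -> lker g == 0%VS.
Proof.
move=> gS; apply/lker0P=> x y E; apply/eqP; rewrite -subr_eq0; apply/eqP.
apply: darboux_nondegenerate => w.
by rewrite -gS linearB /= E subrr (skew0l formP).
Qed.

Lemma darboux_change (P : 'M_l) : P \in unitmx ->
  darboux_basis (lincomb e P) (lincomb f (invmx P)^T).
Proof.
move=> Pu; apply: (darboux_family_basis ef); have [[efE ee ff] _] := ef.
split; rewrite (gram_lincombl formP) (gram_lincombr formP) ?ee ?ff.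
- by rewrite efE mul1mx -trmx_mul mulVmx // trmx1.
- by rewrite mul0mx mulmx0.
- by rewrite mul0mx mulmx0.
Qed.

Lemma darboux_shear (s : 'M_l) : s^T = s -> darboux_basis e (f \+ lincomb e s).
Proof.
move=> sT; apply: (darboux_family_basis ef); have [[efE ee ff] _] := ef.
split=> //; rewrite ?(gramDl formP) (gramDr formP) (gram_lincombr formP) ?ee.
  by rewrite efE mul0mx addr0.
rewrite (gramDr formP) !(gram_lincombl formP) (gram_lincombr formP) efE.
rewrite (darboux_gramC ef.1) ff ee mul0mx mulmx0 mulNmx mul1mx mulmx1 sT.
by rewrite addr0 add0r addNr.
Qed.

End OneBasis.

Section Exchange.
Variables (l : nat) (S : {set 'I_l}).

Definition exchange (X Y : 'I_l -> V) (i : 'I_l) : V :=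
  if i \in S then Y i else X i.

Definition select_mx : 'M[F]_l := diag_mx (\row_i (i \in S)%:R).

Lemma tr_select_mx : select_mx^T = select_mx.
Proof. exact: tr_diag_mx. Qed.

Lemma select_mx_idem : select_mx *m select_mx = select_mx.
Proof.
rewrite mulmx_diag; congr diag_mx; apply/rowP=> i; rewrite !mxE.
by case: (i \in S); rewrite ?mulr1 ?mulr0.
Qed.

Lemma exchangeE X Y :
  exchange X Y = lincomb X (1%:M - select_mx) \+ lincomb Y select_mx.
Proof.
have selE Z j : lincomb Z select_mx j = (j \in S)%:R *: Z j.
  rewrite /lincomb (bigD1 j) //= !mxE eqxx mulr1n big1 ?addr0 // => i /negPf ij.
  by rewrite !mxE ij scale0r.
apply/funext=> j; rewrite /= lincombB lincomb1 !selE /exchange.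
by case: (j \in S); rewrite ?scale1r ?scale0r ?subrr ?add0r ?subr0 ?addr0.
Qed.

Lemma darboux_exchange e f : darboux_basis e f ->
  darboux_basis (exchange e f) (exchange f (\- e)).
Proof.
move=> ef; apply: (darboux_family_basis ef); have [efP _] := ef.
have -> : exchange f (\- e) =
    lincomb e (- select_mx) \+ lincomb f (1%:M - select_mx).
  rewrite exchangeE; apply/funext=> j; rewrite /= addrC; congr (_ + _).
  by apply: eq_bigr => i _; rewrite /= !mxE scalerN scaleNr.
rewrite exchangeE; set p := select_mx; set q := 1%:M - p.
have pT : p^T = p := tr_select_mx; have pp : p *m p = p := select_mx_idem.
have qT : q^T = q by rewrite linearB /= pT trmx1.
have pq : p *m q = 0 by rewrite mulmxBr mulmx1 pp subrr.
have qp : q *m p = 0 by rewrite mulmxBl mul1mx pp subrr.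
have NpT : (- p)^T = - p by rewrite linearN /= pT.
split; rewrite (gram_darboux efP) qT ?NpT ?pT.
- by rewrite mulmxN pp opprK {1}/q mulmxBl mul1mx pq subr0 subrK.
- by rewrite qp pq subrr.
- by rewrite mulNmx mulmxN pq qp subrr.
Qed.

End Exchange.

End DarbouxBases.

Section DarbouxMaps.
Variables (F : fieldType) (V : vectType F) (form : V -> V -> F).
Hypothesis formP : skew_bilinear form.
Local Notation gram := (gram form).
Local Notation darboux_basis := (darboux_basis form).

Definition darboux_map l (e f E G : 'I_l -> V) : 'End(V) :=
  linfun (fun v => \sum_i form v (f i) *: E i + \sum_i form (e i) v *: G i).

Section TwoBases.
Variables (l : nat) (e f E G : 'I_l -> V).
Hypotheses (ef : darboux_basis e f) (EG : darboux_basis E G).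

Lemma darboux_mapE v : darboux_map e f E G v =
  \sum_i form v (f i) *: E i + \sum_i form (e i) v *: G i.
Proof.
rewrite linfunE // => a x y; rewrite scalerDr !scaler_sumr -!big_split.
apply: eq_bigr => i _ /=; rewrite (skewDl formP) (skewDr formP).
by rewrite (skewZl formP) (skewZr formP) !scalerDl !scalerA addrACA.
Qed.

Lemma darboux_map_l i : darboux_map e f E G (e i) = E i.
Proof.
have [[efE ee _] _] := ef; rewrite darboux_mapE [X in _ + X]big1 => [|j _].
  rewrite addr0 -[E in RHS]lincomb1 -trmx1 -efE.
  by apply: eq_bigr => j _; rewrite !mxE.
by have /matrixP/(_ j i) := ee; rewrite !mxE => ->; rewrite scale0r.
Qed.

Lemma darboux_map_r i : darboux_map e f E G (f i) = G i.
Proof.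
have [[efE _ ff] _] := ef; rewrite darboux_mapE [X in X + _]big1 => [|j _].
  rewrite add0r -[G in RHS]lincomb1 -efE.
  by apply: eq_bigr => j _; rewrite !mxE.
by have /matrixP/(_ i j) := ff; rewrite !mxE => ->; rewrite scale0r.
Qed.

Lemma darboux_map_Sp : Sp form (darboux_map e f E G).
Proof.
have lincombE (X : 'I_l -> V) (c : 'I_l -> F) :
    \sum_i c i *: X i = lincomb X (\col_i c i) 0.
  by apply: eq_bigr => i _; rewrite mxE.
have [EGP _] := EG.
have mapr v i : form (darboux_map e f E G v) (G i) = form v (f i).
  rewrite darboux_mapE (skewDl formP) !lincombE (darboux_coordl formP EGP).
  rewrite (darboux_formr formP EGP) ?addr0 ?mxE //.
  by apply/span_codomP; eexists.
have mapl v i : form (E i) (darboux_map e f E G v) = form (e i) v.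
  rewrite darboux_mapE (skewDr formP) !lincombE (darboux_coordr formP EGP).
  rewrite (darboux_forml formP EGP) ?add0r ?mxE //.
  by apply/span_codomP; eexists.
move=> v w; rewrite (darboux_formE formP EG) (darboux_formE formP ef).
by congr (_ - _); apply: eq_bigr => i _; rewrite mapl mapr.
Qed.

End TwoBases.

Lemma darboux_mapK l (e f E G : 'I_l -> V) :
  darboux_basis e f -> darboux_basis E G ->
  (darboux_map E G e f \o darboux_map e f E G)%VF = \1%VF.
Proof.
move=> ef EG; apply/lfunP=> v; rewrite comp_lfunE id_lfunE (darboux_mapE e f).
rewrite linearD !linear_sum {3}(darboux_expand formP ef v).
by congr (_ + _); apply: eq_bigr => i _;
  rewrite linearZ /= ?(darboux_map_l _ _ EG) ?(darboux_map_r _ _ EG).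
Qed.

Lemma family_expand l (e f : 'I_l -> V) n (X : 'I_n -> V) : darboux_basis e f ->
  X = lincomb e (gram X f)^T \+ lincomb f (gram e X).
Proof.
move=> ef; apply/funext=> j; rewrite {1}[X j](darboux_expand formP ef) /=.
by congr (_ + _); apply: eq_bigr => i _; rewrite !mxE.
Qed.

(* The normal form of an isometry [h] in the Bruhat decomposition of [Sp] with
   respect to the stabilizer of the Lagrangian [x]. *)
Definition bruhat_form (x : {vspace V}) (h : 'End(V)) l (E G : 'I_l -> V)
    (S : {set 'I_l}) (C : 'M[F]_l) : Prop :=
  [/\ darboux_basis E G, <<codom E>>%VS = x
    & h \o E = lincomb (exchange S E G) C].

Section BruhatForms.
Variables (l : nat) (h : 'End(V)).
Hypothesis hS : Sp form h.

Lemma gram_isometry m n (X : 'I_m -> V) (Y : 'I_n -> V) :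
  gram (h \o X) (h \o Y) = gram X Y.
Proof. by apply/matrixP=> i j; rewrite !mxE hS. Qed.

Lemma isometry_rank_form (e f : 'I_l -> V) : darboux_basis e f ->
  exists (E G : 'I_l -> V) (U A : 'M_l) r,
    [/\ darboux_basis E G, <<codom E>>%VS = <<codom e>>%VS, U \in unitmx
      & h \o lincomb E U = lincomb E A \+ lincomb G (pid_mx r)].
Proof.
move=> ef; have heE := family_expand (h \o e) ef.
set a := (gram _ f)^T in heE; set b := gram e _ in heE.
pose L := col_ebase b; pose R := row_ebase b.
have [Lu Ru] : L \in unitmx /\ R \in unitmx.
  by rewrite col_ebase_unit row_ebase_unit.
pose P := (invmx L)^T; have Pu : P \in unitmx by rewrite unitmx_tr unitmx_inv.
have PVT : (invmx P)^T = L by rewrite -trmx_inv trmxK invmxK.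
exists (lincomb e P), (lincomb f L), (invmx P *m invmx R).
exists (invmx P *m a *m invmx R), (\rank b); split.
- by rewrite -PVT; apply: darboux_change.
- exact: span_lincomb_unit.
- by rewrite unitmx_mul !unitmx_inv Pu.
rewrite !lincombM !mulmxA mulmxV // !mul1mx comp_lincomb heE lincombDl.
by rewrite !lincombM -[b in LHS]mulmx_ebase mulmxK.
Qed.

Lemma pid_select_mx r : pid_mx r = select_mx F [set i : 'I_l | (i < r)%N].
Proof.
by apply/matrixP=> i j; rewrite !mxE inE -val_eqE; case: eqP.
Qed.

(* In the basis [E, G] of the rank form, isotropy of [h x] makes the part of [A]
   facing the image of [pid_mx r] symmetric, so that a shear absorbs it. *)
Lemma bruhat_exists (e f : 'I_l -> V) : darboux_basis e f ->
  exists (E G : 'I_l -> V) S C, bruhat_form <<codom e>> h E G S C.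
Proof.
move=> /isometry_rank_form[E [G [U [A [r [EG Ee Uu hE]]]]]].
have := gram_isometry (lincomb E U) (lincomb E U); rewrite hE.
rewrite (gram_lincombl formP E) (gram_lincombr formP).
have [efP _] := EG; have [_ -> _] := efP.
rewrite mul0mx mulmx0 (gram_darboux formP efP).
move: hE; rewrite pid_select_mx; set S := finset _; set p := select_mx F S.
move=> hE; have pT : p^T = p := tr_select_mx F S.
have pp : p *m p = p := select_mx_idem F S.
rewrite pT => /eqP; rewrite subr_eq0 => /eqP ATp.
have pA : p *m A *m (1%:M - p) = 0.
  by rewrite -ATp mulmxBr mulmx1 -mulmxA pp subrr.
have {}pA : p *m A = p *m A *m p.
  by apply/eqP; rewrite -subr_eq0 -{1}[p *m A]mulmx1 -mulmxBr pA.
pose s := A *m p + p *m A^T - p *m A *m p.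
have sT : s^T = s.
  by rewrite /s -pA linearB linearD /= !trmx_mul pT trmxK ATp [_ + A *m p]addrC.
pose D := p + A *m (1%:M - p).
have pD : p *m D = p.
  by rewrite mulmxDr pp mulmxA mulmxBr mulmx1 -pA subrr addr0.
have sD : (1%:M - p + s *m p) *m D = A.
  have sp : s *m p = A *m p.
    by rewrite /s mulmxBl mulmxDl -!mulmxA pp ATp !mulmxA pp -pA addrK.
  rewrite mulmxDl sp mulmxBl mul1mx pD -mulmxA pD /D [p + _]addrC addrK mulmxBr.
  by rewrite mulmx1 subrK.
exists E, (G \+ lincomb E s), S, (D *m invmx U).
split=> //; first exact: darboux_shear.
have -> : h \o E = lincomb (h \o lincomb E U) (invmx U).
  by rewrite -comp_lincomb lincombM mulmxV // lincomb1.
rewrite -lincombM hE; congr lincomb.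
rewrite exchangeE !lincombDl !lincombM -/p pD.
apply/funext=> j; rewrite /= addrCA addrC; congr (_ + _).
by rewrite -[A in LHS]sD mulmxDl lincombDr -mulmxA pD.
Qed.

(* The map tau_S in the definition of [theta_function]. *)
Definition partial_flip (e f : 'I_l -> V) (S : {set 'I_l}) : 'End(V) :=
  darboux_map e f (exchange S e f) (exchange S f (\- e)).

Lemma bruhat_factorization (x : {vspace V}) (e f E G : 'I_l -> V) S C :
  darboux_basis e f -> bruhat_form x h E G S C ->
  exists p r, [/\ Sp form p /\ Sp form r, p \o e = E, r \o E = lincomb e C
    & h = (p \o partial_flip e f S \o r)%VF].
Proof.
move=> ef [EG _ hE]; have XY := darboux_exchange formP S ef.
rewrite /partial_flip.
set X := exchange S e f in XY *; set Y := exchange S f _ in XY *.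
pose p := darboux_map e f E G; pose pV := darboux_map E G e f.
pose tV := darboux_map X Y e f; exists p, (tV \o pV \o h)%VF; split.
- split; first exact: darboux_map_Sp.
  by move=> u v; rewrite !comp_lfunE !(darboux_map_Sp _ _).
- by apply/funext=> i /=; rewrite (darboux_map_l _ _ ef).
- have -> : (tV \o pV \o h)%VF \o E = tV \o (pV \o (h \o E)).
    by apply/funext=> i; rewrite /= !comp_lfunE.
  rewrite hE !comp_lincomb; congr lincomb; apply/funext=> i /=.
  have -> : pV (exchange S E G i) = X i.
    by rewrite /X /exchange; case: ifP; rewrite (darboux_map_l, darboux_map_r).
  exact: (darboux_map_l _ _ XY).
- rewrite -!comp_lfunA [(darboux_map e f X Y \o _)%VF]comp_lfunA.
  rewrite (darboux_mapK XY ef).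
  by rewrite comp_lfun1l comp_lfunA (darboux_mapK EG ef) comp_lfun1l.
Qed.

Lemma bruhat_dim (x : {vspace V}) (E G : 'I_l -> V) S C :
  bruhat_form x h E G S C -> \dim (x :&: h @: x) = #|~: S|.
Proof.
move=> [EG Ex hE]; have [XY _] := darboux_exchange formP S EG.
have hx : (h @: x)%VS = <<codom (exchange S E G)>>%VS.
  apply/eqP; rewrite eqEdim -{1}Ex limg_span -map_comp -/(codom (h \o E)).
  rewrite (span_lincombP _ _).2; last by exists C.
  rewrite limg_dim_eq; last by rewrite (eqP (lker0_isometry formP EG hS)) capv0.
  by rewrite -Ex (dim_lagrangian formP XY) (dim_lagrangian formP EG.1) leqnn.
pose E' (i : 'I_#|~: S|) := E (enum_val i).
pose G' (i : 'I_#|~: S|) := G (enum_val i).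
have E'G' : darboux_family form E' G'.
  have [[EGE EE GG] _] := EG; split; apply/matrixP=> i j.
  - have /matrixP/(_ (enum_val i) (enum_val j)) := EGE.
    by rewrite !mxE (inj_eq enum_val_inj).
  - by have /matrixP/(_ (enum_val i) (enum_val j)) := EE; rewrite !mxE.
  - by have /matrixP/(_ (enum_val i) (enum_val j)) := GG; rewrite !mxE.
rewrite -(dim_lagrangian formP E'G'); congr (\dim _); apply/eqP.
rewrite hx -Ex eqEsubv; apply/andP; split.
  apply/subvP=> v; rewrite memv_cap => /andP[vx /span_codomP[c vE]].
  rewrite vE; apply: memv_suml => i _; rewrite /exchange.
  have [iS|iS] := boolP (i \in S); last first.
    have iSC : i \in ~: S by rewrite inE.
    apply/memvZ/memv_span/codomP; exists (enum_rank_in iSC i).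
    by rewrite /E' enum_rankK_in.
  have := darboux_coordl formP XY c i; rewrite -vE /exchange iS.
  rewrite (skewNr formP) (skewC formP) opprK.
  by rewrite (darboux_forml formP EG.1) // => <-; rewrite scale0r mem0v.
apply/span_subvP=> _ /codomP[i ->]; have := enum_valP i; rewrite inE => iS.
rewrite memv_cap !memv_span //; last exact: codom_f.
by apply/codomP; exists (enum_val i); rewrite /exchange (negPf iS).
Qed.

End BruhatForms.
End DarbouxMaps.

(** * Orthogonal sums of Bruhat forms *)

Lemma big_Rank (R : Type) (idx : R) (op : Monoid.com_law idx) n
    (l : 'I_n -> nat) (X : 'I_(\sum_i l i)%N -> R) :
  \big[op/idx]_s X s =
    \big[op/idx]_i \big[op/idx]_(j < l i) X (tagnat.Rank i j).
Proof.
rewrite (sig_big_dep xpredT (fun _ => xpredT) (fun i j => X (tagnat.Rank i j))).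
rewrite (reindex (@tagnat.rank _ l));
  last exact: onW_bij (@tagnat.rank_bij _ l).
by apply: eq_bigr => -[i j] _.
Qed.

Lemma mxdiag_Rank (R : nmodType) n (l : 'I_n -> nat) (C : forall i, 'M[R]_(l i))
    i (j k : 'I_(l i)) :
  (\mxdiag_i C i) (tagnat.Rank i j) (tagnat.Rank i k) = C i j k.
Proof. by have /matrixP/(_ j k) := submxblock_diag C i; rewrite mxE. Qed.

Lemma mxdiag_Rank_neq (R : nmodType) n (l : 'I_n -> nat)
    (C : forall i, 'M[R]_(l i)) i i' (j : 'I_(l i)) (k : 'I_(l i')) :
  i != i' -> (\mxdiag_i C i) (tagnat.Rank i j) (tagnat.Rank i' k) = 0.
Proof.
move=> /negPf ii'; have /matrixP/(_ j k) := mxblockK (fun i1 i2 =>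
  if i1 == i2 then conform_mx 0 (C i1) else 0 : 'M_(l i1, l i2)) i i'.
by rewrite ii' !mxE.
Qed.

Section OrthogonalSums.
Variables (F : fieldType) (V : vectType F) (form : V -> V -> F).
Variables (n : nat) (V_ : 'I_n -> vectType F)
    (form_ : forall i, V_ i -> V_ i -> F).
Variable iota : forall i, 'Hom(V_ i, V).
Hypothesis iota_isometry : forall i u v, form (iota i u) (iota i v) = form_ u v.
Hypothesis iota_orthogonal : forall i j u v, i != j ->
  form (iota i u) (iota j v) = 0.
Hypothesis iota_span : (\sum_i limg (iota i) = {:V})%VS.
Variable l : 'I_n -> nat.

Definition glue_family (X : forall i, 'I_(l i) -> V_ i)
    (s : 'I_(\sum_i l i)%N) : V :=
  iota (tagnat.sig1 s) (X _ (tagnat.sig2 s)).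

Definition glue_set (S : forall i, {set 'I_(l i)}) : {set 'I_(\sum_i l i)%N} :=
  [set s | tagnat.sig2 s \in S (tagnat.sig1 s)]%SET.

Lemma glue_Rank X i (j : 'I_(l i)) :
  glue_family X (tagnat.Rank i j) = iota i (X i j).
Proof. by rewrite /glue_family /tagnat.sig1 /tagnat.sig2 tagnat.rankK. Qed.

Lemma mem_glue_set S i (j : 'I_(l i)) :
  (tagnat.Rank i j \in glue_set S) = (j \in S i).
Proof. by rewrite inE /tagnat.sig1 /tagnat.sig2 tagnat.rankK. Qed.

Lemma card_glue_set S : #|glue_set S| = (\sum_i #|S i|)%N.
Proof.
rewrite -sum1_card big_mkcond big_Rank; apply: eq_bigr => i _.
rewrite -sum1_card [RHS]big_mkcond; apply: eq_bigr => j _.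
by rewrite mem_glue_set.
Qed.

Lemma gram_glue X Y :
  gram form (glue_family X) (glue_family Y) =
    \mxdiag_i gram (@form_ i) (X i) (Y i).
Proof.
apply/matrixP=> s t; rewrite mxE -[s]tagnat.sig2K -[t]tagnat.sig2K.
move: (tagnat.sig1 s) (tagnat.sig2 s) => i a.
move: (tagnat.sig1 t) (tagnat.sig2 t) => j b.
rewrite !glue_Rank; have [ij|ij] := eqVneq i j.
  by move: b; rewrite -ij => b; rewrite mxdiag_Rank mxE iota_isometry.
by rewrite mxdiag_Rank_neq // iota_orthogonal.
Qed.

Lemma lincomb_glue X (C : forall i, 'M_(l i)) :
  lincomb (glue_family X) (\mxdiag_i C i) =
    glue_family (fun i => lincomb (X i) (C i)).
Proof.
apply/funext=> t; rewrite -[t]tagnat.sig2K.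
move: (tagnat.sig1 t) (tagnat.sig2 t) => i a.
rewrite glue_Rank /lincomb big_Rank (bigD1 i) //= [X in _ + X]big1 ?addr0.
  rewrite linear_sum; apply: eq_bigr => j _.
  by rewrite mxdiag_Rank glue_Rank linearZ.
by move=> j ji; rewrite big1 // => b _; rewrite mxdiag_Rank_neq ?scale0r.
Qed.

Lemma exchange_glue S (X Y : forall i, 'I_(l i) -> V_ i) :
  exchange (glue_set S) (glue_family X) (glue_family Y) =
  glue_family (fun i => exchange (S i) (X i) (Y i)).
Proof. by apply/funext=> s; rewrite /exchange inE /glue_family; case: ifP. Qed.

Lemma span_glue (X : forall i, 'I_(l i) -> V_ i) :
  <<codom (glue_family X)>>%VS = (\sum_i (iota i @: <<codom (X i)>>))%VS.
Proof.
apply/eqP; rewrite eqEsubv; apply/andP; split.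
  apply/span_subvP=> _ /codomP[s ->]; rewrite /glue_family.
  apply: (subvP (sumv_sup (tagnat.sig1 s) isT (subvv _))).
  exact/memv_img/memv_span/codom_f.
apply/subv_sumP=> i _; rewrite limg_span -map_comp.
apply/span_subvP=> _ /mapP[j _ ->]; apply/memv_span/codomP.
by exists (tagnat.Rank i j); rewrite glue_Rank.
Qed.

Lemma darboux_basis_glue (E G : forall i, 'I_(l i) -> V_ i) :
  (forall i, darboux_basis (@form_ i) (E i) (G i)) ->
  darboux_basis form (glue_family E) (glue_family G).
Proof.
move=> EG; split.
  split; rewrite gram_glue; [rewrite -mxdiagZ | rewrite -mxdiag0..];
  by apply: eq_mxdiag => i; have [[]] := EG i.
rewrite span_cat !span_glue -big_split -iota_span; apply: eq_bigr => i _ /=.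
by rewrite -limgD -span_cat; have [_ ->] := EG i.
Qed.

Lemma bruhat_form_glue (x : {vspace V}) (x_ : forall i, {vspace V_ i})
    (h : 'End(V)) (h_ : forall i, 'End(V_ i)) (E G : forall i, 'I_(l i) -> V_ i)
    S C : x = (\sum_i (iota i @: x_ i))%VS ->
  (forall i u, h (iota i u) = iota i (h_ i u)) ->
  (forall i, bruhat_form (@form_ i) (x_ i) (h_ i) (E i) (G i) (S i) (C i)) ->
  bruhat_form form x h (glue_family E) (glue_family G) (glue_set S)
    (\mxdiag_i C i).
Proof.
move=> -> hi EG; split.
- by apply: darboux_basis_glue => i; have [] := EG i.
- by rewrite span_glue; apply: eq_bigr => i _; have [_ ->] := EG i.
rewrite exchange_glue lincomb_glue; apply/funext=> s;
  rewrite /glue_family /= hi.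
by have [_ _ <-] := EG (tagnat.sig1 s).
Qed.

End OrthogonalSums.

(** * Valuations and local fields *)

Section Valuations.
Variables (F : fieldType) (v : F -> int).
Hypothesis vP : normalized_valuation v.

Lemma valuationM x y : x != 0 -> y != 0 -> v (x * y) = v x + v y.
Proof. by case: vP => + _ _; apply. Qed.

Lemma valuation1 : v 1 = 0.
Proof.
by apply: (addrI (v 1)); rewrite -valuationM ?oner_neq0 // mulr1 addr0.
Qed.

Lemma valuationN x : v (- x) = v x.
Proof.
have [->|x0] := eqVneq x 0; first by rewrite oppr0.
have n0 : (-1 : F) != 0 by rewrite oppr_eq0 oner_eq0.
have := valuationM n0 n0; rewrite mulrNN mulr1 valuation1 => v_opp1.
by rewrite -mulN1r valuationM //; lia.
Qed.

Lemma valuationV x : x != 0 -> v x^-1 = - v x.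
Proof.
move=> x0; have xV : x^-1 != 0 by rewrite invr_eq0.
by have := valuationM x0 xV; rewrite divff // valuation1; lia.
Qed.

Lemma valuationXz x (m : int) : x != 0 -> v (x ^ m) = m * v x.
Proof.
move=> x0.
have valuationX n : v (x ^+ n) = n%:Z * v x.
  elim: n => [|n IHn]; first by rewrite expr0 valuation1 mul0r.
  by rewrite exprS valuationM ?expf_neq0 // IHn; lia.
case: m => n; first by rewrite -exprnP valuationX.
by rewrite NegzE -exprnN valuationV ?expf_neq0 // valuationX; lia.
Qed.

Lemma mem_videal m x : x != 0 -> videal v m x <-> m <= v x.
Proof. by move=> x0; split=> [[E|//]|]; [rewrite E eqxx in x0 | right]. Qed.

Lemma videal0 m : videal v m 0.
Proof. by left. Qed.

Lemma videal1 : videal v 0 1.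
Proof. by right; rewrite valuation1. Qed.

Lemma sub_videal m n x : m <= n -> videal v n x -> videal v m x.
Proof. by move=> mn [->|h]; [left | right; apply: le_trans h]. Qed.

Lemma videalD m x y : videal v m x -> videal v m y -> videal v m (x + y).
Proof.
have [->|x0] := eqVneq x 0; first by rewrite add0r.
have [->|y0] := eqVneq y 0; first by rewrite addr0.
have [->|xy0] := eqVneq (x + y) 0; first by left.
move=> /(mem_videal _ x0) hx /(mem_videal _ y0) hy; apply/mem_videal => //.
by case: vP => _ h _; apply: le_trans (h _ _ x0 y0 xy0); rewrite le_min hx hy.
Qed.

Lemma videalN m x : videal v m (- x) <-> videal v m x.
Proof.
have [->|x0] := eqVneq x 0; first by rewrite oppr0.
by rewrite !mem_videal ?oppr_eq0 // valuationN.
Qed.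

Lemma videalB m x y : videal v m x -> videal v m y -> videal v m (x - y).
Proof. by move=> hx hy; apply: videalD => //; apply/videalN. Qed.

Lemma videal_mull c x m : c != 0 -> videal v (v c + m) (c * x) <-> videal v m x.
Proof.
move=> c0; have [->|x0] := eqVneq x 0.
  by rewrite mulr0; split=> _; left.
by rewrite !mem_videal ?mulf_neq0 // valuationM // lerD2l.
Qed.

Lemma videal_mul_unitl c x m : c != 0 -> v c = 0 ->
  videal v m (c * x) <-> videal v m x.
Proof. by move=> c0 vc; rewrite -(videal_mull x m c0) vc add0r. Qed.

Lemma videalM m n x y : videal v m x -> videal v n y ->
  videal v (m + n) (x * y).
Proof.
have [->|x0] := eqVneq x 0; first by rewrite mul0r; left.
have [->|y0] := eqVneq y 0; first by rewrite mulr0; left.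
by rewrite !mem_videal ?mulf_neq0 // valuationM // => *; apply: lerD.
Qed.

Lemma videal_principal c x : c != 0 ->
  videal v (v c) x <-> exists2 y, videal v 0 y & x = c * y.
Proof.
move=> c0; split=> [xc|[y y0 ->]].
  exists (c^-1 * x); last by rewrite mulVKf.
  by apply/(videal_mull _ _ c0); rewrite addr0 mulVKf.
by rewrite -[v c]addr0; apply/videal_mull.
Qed.

End Valuations.

Section LocalFields.
Variables (k : fieldType) (Fq : finFieldType) (K : localField k Fq).
Local Notation v := (lf_val K).
Local Notation pi := (lf_unif K).
Let vP := lf_valP K.

Lemma lf_unif_neq0 : pi != 0. Proof. by case: (lf_unifP K). Qed.

Lemma lf_val_unif : v pi = 1. Proof. by case: (lf_unifP K). Qed.

Lemma lf_val_unifXz m : v (pi ^ m) = m.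
Proof. by rewrite (valuationXz vP _ lf_unif_neq0) lf_val_unif mulr1. Qed.

Lemma lf_unifXz_neq0 m : pi ^ m != 0.
Proof. by rewrite expfz_neq0 // lf_unif_neq0. Qed.

Lemma videal_unifXz_mul m n x : videal v (m + n) (pi ^ m * x) <-> videal v n x.
Proof. by rewrite -{1}(lf_val_unifXz m) videal_mull // lf_unifXz_neq0. Qed.

Lemma lf_intM x y : lf_int K x -> lf_int K y -> lf_int K (x * y).
Proof. exact: (videalM vP (m := 0) (n := 0)). Qed.

Lemma lf_int_unif : lf_int K pi.
Proof. by right; rewrite lf_val_unif. Qed.

Lemma lf_red0 : lf_red K 0 = 0.
Proof. by apply/(lf_red_ker (l := K)); apply: videal0. Qed.

Lemma lf_red_unif : lf_red K pi = 0.
Proof.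
apply/(lf_red_ker lf_int_unif); right; by rewrite lf_val_unif.
Qed.

Lemma lf_red_add x y : lf_int K x -> lf_int K y ->
  lf_red K (x + y) = lf_red K x + lf_red K y.
Proof. by move=> hx hy; apply: lf_redD; rewrite inE. Qed.

Lemma lf_red_mul x y : lf_int K x -> lf_int K y ->
  lf_red K (x * y) = lf_red K x * lf_red K y.
Proof. by move=> hx hy; apply: lf_redM; rewrite inE. Qed.

Lemma lf_red_opp x : lf_int K x -> lf_red K (- x) = - lf_red K x.
Proof.
move=> hx; apply/eqP; rewrite -addr_eq0 -lf_red_add ?addNr ?lf_red0 //.
exact/(videalN vP).
Qed.

Lemma lf_two_neq0 : (2 : k) != 0.
Proof. by apply/eqP=> E; have := lf_char0 K 2%N; rewrite !inE /= E eqxx. Qed.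

Lemma lf_res_two_neq0 : (2 : Fq) != 0.
Proof. by apply/negP=> h; have := lf_odd K; rewrite inE /= h. Qed.

Lemma lf_val2 : v 2 = 0.
Proof.
have int1 : lf_int K 1 by apply: videal1.
have int2 : lf_int K 2 by apply: (videalD vP).
have red2 : lf_red K 2 != 0 by rewrite lf_red_add ?lf_red1 // lf_res_two_neq0.
have : ~ videal v 1 2 by move/(lf_red_ker int2)/eqP; apply/negP.
by move: int2; rewrite /lf_int !(mem_videal _ _ lf_two_neq0); lia.
Qed.

Lemma videal_half m x : videal v m (2^-1 * x) <-> videal v m x.
Proof.
by apply: (videal_mul_unitl vP); rewrite ?invr_eq0 ?(valuationV vP) ?lf_val2
  ?lf_two_neq0.
Qed.

End LocalFields.

(** * Residual symplectic spaces *)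

Definition additive_subgroup (V : zmodType) (L : set V) : Prop :=
  L 0 /\ forall x y, L x -> L y -> L (x - y).

Section AdditiveSubgroups.
Variables (V : zmodType) (L : set V).
Hypothesis LP : additive_subgroup L.

Lemma additive_subgroup0 : L 0. Proof. by case: LP. Qed.

Lemma additive_subgroupB x y : L x -> L y -> L (x - y).
Proof. by case: LP => _; apply. Qed.

Lemma additive_subgroupN x : L x -> L (- x).
Proof.
by move=> Lx; rewrite -sub0r; apply: additive_subgroupB => //;
  exact: additive_subgroup0.
Qed.

Lemma additive_subgroupD x y : L x -> L y -> L (x + y).
Proof.
by move=> Lx Ly; rewrite -[y]opprK; apply/additive_subgroupB/additive_subgroupN.
Qed.

Lemma additive_subgroup_sym x y : L (x - y) -> L (y - x).
Proof. by move=> xy; rewrite -opprB; apply: additive_subgroupN. Qed.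

Lemma additive_subgroup_trans x y z : L (x - y) -> L (y - z) -> L (x - z).
Proof. by move=> xy yz; rewrite -(subrKA y); apply: additive_subgroupD. Qed.

Lemma additive_subgroup_congr x y z : L (z - x) -> L (z - y) -> L (x - y).
Proof. by move=> /additive_subgroup_sym; apply: additive_subgroup_trans. Qed.

End AdditiveSubgroups.

Section SymplecticForms.
Variables (k : fieldType) (W : vectType k) (beta : W -> W -> k).
Hypothesis betaP : symplectic_form beta.

Lemma symplectic_skew : skew_bilinear beta.
Proof.
have [bl br bx _] := betaP; split=> // x y.
have bDl u v w : beta (u + v) w = beta u w + beta v w.
  by rewrite -[u]scale1r bl mul1r scale1r.
have bDr u v w : beta w (u + v) = beta w u + beta w v.
  by rewrite -[u]scale1r br mul1r scale1r.
by apply/eqP; rewrite -addr_eq0; have := bx (x + y);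
  rewrite bDl !bDr !bx add0r addr0 => ->.
Qed.

Lemma lker0_Sp g : Sp beta g -> lker g == 0%VS.
Proof.
have [_ _ _ nondeg] := betaP => gS; apply/lker0P=> x y E.
apply/eqP; rewrite -subr_eq0; apply/eqP/nondeg => z.
by rewrite -(gS (x - y)) linearB /= E subrr (skew0l symplectic_skew).
Qed.

Lemma Sp_adjoint g x y : Sp beta g -> beta (g x) y = beta x ((g^-1)%VF y).
Proof. by move=> gS; rewrite -{1}(lker0_lfunVK (lker0_Sp gS) y) gS. Qed.

End SymplecticForms.

Lemma stabilizer_id (k : fieldType) (W : vectType k) (beta : W -> W -> k)
    (L : set W) : stabilizer beta L \1%VF.
Proof.
split=> [x y|/=]; first by rewrite !id_lfunE.
by apply/seteqP; split=> [_ [w Lw <-]|w Lw]; [|exists w]; rewrite ?id_lfunE.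
Qed.

Section Stabilizers.
Variables (k : fieldType) (W : vectType k) (beta : W -> W -> k) (L : set W).
Variable g : 'End(W).
Hypothesis gL : stabilizer beta L g.

Lemma stabilizer_mem w : L w -> L (g w).
Proof. by case: gL => _ /= gLL Lw; rewrite -gLL; exists w. Qed.

Lemma stabilizer_memV w : symplectic_form beta -> L w -> L ((g^-1)%VF w).
Proof.
move=> betaP; case: gL => gS /= gLL; rewrite -{1}gLL => -[x Lx <-].
by rewrite lker0_lfunK // (lker0_Sp betaP gS).
Qed.

End Stabilizers.

Section ResidualSpaces.
Variables (k : fieldType) (Fq : finFieldType) (K : localField k Fq) (lam : int).
Let vP := lf_valP K.

Definition lattice_chain (W : vectType k) (beta : W -> W -> k) (A B : set W) :
    Prop :=
  [/\ additive_subgroup A, additive_subgroup B, B `<=` A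
    & A `<=` dual_lattice K lam beta B].

Section DualLattice.
Variables (W : vectType k) (beta : W -> W -> k) (B : set W).
Hypothesis betaP : symplectic_form beta.
Local Notation dual := (dual_lattice K lam beta B).
Let bP := symplectic_skew betaP.

Lemma dual0 : dual 0.
Proof. by move=> w _; rewrite (skew0l bP); apply: videal0. Qed.

Lemma dualD x y : dual x -> dual y -> dual (x + y).
Proof.
by move=> hx hy w Bw; rewrite (skewDl bP); apply: (videalD vP);
  [apply: hx | apply: hy].
Qed.

Lemma dualZ c x : lf_int K c -> dual x -> dual (c *: x).
Proof.
move=> hc hx w Bw; rewrite (skewZl bP) -[lam]add0r.
by apply: (videalM vP) => //; apply: hx.
Qed.

Lemma dualN x : dual x -> dual (- x).
Proof. by move=> hx w Bw; rewrite (skewNl bP); apply/(videalN vP)/hx. Qed.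

Lemma stabilizer_dual g w : stabilizer beta B g -> dual w -> dual (g w).
Proof.
move=> gB hw b Bb; rewrite (Sp_adjoint betaP) ?gB.1 //; last by case: gB.
by apply/hw/(stabilizer_memV gB).
Qed.

End DualLattice.

Section OneSpace.
Variables (W : vectType k) (beta : W -> W -> k) (A B : set W).
Hypothesis betaP : symplectic_form beta.
Variable Q : residualSpace K lam beta A B.
Local Notation dual := (dual_lattice K lam beta B).
Local Notation pr := (rs_pr Q).
Local Notation form := (rs_form (r := Q)).
Let bP := symplectic_skew betaP.

Lemma rs_pr_add x y : dual x -> dual y -> pr (x + y) = pr x + pr y.
Proof. by move=> hx hy; apply: rs_prD; rewrite inE. Qed.

Lemma rs_pr0 : pr 0 = 0.
Proof.
have d0 : dual 0 by apply: dual0.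
by apply: (addrI (pr 0)); rewrite -rs_pr_add // !addr0.
Qed.

Lemma rs_pr_opp x : dual x -> pr (- x) = - pr x.
Proof.
move=> hx; apply/eqP; rewrite -addr_eq0 -rs_pr_add ?addNr ?rs_pr0 //.
exact: dualN.
Qed.

Lemma rs_pr_eq x y : dual x -> dual y -> pr x = pr y <-> B (x - y).
Proof.
move=> hx hy; have hNy := dualN betaP hy.
rewrite -(rs_pr_ker Q (dualD betaP hx hNy)) rs_pr_add // rs_pr_opp //.
by split=> [->|/eqP]; rewrite ?subrr // subr_eq0 => /eqP.
Qed.

Lemma dual_form_int x y : dual x -> dual y ->
  lf_int K (lf_unif K ^ (1 - lam) * beta x y).
Proof.
move=> hx hy; have B_unif : B (lf_unif K *: x).
  apply/(rs_pr_ker Q); first exact: (dualZ betaP (lf_int_unif K)).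
  by rewrite rs_prZ ?lf_red_unif ?scale0r //; apply: lf_int_unif.
have := hy _ B_unif; rewrite (skewC bP) (skewZl bP) => /(videalN vP).
rewrite -(videal_unifXz_mul K (- lam)) addNr mulrA.
by rewrite -[X in _ * X * _]expr1z -expfzDr ?lf_unif_neq0 // addrC.
Qed.

Lemma rs_form_skew : skew_bilinear form.
Proof.
split=> [a u v w|u v].
  have [c hc <-] := lf_red_surj K a.
  have [x hx <-] := rs_pr_surj u; have [y hy <-] := rs_pr_surj v.
  have [z hz <-] := rs_pr_surj w; have hcx := dualZ betaP hc hx.
  rewrite -rs_prZ // -rs_pr_add // !rs_formE //; last exact: (dualD betaP).
  have ix := dual_form_int hx hz; have iy := dual_form_int hy hz.
  rewrite (skewDl bP) (skewZl bP) mulrDr mulrCA lf_red_add ?(lf_red_mul hc) //.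
  exact: lf_intM.
have [x hx <-] := rs_pr_surj u; have [y hy <-] := rs_pr_surj v.
rewrite !rs_formE // (skewC bP) mulrN lf_red_opp //; exact: dual_form_int.
Qed.

End OneSpace.

Section InducedMaps.
Variables (W W' : vectType k) (beta : W -> W -> k) (beta' : W' -> W' -> k).
Variables (A B : set W) (A' B' : set W').
Hypotheses (betaP : symplectic_form beta) (betaP' : symplectic_form beta').
Variables (Q : residualSpace K lam beta A B)
    (Q' : residualSpace K lam beta' A' B').
Local Notation dual := (dual_lattice K lam beta B).
Local Notation dual' := (dual_lattice K lam beta' B').
Variable f : 'Hom(W, W').
Hypothesis f_dual : forall w, dual w -> dual' (f w).
Hypothesis f_sub : forall w, B w -> B' (f w).

Definition induced : 'Hom(rs_space Q, rs_space Q') :=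
  linfun (fun y => rs_pr Q' (f (xget 0 [set w | dual w /\ rs_pr Q w = y]))).

Lemma inducedE w : dual w -> induced (rs_pr Q w) = rs_pr Q' (f w).
Proof.
pose F y := rs_pr Q' (f (xget 0 [set w | dual w /\ rs_pr Q w = y])).
have FE x : dual x -> F (rs_pr Q x) = rs_pr Q' (f x).
  move=> hx; rewrite /F; case: xgetP => [y _ [hy yx]|/(_ x)[]//].
  apply/(rs_pr_eq betaP'); [exact: f_dual..|].
  by rewrite -linearB; apply/f_sub/(rs_pr_eq betaP Q).
rewrite /induced linfunE => [|a u v]; first exact: FE.
have [c hc <-] := lf_red_surj K a.
have [x hx <-] := rs_pr_surj u; have [y hy <-] := rs_pr_surj v.
have hcx := dualZ betaP hc hx; have [dx dy] := (f_dual hx, f_dual hy).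
rewrite -rs_prZ // -(rs_pr_add Q) // -!/(F _) !FE //; last exact: (dualD betaP).
rewrite linearD linearZ /= (rs_pr_add Q') ?rs_prZ //; exact: (dualZ betaP').
Qed.

End InducedMaps.

Section Reduction.
Variables (W : vectType k) (beta : W -> W -> k) (A B : set W).
Hypothesis betaP : symplectic_form beta.
Variable Q : residualSpace K lam beta A B.
Local Notation form := (rs_form (r := Q)).
Variable g : 'End(W).
Hypothesis gB : stabilizer beta B g.

Lemma reductionE w : dual_lattice K lam beta B w ->
  reduction Q g (rs_pr Q w) = rs_pr Q (g w).
Proof.
apply: inducedE => // u; first exact: stabilizer_dual.
exact: (stabilizer_mem gB).
Qed.

Lemma reduction_Sp : Sp form (reduction Q g).
Proof.
have [gS _] := gB.
move=> u v; have [x hx <-] := rs_pr_surj u; have [y hy <-] := rs_pr_surj v.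
by rewrite !reductionE // !rs_formE ?gS //; apply: stabilizer_dual.
Qed.

End Reduction.
End ResidualSpaces.

(** * The invariants theta and j *)

Section ModSquares.
Variable F : finFieldType.
Implicit Types c d : F.

Lemma eq_mod_squares_refl c : eq_mod_squares c c.
Proof. by exists 1; rewrite ?oner_eq0 // expr1n mulr1. Qed.

Lemma eq_mod_squares_sym c d : eq_mod_squares c d -> eq_mod_squares d c.
Proof.
move=> [s s0 ->]; exists s^-1; first by rewrite invr_eq0.
by rewrite -mulrA -exprMn divff // expr1n mulr1.
Qed.

Lemma eq_mod_squares_trans c d e :
  eq_mod_squares c d -> eq_mod_squares d e -> eq_mod_squares c e.
Proof.
move=> [s s0 ->] [t t0 ->]; exists (t * s); first by rewrite mulf_neq0.
by rewrite exprMn -mulrA.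
Qed.

Lemma eq_mod_squaresM c c' d d' : eq_mod_squares c c' ->
  eq_mod_squares d d' -> eq_mod_squares (c * d) (c' * d').
Proof.
move=> [s s0 ->] [t t0 ->]; exists (s * t); first by rewrite mulf_neq0.
by rewrite exprMn mulrACA.
Qed.

End ModSquares.

Section Theta.
Variables (k : fieldType) (Fq : finFieldType) (K : localField k Fq) (lam : int).
Variables (W : vectType k) (beta : W -> W -> k) (A B : set W).
Hypothesis betaP : symplectic_form beta.
Variable Q : residualSpace K lam beta A B.
Local Notation b := (rs_space Q).
Local Notation x := (rs_lagr Q).
Local Notation form := (rs_form (r := Q)).
Let formP : skew_bilinear form := rs_form_skew betaP Q.
Variable theta : 'End(b) -> Fq.
Hypothesis thetaP : theta_function theta.

Lemma symplectic_basis_darboux (e f : 'I_(rs_l Q) -> b) :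
  symplectic_basis e f -> darboux_basis form e f /\ <<codom e>>%VS = x.
Proof.
move=> [ex sp ef ee ff]; split=> //; split=> //.
by split; apply/matrixP=> i j; rewrite !mxE.
Qed.

Lemma exists_lagrangian_basis : exists e f : 'I_(rs_l Q) -> b,
  darboux_basis form e f /\ <<codom e>>%VS = x.
Proof.
have [_ _ _ [e [f [ef _]]]] := thetaP.
by exists e, f; apply: symplectic_basis_darboux.
Qed.

Lemma lagrangian_isotropic : A `<=` dual_lattice K lam beta B ->
  A `<=` dual_lattice K lam beta A.
Proof.
have [e [f [ef ex]]] := exists_lagrangian_basis => AD a Aa a' Aa'.
have [ax a'x] : rs_pr Q a \in <<codom e>>%VS /\ rs_pr Q a' \in <<codom e>>%VS.
  by rewrite ex; split; apply/rs_lagrE; [exists a | exists a'].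
have : form (rs_pr Q a) (rs_pr Q a') = 0.
  case/span_codomP: ax => c ->; rewrite (skew_suml formP) big1 // => i _.
  by rewrite (skewZl formP) (darboux_forml formP ef.1) // mulr0.
have [da da'] := (AD _ Aa, AD _ Aa').
rewrite rs_formE // => /(lf_red_ker (dual_form_int betaP Q da da')).
by move=> ?; apply/(videal_unifXz_mul K (1 - lam)); rewrite subrK.
Qed.

Lemma det_on_lincomb l (E G : 'I_l -> b) (p : 'End(b)) (C : 'M_l) :
  darboux_basis form E G -> <<codom E>>%VS = x -> p \o E = lincomb E C ->
  det_on x p = \det C.
Proof.
by move=> [EG _]; apply: det_coord_vbasis; apply: (darboux_freel formP EG).
Qed.

Lemma siegel_Sp (p : 'End(b)) : Sp form p -> (p @: x <= x)%VS -> siegel p.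
Proof.
have [e [f [ef _]]] := exists_lagrangian_basis.
move=> pS px; split=> //; apply/eqP; rewrite eqEdim px limg_dim_eq ?leqnn //.
by rewrite (eqP (lker0_isometry formP ef pS)) capv0.
Qed.

Lemma det_on_mul l (e f E G : 'I_l -> b) (p r : 'End(b)) (C : 'M_l) :
  darboux_basis form e f -> <<codom e>>%VS = x ->
  darboux_basis form E G -> <<codom E>>%VS = x ->
  p \o e = E -> r \o E = lincomb e C -> det_on x p * det_on x r = \det C.
Proof.
move=> ef ex EG Ex pe rE.
have [M EM] : exists M, E = lincomb e M by apply/span_lincombP; rewrite Ex ex.
have [N eN] : exists N, e = lincomb E N by apply/span_lincombP; rewrite Ex ex.
have NM : N *m M = 1%:M.
  apply: (lincomb_inj (darboux_freel formP EG.1)).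
  by rewrite -lincombM -eN -EM lincomb1.
rewrite (det_on_lincomb (C := M) ef ex) ?pe //.
rewrite (det_on_lincomb (C := C *m N) ef ex).
  by rewrite det_mulmx mulrC -mulrA -det_mulmx NM det1 mulr1.
by rewrite {1}eN comp_lincomb rE lincombM.
Qed.

Lemma theta_bruhat l (E G : 'I_l -> b) (S : {set 'I_l}) (C : 'M_l)
    (h : 'End(b)) :
  Sp form h -> bruhat_form form x h E G S C ->
  eq_mod_squares (theta h) (\det C).
Proof.
have [_ thetaM thetad [e [f [efP theta_flip]]]] := thetaP.
have [ef ex] := symplectic_basis_darboux efP.
move=> hS hB; have [EG Ex _] := hB.
have lE : l = rs_l Q by rewrite /rs_l (dim_darboux formP EG) doubleK.
subst l; have [p [r [[pS rS] pe rE ->]]] := bruhat_factorization formP hS ef hB.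
have {}pS : siegel p.
  apply: siegel_Sp => //.
  by rewrite -{1}ex limg_span -map_comp -[map _ _]/(codom (p \o e)) pe Ex.
have {}rS : siegel r.
  apply: siegel_Sp => //.
  rewrite -{1}Ex limg_span -map_comp -[map _ _]/(codom (r \o E)) rE -ex.
  by apply/span_lincombP; exists C.
have flip1 : eq_mod_squares (theta (partial_flip form e f S)) 1.
  apply: (theta_flip S) => i iS; rewrite /partial_flip;
    rewrite (darboux_map_l formP) // (darboux_map_r formP) //;
    by rewrite /exchange ?iS ?(negPf iS).
apply: eq_mod_squares_trans (thetaM _ _ _ pS _ rS) _.
  by apply: darboux_map_Sp => //; apply: darboux_exchange.
rewrite -(det_on_mul ef ex EG Ex pe rE) -[det_on x p]mulr1.
by apply: eq_mod_squaresM (thetad _ rS);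
  apply: eq_mod_squaresM (thetad _ pS) flip1.
Qed.

Lemma rs_j_bruhat l (E G : 'I_l -> b) (S : {set 'I_l}) (C : 'M_l)
    (h : 'End(b)) :
  Sp form h -> bruhat_form form x h E G S C -> rs_j h = #|S|.
Proof.
move=> hS hB; have [EG _ _] := hB.
have lE : rs_l Q = #|'I_l|.
  by rewrite card_ord /rs_l (dim_darboux formP EG) doubleK.
by rewrite /rs_j (bruhat_dim formP hS hB) lE -(cardsC S) addnK.
Qed.

End Theta.

(** * Traces *)

Section Traces.
Variables (F : fieldType) (L : fieldExtType F).

Lemma ext_traceD (x y : L) : ext_trace (x + y) = ext_trace x + ext_trace y.
Proof.
rewrite /ext_trace -big_split; apply: eq_bigr => i _ /=.
by rewrite mulrDl linearD.
Qed.

Lemma ext_traceZ (a : F) (x : L) : ext_trace (a *: x) = a * ext_trace x.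
Proof.
rewrite /ext_trace mulr_sumr; apply: eq_bigr => i _ /=.
by rewrite -scalerAl linearZ.
Qed.

Lemma ext_traceE m (X : 'I_m -> L) (x : L) (C : 'M_m) :
  free (codom X) -> <<codom X>>%VS = {:L}%VS -> *%R x \o X = lincomb X C ->
  ext_trace x = \tr C.
Proof.
move=> freeX spanX xX.
have mulxE : linfun ( *%R x) =1 *%R x.
  by apply: linfunE => a y z; rewrite mulrDr scalerAr.
rewrite -(trace_coord_vbasis (f := linfun ( *%R x)) freeX spanX).
  by apply: eq_bigr => i _; rewrite mulxE.
by rewrite -xX; apply/funext=> i /=; rewrite mulxE.
Qed.

Local Notation vbasisL := (@vbasis_family F L fullv).

Lemma mul_vbasis_family (x : L) :
  exists2 C, *%R x \o vbasisL = lincomb vbasisL C & ext_trace x = \tr C.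
Proof.
have [C xC] : exists C, *%R x \o vbasisL = lincomb vbasisL C.
  by apply/span_lincombP; rewrite span_vbasis_family subvf.
by exists C => //; apply: ext_traceE xC;
  rewrite ?free_vbasis_family ?span_vbasis_family.
Qed.

Lemma ext_trace_conj (tau : {rmorphism L -> L}) (x : L) :
  (forall a : F, tau a%:A = a%:A) -> ext_trace (tau x) = ext_trace x.
Proof.
move=> tau_scalar.
have tauZ (a : F) y : tau (a *: y) = a *: tau y.
  by rewrite -mulr_algl rmorphM tau_scalar mulr_algl.
have tau_lincomb m n (X : 'I_m -> L) (C : 'M_(m, n)) :
    tau \o lincomb X C = lincomb (tau \o X) C.
  apply/funext=> j; rewrite /= /lincomb rmorph_sum.
  by apply: eq_bigr => i _; rewrite /= tauZ.
have [C xC ->] := mul_vbasis_family x.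
have free_tau : free (codom (tau \o vbasisL)).
  apply/free_codomP => c; rewrite -tau_lincomb => /eqP; rewrite /= fmorph_eq0.
  by move=> /eqP; apply: (free_codomP _).1 (free_vbasis_family _) _.
apply: (@ext_traceE _ (tau \o vbasisL)) => //.
  by apply/eqP; rewrite eqEdim subvf (eqP free_tau) size_codom card_ord leqnn.
by rewrite -tau_lincomb -xC; apply/funext=> i /=; rewrite rmorphM.
Qed.

End Traces.

Lemma vsval_eq0 (F : fieldType) (V : vectType F) (U : {vspace V})
    (x : subvs_of U) : (vsval x == 0) = (x == 0).
Proof. exact: (inj_eq val_inj x 0). Qed.

Section QuadraticExtensions.
Variables (F : fieldType) (L : fieldExtType F) (E : {subfield L}) (u : L).
Hypothesis dimL : (\dim {:L} = 2 * \dim E)%N.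
Hypothesis uE : u \notin E.
Local Notation d := (\dim {:subvs_of E}).
Local Notation b := (@vbasis_family F (subvs_of E) fullv).

Definition quadratic_basis (s : 'I_(d + d)) : L :=
  match fintype.split s with
  | inl i => vsval (b i)
  | inr i => vsval (b i) * u
  end.

Lemma lincomb_quadratic_basis n (c c' : 'M_(d, n)) :
  lincomb quadratic_basis (col_mx c c') =
  fun j => vsval (lincomb b c j) + vsval (lincomb b c' j) * u.
Proof.
apply/funext=> j; rewrite /lincomb big_split_ord !linear_sum mulr_suml /=.
congr (_ + _); apply: eq_bigr => i _; rewrite /quadratic_basis.
  by rewrite (unsplitK (inl _)) col_mxEu.
by rewrite (unsplitK (inr _)) col_mxEd scalerAl.
Qed.

Lemma free_quadratic_basis : free (codom quadratic_basis).
Proof.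
have /free_codomP b_free := free_vbasis_family (fullv : {vspace subvs_of E}).
apply/free_codomP => c; rewrite -[c]vsubmxK lincomb_quadratic_basis.
set y := lincomb b _ 0; set z := lincomb b _ 0 => yzu.
have z0 : z = 0.
  apply/eqP/negPn/negP => z0; move/negP: uE; apply.
  suff -> : u = vsval (- (y / z)) by apply: subvsP.
  have vz0 : vsval z != 0 by rewrite vsval_eq0.
  apply: (mulfI vz0); rewrite -(addKr (vsval y) (_ * u)) yzu addr0.
  by rewrite rmorphN fmorph_div mulrN mulrCA mulfV // mulr1.
move: yzu; rewrite z0 mul0r addr0 => /eqP; rewrite vsval_eq0 => /eqP y0.
by rewrite (b_free _ y0) (b_free _ z0) col_mx0.
Qed.

Lemma span_quadratic_basis : <<codom quadratic_basis>>%VS = {:L}%VS.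
Proof.
apply/eqP; rewrite eqEdim subvf (eqP free_quadratic_basis) size_codom card_ord.
by rewrite dimL mul2n -addnn (_ : \dim E = d) ?leqnn // dimvf.
Qed.

(* Multiplication by [a] is block diagonal in the basis [b, b u]. *)
Lemma ext_trace_vsval (a : subvs_of E) : ext_trace (vsval a) = ext_trace a *+ 2.
Proof.
have [C aC ->] := mul_vbasis_family a.
rewrite (ext_traceE (C := block_mx C 0 0 C) free_quadratic_basis).
- by rewrite mxtrace_block mulr2n.
- exact: span_quadratic_basis.
have abE i : lincomb b C i = a * b i by rewrite -aC.
rewrite [block_mx _ _ _ _]/(col_mx _ _) lincomb_quadratic_basis.
apply/funext=> s /=.
have lincomb_row (c c' : 'M_d) : lincomb b (row_mx c c') s =
    match fintype.split s with
    | inl i => lincomb b c i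
    | inr i => lincomb b c' i
    end.
  by rewrite /lincomb; case: (split_ordP s) => i ->;
    apply: eq_bigr => j _; rewrite ?row_mxEl ?row_mxEr.
have lincomb0 i : lincomb b (0 : 'M_d) i = 0.
  by rewrite /lincomb big1 // => j _; rewrite mxE scale0r.
rewrite !lincomb_row /quadratic_basis.
case: (fintype.split s) => i; rewrite lincomb0 abE.
  by rewrite mul0r addr0.
by rewrite add0r mulrA.
Qed.

Lemma ext_trace_tower (tau : {rmorphism L -> L}) (x : L) :
  (2 : F) != 0 -> involutive tau -> (forall y, y \in E <-> tau y = y) ->
  ext_trace x = ext_trace (vsproj E (x + tau x)).
Proof.
move=> two0 tauK tauE.
have tau_scalar (a : F) : tau a%:A = a%:A by apply/tauE/memvZ/mem1v.
have x_tau : x + tau x \in E by apply/tauE; rewrite rmorphD tauK addrC.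
have := ext_trace_vsval (vsproj E (x + tau x)).
rewrite vsprojK // ext_traceD ext_trace_conj // -mulr2n -[LHS]mulr_natl.
by rewrite -[RHS]mulr_natl => /(mulfI two0).
Qed.

End QuadraticExtensions.

(** * The lattices of an irreducible torus *)

Section TorusLattices.
Variables (k : fieldType) (Fq : finFieldType) (K : localField k Fq).
Variables (lam : int) (W : vectType k) (beta : W -> W -> k).
Variables (T : set 'End(W)) (D : irreducibleTorus K beta T).
Local Notation L := (it_k2 D).
Local Notation k1 := (it_k1 D).
Local Notation tau := (it_tau D).
Local Notation v1 := (it_v1 D).
Local Notation v2 := (it_v2 D).
Local Notation e2 := (it_e2 D)%:Z.
Local Notation iso := (it_iso D).
Local Notation u := (it_u D).
Local Notation pi1 := (vsval (it_unif1 D)).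
Local Notation vK := (lf_val K).
Local Notation mu := (it_mu lam D).
Local Notation B := (it_B lam D).
Local Notation A := (it_A lam D).
Local Notation dual := (dual_lattice K lam beta).
Let v1P := it_v1P D.
Let v2P := it_v2P D.

Lemma it_e2_gt0 : 0 < e2. Proof. by case: (it_e2P D). Qed.

Lemma it_v2_vsval (x : subvs_of k1) : x != 0 -> v2 (vsval x) = e2 * v1 x.
Proof. by case: (it_e2P D) => _; apply. Qed.

Lemma videal_vsval m (x : subvs_of k1) :
  videal v2 (e2 * m) (vsval x) <-> videal v1 m x.
Proof.
have [->|x0] := eqVneq x 0; first by rewrite linear0; split=> _; left.
rewrite !mem_videal ?vsval_eq0 // it_v2_vsval // ler_pM2l //; exact: it_e2_gt0.
Qed.

Lemma it_tau_vsval (y : subvs_of k1) : tau (vsval y) = vsval y.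
Proof. by apply/it_tau_fix/subvsP. Qed.

Lemma it_tau_u : tau u = - u.
Proof. by case: (it_uP D) => _ /eqP; rewrite addrC addr_eq0 => /eqP. Qed.

Lemma it_u_neq0 : u != 0. Proof. by case: (it_uP D). Qed.

Lemma it_two_neq0 : (2 : L) != 0.
Proof. by rewrite -scaler_nat scaler_eq0 (negPf (lf_two_neq0 K)) oner_neq0. Qed.

Lemma it_v1_scalar c : c != 0 -> v1 (c%:A) = (it_e D)%:Z * vK c.
Proof. by case: (it_eP D) => _; apply. Qed.

Lemma it_v2_two : v2 2 = 0.
Proof.
have two0 : (2 : k)%:A != 0 :> subvs_of k1.
  by rewrite scaler_eq0 (negPf (lf_two_neq0 K)) oner_neq0.
have -> : (2 : L) = vsval ((2 : k)%:A : subvs_of k1).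
  by rewrite linearZ /= algid1 scaler_nat.
by rewrite it_v2_vsval // it_v1_scalar ?(lf_two_neq0 K) // lf_val2 !mulr0.
Qed.

Lemma videal_two_mul m x : videal v2 m (2 * x) <-> videal v2 m x.
Proof. by apply: (videal_mul_unitl v2P); rewrite ?it_v2_two ?it_two_neq0. Qed.

Lemma videal_tau m x : videal v2 m (tau x) <-> videal v2 m x.
Proof.
have [->|x0] := eqVneq x 0; first by rewrite rmorph0.
by rewrite !mem_videal ?fmorph_eq0 // it_v2_tau.
Qed.

Lemma it_trace_mem x : x + tau x \in k1.
Proof. by apply/it_tau_fix; rewrite rmorphD it_tauK addrC. Qed.

Lemma it_u_notin : u \notin k1.
Proof.
apply/negP=> /it_tau_fix; rewrite it_tau_u => /esym/eqP.
rewrite -addr_eq0 -mulr2n -mulr_natl mulf_eq0 (negPf it_two_neq0).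
by rewrite (negPf it_u_neq0).
Qed.

Lemma it_ext_trace x : ext_trace x = ext_trace (vsproj k1 (x + tau x)).
Proof.
apply: (ext_trace_tower (it_dim2 D) it_u_notin x (lf_two_neq0 K)).
  exact: it_tauK.
exact: it_tau_fix.
Qed.

(* [N = e lam - delta], so that the dual of O' for the form [tr (x y)] with
   values modulo the ideal of exponent [lam] is the ideal of exponent [N]. *)
Local Notation N := ((it_e D)%:Z * lam - it_delta D).

Lemma videal_trace_dual (s : subvs_of k1) :
  (forall y, videal v1 0 y -> videal vK lam (ext_trace (s * y))) <->
  videal v1 N s.
Proof.
pose c := lf_unif K ^ (- lam); have c0 : c != 0 by apply: lf_unifXz_neq0.
have cA0 : (c%:A : subvs_of k1) != 0 by rewrite scaler_eq0 (negPf c0) oner_neq0.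
have vcA : v1 (c%:A) = - ((it_e D)%:Z * lam).
  by rewrite it_v1_scalar // lf_val_unifXz mulrN.
have scaled_mem : videal v1 (- it_delta D) (c%:A * s) <-> videal v1 N s.
  rewrite -(videal_mull v1P s N cA0) vcA (_ : - _ + N = - it_delta D) //.
  by lia.
have scaled_trace y : lf_int K (ext_trace (c%:A * s * y)) <->
    videal vK lam (ext_trace (s * y)).
  rewrite -mulrA mulr_algl ext_traceZ -(videal_unifXz_mul K (- lam)) addNr.
  by [].
have dual_delta := it_deltaP (i := D) (c%:A * s).
split=> [H|/scaled_mem/dual_delta H y hy]; last by apply/scaled_trace/H.
by apply/scaled_mem/dual_delta => y hy; apply/scaled_trace/H.
Qed.

Lemma videal_ext_trace_dual z :
  (forall y, videal v2 0 y -> videal vK lam (ext_trace (z * y))) <->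
  (forall y, videal v2 0 y -> videal v2 (e2 * N) (z * y + tau (z * y))).
Proof.
split=> H y hy.
  rewrite -(vsprojK (it_trace_mem (z * y))); apply/videal_vsval.
  apply/videal_trace_dual => y' hy'.
  have -> : vsproj k1 (z * y + tau (z * y)) * y' =
      vsproj k1 (z * (y * vsval y') + tau (z * (y * vsval y'))).
    apply: val_inj; rewrite /= !vsprojK ?it_trace_mem //.
    by rewrite mulrA [tau (z * y * _)]rmorphM it_tau_vsval mulrDl.
  rewrite -it_ext_trace; apply: H.
  rewrite -[0]addr0; apply: (videalM v2P) => //.
  by rewrite -[0](mulr0 e2); apply/videal_vsval.
rewrite it_ext_trace -[vsproj _ _]mulr1.
have /videal_trace_dual : videal v1 N (vsproj k1 (z * y + tau (z * y))).
  by apply/videal_vsval; rewrite vsprojK ?it_trace_mem //; apply: H.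
by apply; apply: videal1.
Qed.

Lemma it_unif1_neq0 : it_unif1 D != 0. Proof. by case: (it_unif1P D). Qed.

Lemma it_pi1_neq0 : pi1 != 0.
Proof. by rewrite vsval_eq0 it_unif1_neq0. Qed.

Lemma it_pi1Xz_neq0 m : pi1 ^ m != 0.
Proof. by rewrite expfz_neq0 // it_pi1_neq0. Qed.

Lemma it_v2_pi1Xz m : v2 (pi1 ^ m) = e2 * m.
Proof.
have [p0 p1] := it_unif1P D.
by rewrite (valuationXz v2P) ?it_pi1_neq0 // it_v2_vsval // p1 mulr1 mulrC.
Qed.

Lemma it_tau_pi1Xz m : tau (pi1 ^ m) = pi1 ^ m.
Proof.
by rewrite rmorphXz ?unitfE ?it_pi1_neq0 // it_tau_vsval.
Qed.

Lemma unramified_e2 : ~~ it_ramified D -> e2 = 1.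
Proof. by rewrite /it_ramified negbK => /eqP->. Qed.

Lemma ramified_e2 : it_ramified D -> e2 = 2 /\ v2 u = 1.
Proof.
rewrite /it_ramified => r; have := it_unif D; have := it_u_val D.
rewrite (negPf r) => -> E; have [p0 p1] := it_unif2P D; split=> //.
have := it_v2_pi1Xz 1; rewrite expr1z mulr1 => <-.
by rewrite -E expr2 (valuationM v2P) // p1.
Qed.

Lemma it_nu_neq0 : it_nu D != 0.
Proof. by rewrite mulf_neq0 ?it_u_neq0 ?it_pi1Xz_neq0. Qed.

Lemma it_tau_nu : tau (it_nu D) = - it_nu D.
Proof. by rewrite rmorphM it_tau_u it_tau_pi1Xz mulNr. Qed.

Lemma it_v2_nu : ~~ it_ramified D -> v2 (it_nu D) = 0.
Proof.
move=> /unramified_e2 e1; rewrite (valuationM v2P) ?it_u_neq0 ?it_pi1Xz_neq0 //.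
by rewrite it_v2_pi1Xz e1 mul1r subrr.
Qed.

Lemma trace_dual_unramified z : ~~ it_ramified D ->
  (forall y, videal v2 0 y -> videal v2 (e2 * N) (z * y + tau (z * y))) <->
  videal v2 N z.
Proof.
move=> r; have nu0 := it_nu_neq0; have vnu := it_v2_nu r.
rewrite (unramified_e2 r) mul1r; split=> [H|hz y hy]; last first.
  apply: (videalD v2P); rewrite ?videal_tau -[N]addr0;
  exact: (videalM v2P).
apply/videal_two_mul; have -> : 2 * z = (z + tau z) + (z - tau z) by ring.
apply: (videalD v2P); first by have := H 1 (videal1 v2P); rewrite mulr1.
apply/(videal_mul_unitl v2P (c := it_nu D)) => //.
have -> : it_nu D * (z - tau z) = z * it_nu D + tau (z * it_nu D).
  by rewrite rmorphM it_tau_nu; ring.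
by apply: H; right; rewrite vnu.
Qed.

(* A trace lies in k1, so its valuation is even: the exponent [2 * N - 1]
   bounds it by [2 * N]. *)
Lemma trace_dual_ramified z : it_ramified D ->
  (forall y, videal v2 0 y -> videal v2 (e2 * N) (z * y + tau (z * y))) <->
  videal v2 (2 * N - 1) z.
Proof.
move=> r; have [e2E vu] := ramified_e2 r; rewrite e2E.
split=> [H|hz y hy]; last first.
  have : videal v2 (2 * N - 1) (z * y + tau (z * y)).
    apply: (videalD v2P); rewrite ?videal_tau -[2 * N - 1]addr0;
    exact: (videalM v2P).
  rewrite -(vsprojK (it_trace_mem (z * y))).
  set s := vsproj _ _.
  have [->|s0] := eqVneq s 0; first by rewrite linear0; left.
  rewrite !mem_videal ?vsval_eq0 // it_v2_vsval // e2E; lia.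
apply/videal_two_mul; have -> : 2 * z = (z + tau z) + (z - tau z) by ring.
apply: (videalD v2P).
  apply: (sub_videal (n := 2 * N)); first by lia.
  by have := H 1 (videal1 v2P); rewrite mulr1.
apply/(videal_mull v2P _ _ it_u_neq0); rewrite vu.
have -> : u * (z - tau z) = z * u + tau (z * u).
  by rewrite rmorphM it_tau_u; ring.
by rewrite (_ : 1 + _ = 2 * N); [apply: H; right; rewrite vu | lia].
Qed.

Definition it_B_exponent : int :=
  if it_ramified D then mu else ((mu + 1) %/ 2)%Z.
Local Notation M := it_B_exponent.

Lemma mem_it_B w : B w <-> videal v2 M (iso w).
Proof.
rewrite /it_B /it_B_exponent /=; case: ifPn => [_|/unramified_e2 e1].
  have [p0 p1] := it_unif2P D.
  have c0 : it_unif2 D ^ mu != 0 by rewrite expfz_neq0.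
  rewrite -(videal_principal v2P (iso w) c0).
  by rewrite (valuationXz v2P) // p1 mulr1.
rewrite -(videal_principal v2P (iso w) (it_pi1Xz_neq0 _)).
by rewrite it_v2_pi1Xz e1 mul1r.
Qed.

Lemma dual_it_B_trace c w : c != 0 -> v2 c = M ->
  dual B w <-> (forall y, videal v2 0 y ->
    videal vK lam (ext_trace (u * tau (iso w) * c * y))).
Proof.
have [iso' isoK isoK'] := it_isoP D; have formE := @it_formE _ _ _ _ _ _ D.
move=> c0 vc; split=> H => [y hy|b /mem_it_B].
  have := H (iso' (c * y)).
  rewrite mem_it_B isoK' -vc videal_principal // formE.
  by rewrite isoK' mulrA videal_half; apply; exists y.
rewrite -vc videal_principal // => -[y hy bE].
by rewrite formE bE mulrA; apply/videal_half/H.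
Qed.

Lemma mem_dual_it_B w :
  dual B w <-> videal v2 (mu - if it_ramified D then 0 else M) (iso w).
Proof.
have [c c0 vc] : exists2 c : L, c != 0 & v2 c = M.
  have [p0 p1] := it_unif2P D.
  exists (it_unif2 D ^ M); first by rewrite expfz_neq0.
  by rewrite (valuationXz v2P) // p1 mulr1.
rewrite (dual_it_B_trace w c0 vc) videal_ext_trace_dual.
have [w0|w0] := eqVneq (iso w) 0.
  rewrite w0; split=> _; first by left.
  by move=> y hy; left; rewrite rmorph0 mulr0 !mul0r rmorph0 addr0.
set z := u * tau (iso w) * c.
have z0 : z != 0 by rewrite !mulf_neq0 ?it_u_neq0 ?fmorph_eq0.
have vz : v2 z = v2 u + v2 (iso w) + M.
  rewrite !(valuationM v2P) ?mulf_neq0 ?it_u_neq0 ?fmorph_eq0 //.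
  by rewrite it_v2_tau vc.
rewrite /it_B_exponent in vz *; have [r|r] := boolP (it_ramified D).
  rewrite trace_dual_ramified // !mem_videal // vz r /it_mu.
  by have [_ ->] := ramified_e2 r; lia.
rewrite trace_dual_unramified // !mem_videal // vz (negPf r) /it_mu; lia.
Qed.

Lemma not_self_dual_it_B : ~ self_dual K lam beta B ->
  ~~ it_ramified D /\ mu = 2 * M - 1.
Proof.
move=> nsd.
have dual_exponent_neq : M <> mu - (if it_ramified D then 0 else M).
  by move=> E; apply: nsd; apply/seteqP; split=> w;
    rewrite mem_dual_it_B mem_it_B -E.
move: dual_exponent_neq; rewrite /it_B_exponent.
by case: (it_ramified D) => neq; split=> //; lia.
Qed.

Lemma additive_subgroup_it_B : additive_subgroup B.
Proof.
split=> [|x y]; rewrite !mem_it_B; first by rewrite linear0; left.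
by rewrite linearB; apply: (videalB v2P).
Qed.

Lemma unramified_decomposition m x : ~~ it_ramified D -> videal v2 m x ->
  exists y z, [/\ videal v1 m y, videal v1 m z
    & x = vsval y + vsval z * it_nu D].
Proof.
move=> r hx; have e1 := unramified_e2 r.
have nu0 := it_nu_neq0; have two0 := it_two_neq0.
have tau2 : tau 2 = 2 by rewrite rmorph_nat.
have htx : videal v2 m (tau x) by apply/videal_tau.
pose y := (x + tau x) / 2; pose z := (x - tau x) / (2 * it_nu D).
have yk : y \in k1.
  apply/it_tau_fix; rewrite rmorphM fmorphV rmorphD it_tauK tau2.
  by rewrite [tau x + x]addrC.
have zk : z \in k1.
  apply/it_tau_fix; rewrite rmorphM fmorphV rmorphM rmorphB it_tauK tau2.
  by rewrite it_tau_nu /z; field; rewrite ?oppr_eq0 nu0 two0.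
have mem_v1 (t : subvs_of k1) : videal v1 m t <-> videal v2 m (vsval t).
  by rewrite -videal_vsval e1 mul1r.
exists (vsproj k1 y), (vsproj k1 z); split.
- apply/mem_v1; rewrite vsprojK //; apply/videal_two_mul.
  rewrite /y mulrC divfK //; exact: (videalD v2P).
- apply/mem_v1; rewrite vsprojK //.
  apply/videal_two_mul.
  apply/(videal_mul_unitl v2P (c := it_nu D)); rewrite ?it_v2_nu //.
  rewrite (_ : it_nu D * _ = x - tau x); first exact: (videalB v2P).
  by rewrite /z; field; rewrite ?nu0 ?two0.
- by rewrite !vsprojK // /y /z; field; rewrite ?nu0 ?two0.
Qed.

Lemma additive_subgroup_it_A : additive_subgroup A.
Proof.
have [sd|nsd] := pselect (self_dual K lam beta B).
  have [B0 BB] := additive_subgroup_it_B.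
  split=> [|x y]; first by left.
  by move=> [[_ Bx]|[]//] [[_ By]|[]//]; left; split=> //; apply: BB.
split=> [|w w']; first right.
  split=> //; exists 0, 0; split; [by left..|].
  by rewrite !linear0 !mul0r addr0 mulr0.
move=> [[//]|[_ [y [z [hy hz wE]]]]] [[//]|[_ [y' [z' [hy' hz' wE']]]]].
right; split=> //; exists (y - y'), (z - z'); split; [exact: (videalB v1P)..|].
by rewrite linearB /= wE wE'; ring.
Qed.

Lemma sub_it_B_it_A : B `<=` A.
Proof.
move=> w Bw; have [sd|nsd] := pselect (self_dual K lam beta B); first by left.
have [r muE] := not_self_dual_it_B nsd.
have mE : ((mu - 1) %/ 2)%Z = M - 1 by lia.
have [y [z [hy hz wE]]] := unramified_decomposition r ((mem_it_B w).1 Bw).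
right; split=> //; rewrite mE; set m := M - 1; have p0 := it_unif1_neq0.
have v1_unif n : v1 (it_unif1 D ^ n) = n.
  by have [_ p1] := it_unif1P D; rewrite (valuationXz v1P) // p1 mulr1.
have unif_mul n t : videal v1 M t -> videal v1 (n + M) (it_unif1 D ^ n * t).
  by move=> ht; rewrite -{1}(v1_unif n); apply/(videal_mull v1P);
    rewrite ?expfz_neq0.
exists (it_unif1 D ^ (- m) * y), (it_unif1 D ^ (- (m + 1)) * z); split.
- by apply: sub_videal (unif_mul _ _ hy); lia.
- by apply: sub_videal (unif_mul _ _ hz); lia.
have vsvalXz n : vsval (it_unif1 D ^ n) = pi1 ^ n by rewrite rmorphXz ?unitfE.
rewrite wE !rmorphM /= !vsvalXz mulrDr; congr (_ + _).
  by rewrite mulrA -expfzDr ?it_pi1_neq0 // subrr expr0z mul1r.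
have -> : pi1 ^ m * (pi1 ^ (- (m + 1)) * vsval z * pi1 * it_nu D) =
    pi1 ^ m * pi1 ^ 1 * pi1 ^ (- (m + 1)) * (vsval z * it_nu D).
  by rewrite expr1z; ring.
by rewrite -!expfzDr ?it_pi1_neq0 // subrr expr0z mul1r.
Qed.

Lemma sub_it_A_dual : A `<=` dual B.
Proof.
move=> w; case=> [[sd]|[nsd [y [z [hy hz wE]]]]]; first by rewrite {1}sd.
have [r muE] := not_self_dual_it_B nsd; have e1 := unramified_e2 r.
apply/mem_dual_it_B; rewrite (negPf r) wE; set q := pi1 ^ _.
have -> : mu - M = v2 q + 0 by rewrite it_v2_pi1Xz e1; lia.
apply/(videal_mull v2P); first exact: it_pi1Xz_neq0.
have int_vsval (t : subvs_of k1) : videal v1 0 t -> videal v2 0 (vsval t).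
  by move=> ht; rewrite -[0](mulr0 e2); apply/videal_vsval.
apply: (videalD v2P); first exact: int_vsval.
rewrite -mulrA -[0]addr0; apply: (videalM v2P); first exact: int_vsval.
apply: (sub_videal (n := 1 + 0)) => //; apply: (videalM v2P).
  by rewrite -[pi1]expr1z; right; rewrite it_v2_pi1Xz e1.
by right; rewrite it_v2_nu.
Qed.

Lemma lattice_chain_it : lattice_chain K lam beta A B.
Proof.
split; [exact: additive_subgroup_it_A | exact: additive_subgroup_it_B | |].
  exact: sub_it_B_it_A.
exact: sub_it_A_dual.
Qed.

Lemma stabilizer_it_B g : T g -> stabilizer beta B g.
Proof.
have [iso' isoK isoK'] := it_isoP D; have formE := @it_formE _ _ _ _ _ _ D.
move=> /(@it_torusE _ _ _ _ _ _ D)[t tt gE]; have t0 : t != 0.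
  by apply/eqP=> E; move/eqP: tt; rewrite E mul0r eq_sym oner_eq0.
have vt : v2 t = 0.
  have := valuationM v2P t0 (_ : tau t != 0); rewrite fmorph_eq0 tt => /(_ t0).
  by rewrite (valuation1 v2P) it_v2_tau; lia.
have memB_mul w w' : iso w' = t * iso w -> B w' <-> B w.
  by move=> E; rewrite !mem_it_B E; apply: (videal_mul_unitl v2P).
split=> [x y|].
  rewrite !formE !gE rmorphM; congr (_ * ext_trace _).
  by rewrite -[RHS]mul1r -tt; ring.
apply/seteqP; split=> [_ [w Bw <-]|w Bw]; first by apply/(memB_mul w).
exists (iso' (t^-1 * iso w)).
  by apply/(memB_mul _ w) => //; rewrite isoK' mulVKf.
by apply: (can_inj isoK); rewrite gE isoK' mulVKf.
Qed.

End TorusLattices.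

(** * Gauss sums *)

Section SumsOfTwoSquares.
Variable F : finFieldType.
Local Notation squares := [set x ^+ 2 | x : F]%SET.

Lemma card_sqr_eq (y : F) : (#|[pred x : F | x ^+ 2 == y]| <= 2 - (y == 0%R))%N.
Proof.
have [->|y0] := eqVneq y 0.
  by rewrite (@eq_card _ _ (pred1 (0 : F))) ?card1 // => x;
    rewrite !inE sqrf_eq0.
have [x|no_root] := pickP [pred x : F | x ^+ 2 == y]; last by rewrite eq_card0.
move=> /= /eqP xy; apply: (@leq_trans #|[set x; - x]%SET|).
  apply: subset_leq_card; apply/fintype.subsetP=> z.
  by rewrite !inE -xy eqf_sqr.
by rewrite cards2; case: eqP => // _; rewrite subn0.
Qed.

Lemma card_squares : (#|F| < 2 * #|squares|)%N.
Proof.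
have sq0 : 0 \in squares by apply/imsetP; exists 0; rewrite ?inE // expr0n.
have -> : #|F| = (\sum_(y in squares) #|[pred x : F | x ^+ 2 == y]|)%N.
  rewrite -sum1_card (partition_big (fun x : F => x ^+ 2) (mem squares)) /=.
    by apply: eq_bigr => y _; rewrite sum1_card.
  by move=> x _; apply: imset_f.
rewrite (bigD1 0) //= (cardsD1 0) sq0 mulnDr.
rewrite -addn1 addnAC leq_add //.
  by rewrite addn1 ltnS (leq_trans (card_sqr_eq 0)) // eqxx.
rewrite mulnC -sum_nat_const.
under [X in (_ <= X)%N]eq_bigl do rewrite in_setD1 andbC.
by apply: leq_sum => y _; rewrite (leq_trans (card_sqr_eq y)) // leq_subr.
Qed.

Lemma sum_two_squares_eq1 (a b : F) : a != 0 -> b != 0 ->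
  exists x y, a * x ^+ 2 + b * y ^+ 2 = 1.
Proof.
move=> a0 b0; pose S1 := [set a * x | x in squares]%SET.
pose S2 := [set 1 - b * x | x in squares]%SET.
have card1 : #|S1| = #|squares| by apply: card_imset => x y /(mulfI a0).
have card2 : #|S2| = #|squares|.
  by apply: card_imset => x y /addrI/oppr_inj/(mulfI b0).
have : S1 :&: S2 != finset.set0.
  apply/negP=> /eqP E; have := cardsUI S1 S2.
  rewrite E cards0 addn0 card1 card2 addnn -mul2n => U; have := card_squares.
  by rewrite -U ltnNge max_card.
case/set0Pn=> z /finset.setIP[/imsetP[_ /imsetP[x _ ->] ->]].
case/imsetP=> _ /imsetP[y _ ->] E; exists x, y.
by rewrite E subrK.
Qed.

End SumsOfTwoSquares.

Section GaussSums.
Variables (R : realType) (k : fieldType) (Fq : finFieldType).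
Variables (K : localField k Fq) (psi : k -> R[i]) (lam : int).
Hypothesis psiP : unitary_character K psi lam.
Local Notation psibar := (psibar K psi lam).
Local Notation omega := (omega K psi lam).
Let vP := lf_valP K.

Lemma psiD x y : psi (x + y) = psi x * psi y.
Proof. by case: psiP. Qed.

Lemma norm_psi x : `|psi x| = 1.
Proof. by case: psiP. Qed.

Lemma psi_neq0 x : psi x != 0.
Proof. by rewrite -normr_eq0 norm_psi oner_eq0. Qed.

Lemma psi_eq1 x : videal (lf_val K) lam x -> psi x = 1.
Proof. by case: psiP => _ _ + _; apply. Qed.

Lemma psi_sum (I : finType) (c : I -> k) : psi (\sum_i c i) = \prod_i psi (c i).
Proof. by apply: (big_morph psi psiD); apply: psi_eq1; apply: videal0. Qed.

Lemma psibarE z : lf_int K z ->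
  psibar (lf_red K z) = psi (lf_unif K ^ (lam - 1) * z).
Proof.
move=> hz; rewrite /Defs.psibar; case: xgetP => [y _ [hy yz]|/(_ z)[]//].
rewrite -[y](subrK z) mulrDr psiD psi_eq1 ?mul1r //.
rewrite -[X in videal _ X](subrK 1 lam); apply/videal_unifXz_mul.
apply/(lf_red_ker (l := K)); first exact: (videalB vP).
by rewrite lf_red_add ?lf_red_opp ?yz ?subrr //; apply/(videalN vP).
Qed.

Lemma psibarD x y : psibar (x + y) = psibar x * psibar y.
Proof.
have [x' hx <-] := lf_red_surj K x; have [y' hy <-] := lf_red_surj K y.
rewrite -lf_red_add // !psibarE //; first by rewrite mulrDr psiD.
exact: (videalD vP).
Qed.

Lemma psibar0 : psibar 0 = 1.
Proof.
by apply: (mulfI (psi_neq0 _ : psibar 0 != 0)); rewrite -psibarD addr0 mulr1.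
Qed.

Lemma psibar_nontrivial : exists y, psibar y != 1.
Proof.
case: psiP => _ _ _ [x hx psix]; exists (lf_red K (lf_unif K ^ (1 - lam) * x)).
rewrite psibarE; last first.
  rewrite /lf_int (_ : 0 = 1 - lam + (lam - 1)); last by lia.
  exact/videal_unifXz_mul.
rewrite mulrA -expfzDr ?lf_unif_neq0 // (_ : _ + _ = 0); last by lia.
by rewrite expr0z mul1r.
Qed.

Lemma sum_psibar a : \sum_t psibar (a * t) = if a == 0 then #|Fq|%:R else 0.
Proof.
have [->|a0] := eqVneq a 0.
  by under eq_bigr do rewrite mul0r psibar0; rewrite sumr_const.
have [y psiy] := psibar_nontrivial.
have : psibar y * \sum_t psibar (a * t) = \sum_t psibar (a * t).
  rewrite mulr_sumr [RHS](reindex_inj (addrI (a^-1 * y))) /=.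
  by apply: eq_bigr => t _; rewrite mulrDr mulVKf // psibarD.
move/eqP; rewrite -subr_eq0 -{2}[\sum_t _]mul1r -mulrBl mulf_eq0 subr_eq0.
by rewrite (negPf psiy) => /eqP.
Qed.

Definition gauss_sum (a : Fq) : R[i] := \sum_t psibar (2^-1 * a * t ^+ 2).

Lemma gauss_sum_mulE a b : gauss_sum a * gauss_sum b =
  \sum_(s : Fq * Fq) psibar (2^-1 * (a * s.1 ^+ 2 + b * s.2 ^+ 2)).
Proof.
rewrite /gauss_sum big_distrlr pair_big /=; apply: eq_bigr => -[s t] _ /=.
by rewrite -psibarD mulrDr !mulrA.
Qed.

(* [a s^2 - a t^2] is a hyperbolic plane, over which the sum is [q]. *)
Lemma gauss_sum_neq0 a : a != 0 -> gauss_sum a != 0.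
Proof.
move=> a0; have two0 := lf_res_two_neq0 K.
have q0 : (#|Fq|%:R : R[i]) != 0.
  by rewrite pnatr_eq0 -lt0n; apply/card_gt0P; exists 0.
suff E : gauss_sum a * gauss_sum (- a) = #|Fq|%:R.
  by apply/eqP=> g0; move/eqP: E; rewrite g0 mul0r eq_sym (negPf q0).
rewrite gauss_sum_mulE.
pose f (s : Fq * Fq) := (2^-1 * (s.1 + s.2), 2^-1 * (s.1 - s.2)).
have f_inj : injective f.
  apply: (can_inj (g := fun s => (s.1 + s.2, s.1 - s.2))) => -[s t].
  by congr pair => /=; field.
rewrite (reindex_inj f_inj) /=.
transitivity (\sum_s \sum_t psibar (2^-1 * a * s * t)).
  rewrite pair_big /=; apply: eq_bigr => -[s t] _ /=; congr psibar; field.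
  exact: two0.
under eq_bigr do rewrite sum_psibar.
rewrite (bigD1 0) //= mulr0 eqxx big1 ?addr0 // => s s0.
by rewrite !mulf_eq0 invr_eq0 (negPf two0) (negPf a0) (negPf s0).
Qed.

(* A binary form represents 1, so [a s^2 + b t^2] is equivalent to
   [s^2 + a b t^2]. *)
Lemma gauss_sumM a b : a != 0 -> b != 0 ->
  gauss_sum a * gauss_sum b = gauss_sum 1 * gauss_sum (a * b).
Proof.
move=> a0 b0; have [x [y xy]] := sum_two_squares_eq1 a0 b0.
rewrite !gauss_sum_mulE.
pose f (s : Fq * Fq) := (x * s.1 - b * y * s.2, y * s.1 + a * x * s.2).
have f_inj : injective f.
  apply: (can_inj (g := fun s => (a * x * s.1 + b * y * s.2,
                                  x * s.2 - y * s.1))) => -[s t].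
  by congr pair => /=; rewrite -[RHS]mul1r -xy; ring.
rewrite (reindex_inj f_inj) /=; apply: eq_bigr => -[s t] _ /=.
congr (psibar (_ * _)).
transitivity ((a * x ^+ 2 + b * y ^+ 2) * (s ^+ 2 + a * b * t ^+ 2));
  first by ring.
by rewrite xy mul1r mul1r.
Qed.

Lemma sqrtq_neq0 : sqrtC (#|Fq|%:R : R[i]) != 0.
Proof.
by rewrite sqrtC_eq0 pnatr_eq0 -lt0n; apply/card_gt0P; exists 0.
Qed.

Lemma omega_neq0 a : a != 0 -> omega a != 0.
Proof.
by move=> a0; rewrite mulf_neq0 ?invr_eq0 ?sqrtq_neq0 //; apply: gauss_sum_neq0.
Qed.

Lemma omegaM a b : a != 0 -> b != 0 ->
  omega a * omega b = omega 1 * omega (a * b).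
Proof.
move=> a0 b0; rewrite /Defs.omega -!/(gauss_sum _) mulrACA gauss_sumM //.
by rewrite mulrACA.
Qed.

Lemma omega_mod_squares a b : eq_mod_squares a b -> omega a = omega b.
Proof.
move=> [s s0 ->]; rewrite /Defs.omega; congr (_ * _).
rewrite [RHS](reindex_inj (mulfI s0)); apply: eq_bigr => t _ /=.
by congr psibar; ring.
Qed.

Lemma omega_prod n (a : 'I_n -> Fq) : (forall i, a i != 0) ->
  omega (\prod_i a i) = omega 1 * \prod_i (omega (a i) / omega 1).
Proof.
have w0 := omega_neq0 (oner_neq0 Fq).
elim: n a => [|n IHn] a a0; first by rewrite !big_ord0 mulr1.
have p0 : \prod_(i < n) a (lift ord0 i) != 0 by apply/prodf_neq0 => i _.
rewrite !big_ord_recl; apply: (mulfI w0); rewrite -omegaM // IHn //.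
by field.
Qed.

Lemma omega_factor_prod n (a : 'I_n -> Fq) (j : 'I_n -> nat) b :
  (forall i, a i != 0) -> eq_mod_squares b (\prod_i a i) ->
  (omega b)^-1 * omega 1 ^ (1 - (\sum_i j i)%N%:Z) =
  \prod_i ((omega (a i))^-1 * omega 1 ^ (1 - (j i)%:Z)).
Proof.
move=> a0 /omega_mod_squares->; have w0 := omega_neq0 (oner_neq0 Fq).
have split_exponent m : omega 1 ^ (1 - m%:Z) = omega 1 / omega 1 ^+ m.
  by rewrite expfzDr // expr1z exprnN.
under [RHS]eq_bigr do
  rewrite split_exponent mulrA [_^-1 * _]mulrC -[omega 1 / omega _]invf_div.
rewrite [RHS]big_split !prodfV /= omega_prod // split_exponent -prodrXr invfM.
by rewrite mulrACA mulVf // mul1r.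
Qed.

End GaussSums.

(** * Coset representatives and the Weil operator *)

Lemma prod_sum_fprod (R : comPzSemiRingType) (I : finType) (T_ : I -> finType)
    (P : forall i, T_ i -> R) :
  \prod_i \sum_(j : T_ i) P i j = \sum_(t : fprod T_) \prod_i P i (t i).
Proof.
under eq_bigr do rewrite big_tag.
rewrite bigA_distr_big_dep.
have -> : \sum_(t : fprod T_) \prod_i P i (t i) =
    \sum_(t : fprod T_) \prod_(i in I) (finfun (P i)) (t i).
  by apply: eq_bigr => t _; apply: eq_bigr => i _; rewrite ffunE.
rewrite big_fprod; apply: eq_bigr => f _; apply: eq_bigr => i _.
by rewrite /untag; case: eqP => // e; rewrite ffunE.
Qed.

Lemma fsbig_setT (R : Type) (idx : R) (op : Monoid.com_law idx) (I : finType)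
    (F : I -> R) :
  \big[op/idx]_(i \in [set: I]) F i = \big[op/idx]_i F i.
Proof.
rewrite [RHS](bigfs _ (P := xpredT)) ?index_enum_uniq //.
  by apply: eq_fsbigl; apply/seteqP; split.
by move=> i _; rewrite mem_index_enum.
Qed.

Lemma finite_vect (F : finFieldType) (V : vectType F) : finite_set [set: V].
Proof.
pose f (c : {ffun 'I_(\dim {:V}) -> F}) := \sum_i c i *: (vbasis {:V})`_i.
have -> : [set: V] = f @` setT.
  apply/seteqP; split=> // v _.
  exists [ffun i => coord (vbasis {:V}) i v] => //.
  rewrite [RHS](coord_vbasis (memvf v)).
  by apply: eq_bigr => i _; rewrite ffunE.
by apply: finite_image; apply: finite_finset.
Qed.

Section Representatives.
Variables (k : fieldType) (W : vectType k) (M L : set W).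
Hypothesis LP : additive_subgroup L.

Definition rep a := xget 0 [set x | M x /\ L (x - a)].

Lemma repP a : M a -> M (rep a) /\ L (rep a - a).
Proof.
move=> Ma; rewrite /rep; case: xgetP => [x _ //|/(_ a)[]].
by rewrite /= subrr; split=> //; case: LP.
Qed.

Lemma rep_eq a b : L (a - b) -> rep a = rep b.
Proof.
move=> ab; rewrite /rep; congr (xget 0).
apply/seteqP; split=> x /= [Mx xL]; split=> //.
  exact: (additive_subgroup_trans LP xL).
apply: (additive_subgroup_trans LP xL).
exact: additive_subgroup_sym.
Qed.

Lemma reps_rep a : M a -> reps M L (rep a).
Proof. by exists a. Qed.

Lemma sub_reps : reps M L `<=` M.
Proof. by move=> _ [a Ma <-]; case: (repP Ma). Qed.

Lemma rep_id r : reps M L r -> rep r = r.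
Proof. by case=> a Ma <-; apply: rep_eq; case: (repP Ma). Qed.

Lemma reps_inj r r' : reps M L r -> reps M L r' -> L (r - r') -> r = r'.
Proof. by move=> /rep_id{2}<- /rep_id{2}<-; apply: rep_eq. Qed.

Definition coset_transversal (I : finType) (x : I -> W) : Prop :=
  [/\ forall i, M (x i), forall a, M a -> exists i, L (x i - a)
    & forall i j, L (x i - x j) -> i = j].

Section BigReps.
Variables (I : finType) (x : I -> W).
Hypothesis xT : coset_transversal x.

Let rep_inj : injective (rep \o x).
Proof.
have [xM _ x_inj] := xT; move=> i j /= E; apply: x_inj.
have [[_ xi] [_ xj]] := (repP (xM i), repP (xM j)).
by apply: (additive_subgroup_congr LP xi); rewrite E.
Qed.

Let repsE : reps M L = (rep \o x) @` setT.
Proof.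
have [xM x_cover _] := xT.
apply/seteqP; split=> [_ [a Ma <-]|_ [i _ <-]]; last exact: reps_rep.
by have [i /rep_eq E] := x_cover a Ma; exists i.
Qed.

Lemma big_reps (R : Type) (idx : R) (op : Monoid.com_law idx) (G : W -> R) :
  (forall a b, M a -> M b -> L (a - b) -> G a = G b) ->
  \big[op/idx]_(a \in reps M L) G a = \big[op/idx]_i G (x i).
Proof.
move=> GL; rewrite repsE fsbig_image; last by move=> i j _ _; apply: rep_inj.
rewrite fsbig_setT; apply: eq_bigr => i _ /=.
by have [xM _ _] := xT; have [h1 h2] := repP (xM i); apply: GL.
Qed.

Lemma lat_index_transversal : lat_index M L = #|I|.
Proof.
have reps_finite : finite_set (reps M L).
  by rewrite repsE; apply: finite_image; apply: finite_finset.
rewrite /lat_index -sum1_size -(fsbig_finite _ _ reps_finite).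
by rewrite big_reps // sum1_card.
Qed.

End BigReps.

Lemma exists_coset_transversal : finite_set (reps M L) ->
  exists (I : finType) (x : I -> W), coset_transversal x.
Proof.
move=> finML; pose X := fset_set (reps M L).
have XE w : (w \in X) = (w \in reps M L) by apply: in_fset_set.
have XP (i : X) : reps M L (val i) by have := valP i; rewrite XE inE.
exists (fset_sub_type X : finType), (fun i => val i); split.
- by move=> i; apply/sub_reps/XP.
- move=> a Ma; have rX : rep a \in X by rewrite XE inE; apply: reps_rep.
  by exists [` rX]%fset => /=; case: (repP Ma).
- by move=> i j ij; apply: val_inj; apply: reps_inj ij.
Qed.

End Representatives.

Section WeilOperators.
Variables (R : realType) (k : fieldType) (Fq : finFieldType).
Variables (K : localField k Fq) (psi : k -> R[i]) (lam : int).
Hypothesis psiP : unitary_character K psi lam.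
Variables (W : vectType k) (beta : W -> W -> k) (A B : set W).
Hypothesis betaP : symplectic_form beta.
Let bP := symplectic_skew betaP.

Definition quasiperiodic (phi : W -> R[i]) : Prop :=
  forall a w, A a -> phi (a + w) = psi (2^-1 * beta w a) * phi w.

Section OneOperator.
Hypothesis AP : additive_subgroup A.
Variable g : 'End(W).
Hypothesis gS : Sp beta g.

Lemma additive_subgroup_capg : additive_subgroup (A `&` g @` A).
Proof.
have A0 := additive_subgroup0 AP; split=> [|x y [Ax [a Aa ax]] [Ay [b Ab bx]]].
  by split=> //; exists 0; rewrite ?linear0.
split; first exact: (additive_subgroupB AP).
by exists (a - b); [exact: (additive_subgroupB AP) | rewrite linearB /= ax bx].
Qed.

Lemma finite_reps_capg : lattice_chain K lam beta A B -> stabilizer beta B g ->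
  residualSpace K lam beta A B -> finite_set (reps A (A `&` g @` A)).
Proof.
move=> [_ _ BA AD] gB Q; have LP := additive_subgroup_capg.
have B_sub_cap w : B w -> (A `&` g @` A) w.
  move=> Bw; split; first exact: BA.
  exists ((g^-1)%VF w); first by apply/BA/(stabilizer_memV gB).
  by rewrite lker0_lfunVK // (lker0_Sp betaP gS).
rewrite -(eq_finite_set (inj_card_eq (f := rs_pr Q) _)).
  by apply: sub_finite_set (@finite_vect _ (rs_space Q)).
move=> r r'; rewrite !inE => hr hr' E; apply: (reps_inj LP hr hr').
by apply/B_sub_cap/(rs_pr_eq betaP Q) => //; apply/AD/(sub_reps LP).
Qed.

Variables (Q : residualSpace K lam beta A B) (theta : 'End(rs_space Q) -> Fq).

Definition weil_factor : R[i] :=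
  mfactor psi theta (reduction Q g) * sqrtC #|Fq|%:R ^+ rs_j (reduction Q g).

Lemma weil_op_transversal (phi : W -> R[i]) (I : finType) (x : I -> W) w :
  A `<=` dual_lattice K lam beta A -> quasiperiodic phi ->
  coset_transversal A (A `&` g @` A) x ->
  weil_op psi theta g phi w = weil_factor * (#|I|%:R)^-1
    * \sum_i psi (2^-1 * beta (x i) w) * phi ((g^-1)%VF (x i + w)).
Proof.
move=> A_iso phiA xT; have LP := additive_subgroup_capg.
rewrite /weil_op (lat_index_transversal LP xT); congr (_ * _).
apply: (big_reps LP xT) => a b Aa Ab [Al [a' Aa' la]].
have -> : a = b + g a' by rewrite la addrC subrK.
have -> : (g^-1)%VF (b + g a' + w) = a' + (g^-1)%VF (b + w).
  by rewrite addrAC addrC linearD /= lker0_lfunK // (lker0_Sp betaP gS).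
rewrite phiA // mulrA -(psiD psiP) (skewDl bP).
have -> : beta ((g^-1)%VF (b + w)) a' = beta (b + w) (g a').
  by rewrite [RHS](skewC bP) (Sp_adjoint betaP) // -(skewC bP).
rewrite (skewDl bP) -mulrDr.
have -> : beta b w + beta (g a') w + (beta b (g a') + beta w (g a')) =
    beta b w + beta b (g a').
  by rewrite [beta (g a') w](skewC bP); ring.
rewrite mulrDr (psiD psiP) [X in _ * X * _](psi_eq1 psiP) ?mulr1 //.
by apply/videal_half/A_iso; rewrite // la.
Qed.

End OneOperator.

Lemma weil_factor1 (Q : residualSpace K lam beta A B)
    (theta : 'End(rs_space Q) -> Fq) :
  theta_function theta -> weil_factor \1%VF theta = 1.
Proof.
move=> thetaP; have bQ := rs_form_skew betaP Q.
have id_stab := stabilizer_id beta B.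
have [e [f [ef ex]]] := exists_lagrangian_basis thetaP.
have red1 : reduction Q \1%VF = \1%VF.
  apply/lfunP=> u; have [y hy <-] := rs_pr_surj u.
  by rewrite (reductionE betaP Q id_stab) // !id_lfunE.
have bruhat1 : bruhat_form (rs_form (r := Q)) (rs_lagr Q) \1%VF e f
    finset.set0 1%:M.
  split=> //; rewrite lincomb1; apply/funext=> i.
  by rewrite /= id_lfunE /exchange inE.
have id_Sp : Sp (rs_form (r := Q)) \1%VF by move=> u v; rewrite !id_lfunE.
rewrite /weil_factor red1 /mfactor (rs_j_bruhat betaP id_Sp bruhat1) cards0.
rewrite (omega_mod_squares K psi lam (theta_bruhat betaP thetaP id_Sp bruhat1)).
rewrite expr0 mulr1 subr0 expr1z det1 mulVf //.
by apply: (omega_neq0 psiP); rewrite oner_neq0.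
Qed.

End WeilOperators.

(** * Norms *)

Section SquaredNorms.
Variables (R : realType) (k : fieldType) (Fq : finFieldType).
Variables (K : localField k Fq) (psi : k -> R[i]) (lam : int).
Hypothesis psiP : unitary_character K psi lam.

Definition sqmod (z : R[i]) : R := complex.Re (`|z| ^+ 2).

Lemma sqmod_normc z : sqmod z = Normc.normc z ^+ 2.
Proof. by case: z => a b; rewrite /sqmod normc_def -rmorphXn. Qed.

Lemma sqmod_ge0 z : 0 <= sqmod z.
Proof. by rewrite sqmod_normc sqr_ge0. Qed.

Lemma sqmodM y z : sqmod (y * z) = sqmod y * sqmod z.
Proof. by rewrite !sqmod_normc Normc.normcM exprMn. Qed.

Lemma sqmod_prod (I : finType) (z : I -> R[i]) :
  sqmod (\prod_i z i) = \prod_i sqmod (z i).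
Proof. by apply: (big_morph sqmod sqmodM); rewrite /sqmod normr1 expr1n. Qed.

Lemma sqmod_quasiperiodic (W : vectType k) (beta : W -> W -> k) (A : set W)
    (phi : W -> R[i]) x y :
  quasiperiodic psi beta A phi -> A (x - y) -> sqmod (phi x) = sqmod (phi y).
Proof.
move=> phiA Axy; rewrite -{1}[x](subrK y) phiA //.
by rewrite /sqmod normrM (norm_psi psiP) mul1r.
Qed.

Lemma sqnorm_comp_le (W W' : vectType k) (beta' : W' -> W' -> k)
    (A : set W) (A' : set W') (f : W -> W') (phi : W' -> R[i]) :
  additive_subgroup A -> additive_subgroup A' ->
  (forall x y, A' (f x - f y) -> A (x - y)) -> quasiperiodic psi beta' A' phi ->
  (sqnorm A (phi \o f) <= sqnorm A' phi)%E.
Proof.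
move=> AP AP' fA phiA; pose F w := rep setT A' (f w).
have FP w : A' (F w - f w) by case: (repP (M := setT) AP' (a := f w)).
have -> : sqnorm A (phi \o f) =
    (\esum_(w in reps setT A) (sqmod (phi (F w)))%:E)%R.
  apply: eq_esum => w _; congr EFin; apply/esym/(sqmod_quasiperiodic phiA).
  exact: FP.
rewrite -(esum_image _ F (fun w => (sqmod (phi w))%:E)).
  apply: ereal_sup_le => _ [X [finX XS] <-]; exists X => //; split=> // y /XS.
  by case=> w _ <-; apply: reps_rep.
move=> x y; rewrite !inE => hx hy E; apply: (reps_inj AP hx hy); apply: fA.
by apply: (additive_subgroup_congr AP' (FP x)); rewrite E; apply: FP.
Qed.

Lemma sqnorm_ge0 (W : vectType k) (A : set W) (phi : W -> R[i]) :
  (0 <= sqnorm A phi)%E.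
Proof. by apply: esum_ge0 => w _; rewrite lee_fin; apply: sqmod_ge0. Qed.

Lemma sum_le_sqnorm (W : vectType k) (A : set W) (phi : W -> R[i])
    (X : {fset W}) :
  [set` X] `<=` reps setT A ->
  ((\sum_(w <- X) sqmod (phi w))%:E <= sqnorm A phi)%E.
Proof.
move=> XA; apply: ereal_sup_ubound; exists [set` X].
  by split=> //; apply: finite_fset.
by rewrite (fsbig_finite _ _ (finite_fset X)) set_fsetK sumEFin.
Qed.

Lemma sqnorm_le (W : vectType k) (A : set W) (phi : W -> R[i]) (c : R) :
  (forall X : {fset W}, [set` X] `<=` reps setT A ->
     \sum_(w <- X) sqmod (phi w) <= c) -> (sqnorm A phi <= c%:E)%E.
Proof.
move=> Xc; apply: ge_ereal_sup => _ [X [finX XA] <-].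
rewrite fsbig_finite //= sumEFin lee_fin; apply: Xc => w.
by rewrite /= in_fset_set // inE; apply: XA.
Qed.

End SquaredNorms.

(* The right-hand side is the sum over the box spanned by the points of [X]. *)
Lemma sum_prod_le_prod_sum (R : realDomainType) (I : finType) (U : choiceType)
    (T_ : I -> choiceType) (r : forall i, U -> T_ i) (F : forall i, T_ i -> R)
    (X : {fset U}) :
  (forall i z, 0 <= F i z) ->
  {in X &, forall x y, (forall i, r i x = r i y) -> x = y} ->
  \sum_(x <- X) \prod_i F i (r i x) <=
  \prod_i \sum_(z <- [fset r i x | x in X]%fset) F i z.
Proof.
move=> F_ge0 r_inj; pose Z i := [fset r i x | x in X]%fset.
have rZ i (x : X) : r i (val x) \in Z i by apply: in_imfset; exact: valP.
pose f (x : X) : fprod (fun i => (Z i : finType)) :=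
  fprod_of_fun (fun i => [` rZ i x]%fset).
have f_inj : injective f.
  move=> x y E; apply/val_inj/r_inj => [||i]; try exact: valP.
  by have := congr1 (fun t : fprod _ => val (t i)) E; rewrite !fprodE.
rewrite (big_seq_fsetE _ X xpredT (fun x => \prod_i F i (r i x))) /=.
have -> : \prod_i \sum_(z <- Z i) F i z =
    \sum_(t : fprod (fun i => (Z i : finType))) \prod_i F i (val (t i)).
  rewrite -(prod_sum_fprod (fun i (z : Z i) => F i (val z))).
  by apply: eq_bigr => i _; rewrite (big_seq_fsetE _ (Z i) xpredT (F i)).
rewrite (eq_bigr (fun x => \prod_i F i (val (f x i)))); last first.
  by move=> x _; apply: eq_bigr => i _; rewrite fprodE.
rewrite -(big_imset (fun t : fprod _ => \prod_i F i (val (t i)))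
  (h := f) (A := predT)) /=.
  rewrite big_mkcond; apply: ler_sum => t _; case: ifP => // _.
  by apply: prodr_ge0 => i _.
by move=> x y _ _; apply: f_inj.
Qed.

(** * Orthogonal decompositions *)

Section OrthogonalDecompositions.
Variables (k : fieldType) (W : vectType k) (beta : W -> W -> k).
Variables (n : nat) (Ws : 'I_n -> {vspace W}).
Local Notation comp := (component Ws).
Local Notation sbeta := (sub_form beta Ws).

Definition orthogonal_decomposition : Prop :=
  [/\ (\sum_i Ws i)%VS = {:W}%VS, directv (\sum_i Ws i)
    & forall i j x y, i != j -> x \in Ws i -> y \in Ws j -> beta x y = 0].

Definition block_diagonal (g : 'End(W)) : Prop :=
  forall i x, x \in Ws i -> g x \in Ws i.

Lemma component_linear i : linear (comp i).
Proof. by move=> a x y; rewrite /component !linearP. Qed.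

HB.instance Definition _ i :=
  GRing.isLinear.Build k W (subvs_of (Ws i)) *:%R (comp i) (component_linear i).

Hypothesis WsP : orthogonal_decomposition.

Lemma sum_component w : \sum_i vsval (comp i w) = w.
Proof.
have [sumW _ _] := WsP.
rewrite -[RHS](sumv_pi_sum (erefl (\sum_(j < n) Ws j)%VS));
  last by rewrite sumW memvf.
by apply: eq_bigr => i _; rewrite /component vsprojK // memv_sum_pi.
Qed.

Lemma component_sum_mem (v : 'I_n -> W) i :
  (forall j, v j \in Ws j) -> vsval (comp i (\sum_j v j)) = v i.
Proof.
have [_ dW _] := WsP => hv; have /directv_sum_unique := dW.
move=> /(_ (fun j => vsval (comp j (\sum_j v j))) v).
rewrite sum_component eqxx => /(_ (fun j _ => subvsP _) (fun j _ => hv j)).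
by move/esym/forall_inP => /(_ i isT)/eqP.
Qed.

Lemma component_sum (y : forall i, subvs_of (Ws i)) i :
  comp i (\sum_j vsval (y j)) = y i.
Proof.
apply: val_inj; apply: (component_sum_mem (v := fun j => vsval (y j))) => j.
exact: subvsP.
Qed.

Lemma component_vsvalE i j (y : subvs_of (Ws i)) :
  vsval (comp j (vsval y)) = if j == i then vsval y else 0.
Proof.
rewrite -(component_sum_mem (v := fun j => if j == i then vsval y else 0)).
  by rewrite -big_mkcond big_pred1_eq.
by move=> m; case: eqP => [->|_]; [exact: subvsP | exact: mem0v].
Qed.

Lemma component_vsval i (y : subvs_of (Ws i)) : comp i (vsval y) = y.
Proof. by apply: val_inj; rewrite /= component_vsvalE eqxx. Qed.

Lemma component_vsval_neq i j (y : subvs_of (Ws i)) :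
  j != i -> comp j (vsval y) = 0.
Proof. by move=> /negPf ji; apply: val_inj; rewrite /= component_vsvalE ji. Qed.

Lemma component_inj x y : (forall i, comp i x = comp i y) -> x = y.
Proof.
move=> E; rewrite -[x]sum_component -[y]sum_component.
by apply: eq_bigr => i _; rewrite E.
Qed.

Section Blocks.
Variable g : 'End(W).
Hypothesis gW : block_diagonal g.

Lemma restrE i y : vsval (restr Ws i g y) = g (vsval y).
Proof.
rewrite /restr linfunE; first by rewrite vsprojK // gW // subvsP.
by move=> a x z; rewrite !linearP.
Qed.

Lemma component_block i w : comp i (g w) = restr Ws i g (comp i w).
Proof.
apply: val_inj; rewrite /= restrE -{1}[w]sum_component linear_sum.
apply: (component_sum_mem (v := fun j => g (vsval (comp j w)))) => j.
by apply: gW; apply: subvsP.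
Qed.

End Blocks.

Lemma block_diagonal_inj g h : block_diagonal g -> block_diagonal h ->
  (forall i, restr Ws i g = restr Ws i h) -> g = h.
Proof.
move=> gW hW E; apply/lfunP=> w; apply: component_inj => i.
by rewrite !component_block // E.
Qed.

Lemma block_diagonal_id : block_diagonal \1%VF.
Proof. by move=> i x; rewrite id_lfunE. Qed.

Lemma restr_id i : restr Ws i \1%VF = \1%VF.
Proof.
apply/lfunP=> y; apply: val_inj; rewrite /= restrE ?id_lfunE //.
exact: block_diagonal_id.
Qed.

Lemma block_diagonal_comp g h : block_diagonal g -> block_diagonal h ->
  block_diagonal (g \o h)%VF.
Proof. by move=> gW hW i x xi; rewrite comp_lfunE; apply/gW/hW. Qed.

Lemma restr_comp i g h : block_diagonal g -> block_diagonal h ->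
  restr Ws i (g \o h)%VF = (restr Ws i g \o restr Ws i h)%VF.
Proof.
move=> gW hW; have ghW := block_diagonal_comp gW hW.
by apply/lfunP=> y; apply: val_inj;
  rewrite /= comp_lfunE !restrE ?comp_lfunE ?restrE.
Qed.

Section Embeddings.
Variables (i : 'I_n) (t : 'End(subvs_of (Ws i))).

Lemma embedE w : embed Ws i t w = w - vsval (comp i w) + vsval (t (comp i w)).
Proof.
rewrite /embed linfunE // => a x y; rewrite !linearP /= scalerDr scalerBr.
by rewrite scalerN [X in X + _ = _]addrACA [LHS]addrACA.
Qed.

Lemma component_embed w : comp i (embed Ws i t w) = t (comp i w).
Proof.
by rewrite embedE linearD linearB /= !component_vsval subrr add0r.
Qed.

Lemma component_embed_neq j w : j != i -> comp j (embed Ws i t w) = comp j w.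
Proof.
move=> ji; rewrite embedE linearD linearB /= !component_vsval_neq //.
by rewrite subr0 addr0.
Qed.

Lemma block_diagonal_embed : block_diagonal (embed Ws i t).
Proof.
move=> j x xj; have [E|ji] := eqVneq j i.
  by subst j; rewrite embedE memvD ?memvB ?subvsP.
rewrite embedE -(vsprojK xj) component_vsval_neq 1?eq_sym // !linear0.
by rewrite !addr0 subvsP.
Qed.

Lemma restr_embed : restr Ws i (embed Ws i t) = t.
Proof.
apply/lfunP=> y; rewrite -[in LHS](component_vsval y) -component_block.
  by rewrite component_embed component_vsval.
exact: block_diagonal_embed.
Qed.

Lemma restr_embed_neq j : j != i -> restr Ws j (embed Ws i t) = \1%VF.
Proof.
move=> ji; apply/lfunP=> y.
rewrite -[in LHS](component_vsval y) -component_block.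
  by rewrite component_embed_neq // component_vsval id_lfunE.
exact: block_diagonal_embed.
Qed.

End Embeddings.

Hypothesis betaP : symplectic_form beta.
Let bP := symplectic_skew betaP.

Lemma form_vsvall i (y : subvs_of (Ws i)) w :
  beta (vsval y) w = sbeta i y (comp i w).
Proof.
have [_ _ orth] := WsP.
rewrite -{1}[w]sum_component (skew_sumr bP) (bigD1 i) //=.
rewrite big1 ?addr0 // => j ji.
by rewrite (orth i j) ?subvsP // eq_sym.
Qed.

Lemma form_vsvalr i (y : subvs_of (Ws i)) w :
  beta w (vsval y) = sbeta i (comp i w) y.
Proof. by rewrite (skewC bP) form_vsvall /sub_form -(skewC bP). Qed.

Lemma form_componentE x y : beta x y = \sum_i sbeta i (comp i x) (comp i y).
Proof.
rewrite -{1}[x]sum_component (skew_suml bP).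
by apply: eq_bigr => i _; rewrite form_vsvall.
Qed.

Lemma sub_form_symplectic i : symplectic_form (sbeta i).
Proof.
have [bl br bx nondeg] := betaP; split=> [a x y z|a x y z|x|x x0];
  rewrite /sub_form.
- by rewrite linearP bl.
- by rewrite linearP br.
- exact: bx.
by apply: val_inj; apply: nondeg => w; rewrite form_vsvall x0.
Qed.

Section BlockIsometries.
Variable g : 'End(W).
Hypothesis gW : block_diagonal g.
Hypothesis gS : forall i, Sp (sbeta i) (restr Ws i g).

Lemma block_diagonal_Sp : Sp beta g.
Proof.
move=> x y; rewrite !form_componentE; apply: eq_bigr => i _.
by rewrite !component_block // gS.
Qed.

Lemma component_inv i w :
  comp i ((g^-1)%VF w) = (restr Ws i g)^-1%VF (comp i w).
Proof.
have g0 := lker0_Sp betaP block_diagonal_Sp.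
have r0 := lker0_Sp (sub_form_symplectic i) (@gS i).
by rewrite -{2}(lker0_lfunVK g0 w) component_block // lker0_lfunK.
Qed.

End BlockIsometries.

End OrthogonalDecompositions.

Section TorusDecompositions.
Variables (k : fieldType) (W : vectType k) (beta : W -> W -> k).
Variables (T : set 'End(W)) (n : nat) (Ws : 'I_n -> {vspace W}).
Hypotheses (Tgroup : subgroup T) (TP : torus_decomposition beta T Ws).

Lemma torus_orthogonal_decomposition : orthogonal_decomposition beta Ws.
Proof.
have [[sumW dW] orth _ _ _] := TP.
by split=> // i j x y ij; apply: orth.
Qed.

Let WsP := torus_orthogonal_decomposition.

Lemma torus_block_diagonal g : T g -> block_diagonal Ws g.
Proof.
move=> Tg i x xi; have [_ _ _ /(_ i)[_ stab _] _] := TP.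
by apply: (subvP (stab _ Tg)); apply: memv_img.
Qed.

Lemma torus_embed g i : T g -> T (embed Ws i (restr Ws i g)).
Proof.
move=> Tg; have T1 : T \1%VF by case: Tgroup.
have [_ _ _ _ T_prod] := TP.
have [|h Th hE] := T_prod (fun j => restr Ws j (if j == i then g else \1%VF)).
  by move=> j; case: ifP => _; [exists g | exists \1%VF].
suff -> : embed Ws i (restr Ws i g) = h by [].
apply: (block_diagonal_inj WsP) => [||j];
  first exact: (block_diagonal_embed WsP).
  exact: torus_block_diagonal.
rewrite hE; have [->|ji] := eqVneq j i; first by rewrite (restr_embed WsP).
by rewrite (restr_embed_neq WsP) // restr_id.
Qed.

Lemma character_prod (R : realType) (v : k -> int) (chi : 'End(W) -> R[i]) g :
  character v T chi -> T g -> chi g = \prod_i chi (embed Ws i (restr Ws i g)).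
Proof.
move=> [chi1 chiM _] Tg; have [T1 TM _] := Tgroup.
have partial (s : seq 'I_n) : uniq s -> exists h, [/\ T h,
    forall j, restr Ws j h = if j \in s then restr Ws j g else \1%VF
    & chi h = \prod_(j <- s) chi (embed Ws j (restr Ws j g))].
  elim: s => [_|i s IHs /= /andP[is_ us]].
    by exists \1%VF; rewrite big_nil; split=> // j; rewrite restr_id.
  have [h [Th hE chih]] := IHs us; have Te := torus_embed i Tg.
  exists (embed Ws i (restr Ws i g) \o h)%VF; split; first exact: TM.
    move=> j; rewrite inE restr_comp ?hE; [|exact: torus_block_diagonal..].
    have [->|ji] /= := eqVneq j i.
      by rewrite (restr_embed WsP) (negPf is_) comp_lfun1r.
    by rewrite (restr_embed_neq WsP) // comp_lfun1l.
  by rewrite chiM // chih big_cons.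
have [h [Th hE chih]] := partial _ (index_enum_uniq 'I_n).
rewrite -chih; congr chi; apply: (block_diagonal_inj WsP) => [||j].
- exact: torus_block_diagonal.
- exact: torus_block_diagonal.
by rewrite hE mem_index_enum.
Qed.

End TorusDecompositions.

(** * Sums of lattices and their residual spaces *)

Section SumLattices.
Variables (k : fieldType) (Fq : finFieldType) (K : localField k Fq) (lam : int).
Variables (W : vectType k) (beta : W -> W -> k).
Hypothesis betaP : symplectic_form beta.
Variables (n : nat) (Ws : 'I_n -> {vspace W}).
Hypothesis WsP : orthogonal_decomposition beta Ws.
Local Notation comp := (component Ws).
Local Notation sbeta := (sub_form beta Ws).
Let sbetaP i : symplectic_form (sbeta i) := sub_form_symplectic WsP betaP i.

Section OneLattice.
Variable Ls : forall i, set (subvs_of (Ws i)).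
Arguments Ls : clear implicits.
Hypothesis LsP : forall i, additive_subgroup (Ls i).
Local Notation L := (sum_lattice Ls).

Lemma additive_subgroup_sum : additive_subgroup L.
Proof.
split=> [i|x y hx hy i]; first by rewrite linear0; apply: additive_subgroup0.
by rewrite linearB; apply: additive_subgroupB.
Qed.

Lemma sum_lattice_vsval i y : Ls i y -> L (vsval y).
Proof.
move=> Ly j; have [E|ji] := eqVneq j i.
  by subst j; rewrite (component_vsval WsP).
by rewrite (component_vsval_neq WsP) //; apply: additive_subgroup0.
Qed.

Lemma dual_sum_lattice w :
  dual_lattice K lam beta L w <->
    forall i, dual_lattice K lam (sbeta i) (Ls i) (comp i w).
Proof.
split=> [Lw i b Lb|Lw b Lb].
  by rewrite -(form_vsvalr WsP betaP); apply/Lw/sum_lattice_vsval.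
rewrite (form_componentE WsP betaP); apply: big_ind; first exact: videal0.
  by move=> x y; apply: (videalD (lf_valP K)).
by move=> i _; apply: Lw.
Qed.

Lemma dual_vsval i y : dual_lattice K lam (sbeta i) (Ls i) y ->
  dual_lattice K lam beta L (vsval y).
Proof.
move=> hy; apply/dual_sum_lattice=> j; have [E|ji] := eqVneq j i.
  by subst j; rewrite (component_vsval WsP).
by rewrite (component_vsval_neq WsP) //; apply: dual0.
Qed.

Section BlockDiagonal.
Variable g : 'End(W).
Hypothesis gW : block_diagonal Ws g.

Lemma stabilizer_sum_lattice :
  (forall i, stabilizer (sbeta i) (Ls i) (restr Ws i g)) -> stabilizer beta L g.
Proof.
move=> gL; have gSs i : Sp (sbeta i) (restr Ws i g) by case: (gL i).
have gS := block_diagonal_Sp WsP betaP gW gSs; split=> //.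
apply/seteqP; split=> [_ [w Lw <-] i|w Lw].
  by rewrite (component_block WsP gW); apply/(stabilizer_mem (gL i))/Lw.
exists ((g^-1)%VF w); last by rewrite lker0_lfunVK // (lker0_Sp betaP gS).
move=> i; rewrite (component_inv WsP betaP gW gSs).
by apply/(stabilizer_memV (gL i))/Lw.
Qed.

Lemma sum_lattice_capg z : (forall i, Sp (sbeta i) (restr Ws i g)) ->
  (L `&` g @` L) z <->
  forall i, (Ls i `&` restr Ws i g @` Ls i) (comp i z).
Proof.
move=> gSs; have g0 := lker0_Sp betaP (block_diagonal_Sp WsP betaP gW gSs).
split=> [[Lz [a La az]] i|cap].
  split; first exact: Lz.
  by exists (comp i a); rewrite -?(component_block WsP gW) ?az.
split=> [i|]; first by case: (cap i).
exists ((g^-1)%VF z); last by rewrite lker0_lfunVK.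
move=> i; rewrite (component_inv WsP betaP gW gSs).
case: (cap i) => _ [a La <-].
by rewrite lker0_lfunK // (lker0_Sp (sbetaP i) (@gSs i)).
Qed.

Lemma coset_transversal_sum (I_ : 'I_n -> finType)
    (x_ : forall i, I_ i -> subvs_of (Ws i)) :
  (forall i, Sp (sbeta i) (restr Ws i g)) ->
  (forall i,
     coset_transversal (Ls i) (Ls i `&` restr Ws i g @` Ls i) (@x_ i)) ->
  coset_transversal L (L `&` g @` L)
    (fun t : fprod I_ => \sum_i vsval (x_ i (t i))).
Proof.
move=> gSs xT; have capP z := sum_lattice_capg z gSs.
have comp_x (t : fprod I_) i : comp i (\sum_i vsval (x_ i (t i))) = x_ i (t i).
  exact: (component_sum WsP (fun i => x_ i (t i))).
split.
- by move=> t i; rewrite comp_x; case: (xT i).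
- move=> a La; have /fin_all_exists[t tP] i : exists j : I_ i,
      (Ls i `&` restr Ws i g @` Ls i) (x_ i j - comp i a).
    by have [_ + _] := xT i; apply.
  exists (fprod_of_fun t); apply/capP=> i.
  by rewrite linearB /= comp_x fprodE; apply: tP.
- move=> t t' /capP cap; apply/fprodP=> i.
  have [_ _ x_inj] := xT i; apply: x_inj.
  by have := cap i; rewrite linearB /= !comp_x.
Qed.

End BlockDiagonal.

Lemma restr_embed_Sp i (t : 'End(subvs_of (Ws i))) j : Sp (sbeta i) t ->
  Sp (sbeta j) (restr Ws j (embed Ws i t)).
Proof.
move=> tS; have [->|ji] := eqVneq j i; first by rewrite (restr_embed WsP).
by rewrite (restr_embed_neq WsP) // => u v; rewrite !id_lfunE.
Qed.

Lemma coset_transversal_embed i (t : 'End(subvs_of (Ws i))) (I : finType)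
    (x : I -> subvs_of (Ws i)) : Sp (sbeta i) t ->
  coset_transversal (Ls i) (Ls i `&` t @` Ls i) x ->
  coset_transversal L (L `&` embed Ws i t @` L) (fun j => vsval (x j)).
Proof.
move=> tS [xL x_cover x_inj].
have capP z := sum_lattice_capg (block_diagonal_embed WsP t) z
  (fun j => restr_embed_Sp (j := j) tS).
split.
- by move=> j; apply: sum_lattice_vsval.
- move=> a La; have [j ja] := x_cover _ (La i); exists j; apply/capP=> m.
  rewrite linearB /=; have [E|mi] := eqVneq m i.
    by subst m; rewrite (component_vsval WsP) (restr_embed WsP).
  rewrite (component_vsval_neq WsP) // sub0r (restr_embed_neq WsP) //.
  have LNa : Ls m (- comp m a) by apply/(additive_subgroupN (LsP m))/La.
  by split=> //; exists (- comp m a); rewrite ?id_lfunE.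
- move=> j j' /capP/(_ i); rewrite -linearB (component_vsval WsP).
  by rewrite (restr_embed WsP); apply: x_inj.
Qed.

Lemma stabilizer_restr_embed i (t : 'End(subvs_of (Ws i))) j :
  stabilizer (sbeta i) (Ls i) t ->
  stabilizer (sbeta j) (Ls j) (restr Ws j (embed Ws i t)).
Proof.
move=> tL; have [E|ji] := eqVneq j i.
  by subst j; rewrite (restr_embed WsP).
rewrite (restr_embed_neq WsP) //; exact: stabilizer_id.
Qed.

End OneLattice.

Variables (As Bs : forall i, set (subvs_of (Ws i))).
Arguments As : clear implicits.
Arguments Bs : clear implicits.
Local Notation A := (sum_lattice As).
Local Notation B := (sum_lattice Bs).
Local Notation dual := (dual_lattice K lam beta B).
Local Notation duals i := (dual_lattice K lam (sbeta i) (Bs i)).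
Hypothesis chains : forall i, lattice_chain K lam (sbeta i) (As i) (Bs i).
Let AsP i : additive_subgroup (As i). Proof. by case: (chains i). Qed.
Let BsP i : additive_subgroup (Bs i). Proof. by case: (chains i). Qed.

Lemma lattice_chain_sum : lattice_chain K lam beta A B.
Proof.
split; [exact: additive_subgroup_sum | exact: additive_subgroup_sum | |].
  by move=> w Bw i; have [_ _ BA _] := chains i; apply/BA/Bw.
move=> w Aw; apply/(dual_sum_lattice BsP) => i.
by have [_ _ _ AD] := chains i; apply/AD/Aw.
Qed.

Variable Q : residualSpace K lam beta A B.
Variable Qs : forall i, residualSpace K lam (sbeta i) (As i) (Bs i).
Local Notation form := (rs_form (r := Q)).
Local Notation forms i := (rs_form (r := Qs i)).

Definition res_embed i : 'Hom(rs_space (Qs i), rs_space Q) :=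
  induced (Qs i) Q (linfun vsval).

Lemma res_embedE i y :
  duals i y -> res_embed i (rs_pr (Qs i) y) = rs_pr Q (vsval y).
Proof.
move=> hy; rewrite /res_embed inducedE ?lfunE // => w; rewrite lfunE /=.
  exact: dual_vsval.
exact: sum_lattice_vsval.
Qed.

Lemma rs_pr_component w : dual w ->
  rs_pr Q w = \sum_i res_embed i (rs_pr (Qs i) (comp i w)).
Proof.
move=> hw; rewrite -{1}(sum_component WsP w).
have hi := (dual_sum_lattice BsP w).1 hw.
suff [] : dual (\sum_i vsval (comp i w)) /\ rs_pr Q (\sum_i vsval (comp i w)) =
  \sum_i res_embed i (rs_pr (Qs i) (comp i w)) by [].
apply: (big_ind2 (fun x y => dual x /\ rs_pr Q x = y)).
- by split; [exact: dual0 | exact: rs_pr0].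
- move=> x1 x2 y1 y2 [d1 e1] [d2 e2]; split; first exact: dualD.
  by rewrite (rs_pr_add Q) // e1 e2.
- by move=> i _; rewrite res_embedE //; split=> //; apply: dual_vsval.
Qed.

Lemma res_embed_isometry i u v :
  form (res_embed i u) (res_embed i v) = forms i u v.
Proof.
have [x hx <-] := rs_pr_surj u; have [y hy <-] := rs_pr_surj v.
by rewrite !res_embedE // !rs_formE //; apply: dual_vsval.
Qed.

Lemma res_embed_orthogonal i j u v : i != j ->
  form (res_embed i u) (res_embed j v) = 0.
Proof.
have [_ _ orth] := WsP.
move=> ij; have [x hx <-] := rs_pr_surj u; have [y hy <-] := rs_pr_surj v.
rewrite !res_embedE // !rs_formE; [|exact: dual_vsval..].
by rewrite (orth i j) ?subvsP // mulr0 lf_red0.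
Qed.

Lemma res_embed_span : (\sum_i limg (res_embed i) = {:rs_space Q})%VS.
Proof.
apply/eqP; rewrite eqEsubv subvf; apply/subvP=> y _.
have [w hw <-] := rs_pr_surj y; rewrite rs_pr_component //.
by apply: memv_sumr => i _; apply: memv_img; apply: memvf.
Qed.

Lemma res_embed_lagr : rs_lagr Q = (\sum_i (res_embed i @: rs_lagr (Qs i)))%VS.
Proof.
have [_ _ _ AD] := lattice_chain_sum.
apply/eqP; rewrite eqEsubv; apply/andP; split.
  apply/subvP=> y /rs_lagrE[a Aa <-]; rewrite rs_pr_component; last exact: AD.
  apply: memv_sumr => i _; apply: memv_img.
  by apply/rs_lagrE; exists (comp i a).
apply/subv_sumP=> i _; apply/subvP=> _ /memv_imgP[y /rs_lagrE[a Aa <-] ->].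
have [_ _ _ ADi] := chains i; rewrite res_embedE; last exact: ADi.
by apply/rs_lagrE; exists (vsval a) => //; apply: sum_lattice_vsval.
Qed.

Variable g : 'End(W).
Hypothesis gW : block_diagonal Ws g.
Hypothesis gBs : forall i, stabilizer (sbeta i) (Bs i) (restr Ws i g).

Lemma reduction_res_embed i u :
  reduction Q g (res_embed i u) =
    res_embed i (reduction (Qs i) (restr Ws i g) u).
Proof.
have gB := stabilizer_sum_lattice gW gBs; have [y hy <-] := rs_pr_surj u.
rewrite (reductionE (sbetaP i) (Qs i) (gBs i)) //.
have hgy : duals i (restr Ws i g y) by apply: (stabilizer_dual (sbetaP i)).
rewrite !res_embedE // reductionE //; last exact: dual_vsval.
by rewrite (restrE gW).
Qed.

Variables (theta : 'End(rs_space Q) -> Fq)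
    (thetas : forall i, 'End(rs_space (Qs i)) -> Fq).
Arguments thetas : clear implicits.
Hypothesis thetaP : theta_function theta.
Hypothesis thetasP : forall i, theta_function (thetas i).
Local Notation h := (reduction Q g).
Local Notation hs i := (reduction (Qs i) (restr Ws i g)).

Lemma theta_reduction_neq0 i : thetas i (hs i) != 0.
Proof.
by have [theta0 _ _ _] := thetasP i; apply/theta0/(reduction_Sp (sbetaP i)).
Qed.

Let reduction_Sps i : Sp (forms i) (hs i) := reduction_Sp (sbetaP i) (gBs i).

Let reduction_Sp_sum : Sp form h :=
  reduction_Sp betaP (stabilizer_sum_lattice gW gBs).

Lemma bruhat_form_reduction :
  exists (E G : forall i, 'I_(rs_l (Qs i)) -> rs_space (Qs i)) S C,
    (forall i, bruhat_form (forms i) (rs_lagr (Qs i)) (hs i)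
                 (E i) (G i) (S i) (C i)) /\
    bruhat_form form (rs_lagr Q) h (glue_family res_embed E)
      (glue_family res_embed G) (glue_set S) (\mxdiag_i C i).
Proof.
have /fin_all_exists[E] i : exists (E : 'I_(rs_l (Qs i)) -> rs_space (Qs i)),
    exists G S C, bruhat_form (forms i) (rs_lagr (Qs i)) (hs i) E G S C.
  have [e [f [ef <-]]] := exists_lagrangian_basis (thetasP i).
  exact: (bruhat_exists (rs_form_skew (sbetaP i) (Qs i)) (@reduction_Sps i) ef).
move=> /fin_all_exists[G /fin_all_exists[S /fin_all_exists[C bruhat]]].
exists E, G, S, C; split=> //.
exact: (bruhat_form_glue res_embed_isometry res_embed_orthogonal
  res_embed_span res_embed_lagr reduction_res_embed bruhat).
Qed.

Lemma theta_reduction_prod :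
  eq_mod_squares (theta h) (\prod_i thetas i (hs i)).
Proof.
have [E [G [S [C [bruhat glued]]]]] := bruhat_form_reduction.
have := theta_bruhat betaP thetaP reduction_Sp_sum glued.
move=> /eq_mod_squares_trans; apply.
rewrite det_mxdiag; apply: (big_ind2 (@eq_mod_squares Fq)) => [||i _].
- exact: eq_mod_squares_refl.
- by move=> *; apply: eq_mod_squaresM.
apply: eq_mod_squares_sym.
exact: (theta_bruhat (sbetaP i) (thetasP i) (@reduction_Sps i) (bruhat i)).
Qed.

Lemma rs_j_reduction_sum : rs_j h = (\sum_i rs_j (hs i))%N.
Proof.
have [E [G [S [C [bruhat glued]]]]] := bruhat_form_reduction.
rewrite (rs_j_bruhat betaP reduction_Sp_sum glued) card_glue_set.
apply: eq_bigr => i _.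
by rewrite (rs_j_bruhat (sbetaP i) (@reduction_Sps i) (bruhat i)).
Qed.

End SumLattices.

(** * Tensor products and slices *)

Lemma fun_neq0 (T : Type) (V : nmodType) (f : T -> V) :
  f <> (fun=> 0) -> exists x, f x != 0.
Proof.
move=> f_neq0; apply/not_existsP => f0; apply: f_neq0.
by apply/funext => x; have /negP/negPn/eqP := f0 x.
Qed.

Section WeilTensor.
Variables (R : realType) (k : fieldType) (Fq : finFieldType).
Variables (K : localField k Fq) (psi : k -> R[i]) (lam : int).
Hypothesis psiP : unitary_character K psi lam.
Variables (W : vectType k) (beta : W -> W -> k).
Hypothesis betaP : symplectic_form beta.
Variables (n : nat) (Ws : 'I_n -> {vspace W}).
Hypothesis WsP : orthogonal_decomposition beta Ws.
Local Notation comp := (component Ws).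
Local Notation sbeta := (sub_form beta Ws).
Variables (As Bs : forall i, set (subvs_of (Ws i))).
Arguments As : clear implicits.
Arguments Bs : clear implicits.
Local Notation A := (sum_lattice As).
Local Notation B := (sum_lattice Bs).
Hypothesis chains : forall i, lattice_chain K lam (sbeta i) (As i) (Bs i).
Let sbetaP i : symplectic_form (sbeta i) := sub_form_symplectic WsP betaP i.
Let AsP i : additive_subgroup (As i). Proof. by case: (chains i). Qed.
Let AP : additive_subgroup A. Proof. exact: additive_subgroup_sum. Qed.

Section Tensor.
Variable phi : forall i, subvs_of (Ws i) -> R[i].

Lemma quasiperiodic_tensor :
  (forall i, quasiperiodic psi (sbeta i) (As i) (@phi i)) ->
  quasiperiodic psi beta A (tensor phi).
Proof.
move=> phiA a w Aa; rewrite (form_componentE WsP betaP) mulr_sumr.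
rewrite (psi_sum psiP) -big_split; apply: eq_bigr => i _ /=.
by rewrite linearD phiA //; apply: Aa.
Qed.

Lemma sqnorm_tensor_lty : (forall i, hilbert psi (sbeta i) (As i) (@phi i)) ->
  (sqnorm A (tensor phi) < +oo)%E.
Proof.
move=> phiH; pose s i := fine (sqnorm (As i) (@phi i)).
have sE i : sqnorm (As i) (@phi i) = (s i)%:E.
  by rewrite fineK // ge0_fin_numE ?sqnorm_ge0 //; case: (phiH i).
apply: (@le_lt_trans _ _ (\prod_i s i)%:E); last exact: ltry.
apply: sqnorm_le => X XA; pose r i (w : W) := rep setT (As i) (comp i w).
have rP i w : As i (r i w - comp i w).
  by case: (repP (M := setT) (AsP i) (a := comp i w)).
rewrite (eq_bigr (fun w => \prod_i sqmod (phi (r i w)))) => [|w _]; last first.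
  rewrite /tensor sqmod_prod; apply: eq_bigr => i _; have [phiA _] := phiH i.
  exact/esym/(sqmod_quasiperiodic psiP phiA).
apply: le_trans (sum_prod_le_prod_sum (F := fun i z => sqmod (@phi i z)) _ _) _.
- by move=> i z; apply: sqmod_ge0.
- move=> w w' wX w'X E; apply: (reps_inj AP (XA _ wX) (XA _ w'X)) => i.
  by rewrite linearB; apply: (additive_subgroup_congr (AsP i) (rP i w));
    rewrite E.
apply: ler_prod => i _; rewrite sumr_ge0 => [/=|z _]; last exact: sqmod_ge0.
rewrite -lee_fin -sE; apply: sum_le_sqnorm => _ /imfsetP[w _ ->].
exact: reps_rep.
Qed.

Lemma hilbert_tensor : (forall i, hilbert psi (sbeta i) (As i) (@phi i)) ->
  hilbert psi beta A (tensor phi).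
Proof.
move=> phiH; split; last exact: sqnorm_tensor_lty.
by apply: quasiperiodic_tensor => i; case: (phiH i).
Qed.

Lemma tensor_neq0 : (forall i, exists y, @phi i y != 0) ->
  exists w, tensor phi w != 0.
Proof.
move=> /fin_all_exists[y y0]; exists (\sum_i vsval (y i)).
by apply/prodf_neq0 => i _; rewrite (component_sum WsP y).
Qed.

End Tensor.

Lemma slice_quasiperiodic (phi : W -> R[i]) i c :
  quasiperiodic psi beta A phi -> comp i c = 0 ->
  quasiperiodic psi (sbeta i) (As i) (fun z => phi (vsval z + c)).
Proof.
move=> phiA c0 a z Aa; rewrite linearD /= -addrA.
rewrite (phiA _ _ (sum_lattice_vsval WsP AsP Aa)) (form_vsvalr WsP betaP).
by rewrite linearD /= c0 addr0 (component_vsval WsP).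
Qed.

Variables (Q : residualSpace K lam beta A B) (theta : 'End(rs_space Q) -> Fq).
Variable Qs : forall i, residualSpace K lam (sbeta i) (As i) (Bs i).
Variable thetas : forall i, 'End(rs_space (Qs i)) -> Fq.
Arguments thetas : clear implicits.
Hypothesis thetaP : theta_function theta.
Hypothesis thetasP : forall i, theta_function (thetas i).

Let A_isotropic : A `<=` dual_lattice K lam beta A.
Proof.
have [_ _ _ AD] := lattice_chain_sum betaP WsP chains.
exact: (lagrangian_isotropic betaP thetaP AD).
Qed.

Let As_isotropic i : As i `<=` dual_lattice K lam (sbeta i) (As i).
Proof.
have [_ _ _ AD] := chains i.
exact: (lagrangian_isotropic (sbetaP i) (thetasP i) AD).
Qed.

Let exists_transversal i t : stabilizer (sbeta i) (Bs i) t ->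
  exists (I : finType) (x : I -> subvs_of (Ws i)),
    coset_transversal (As i) (As i `&` t @` As i) x.
Proof.
move=> tB; have [tS _] := tB; apply: exists_coset_transversal.
  exact: (additive_subgroup_capg (AsP i)).
exact: (finite_reps_capg (sbetaP i) (AsP i) tS (chains i) tB (Qs i)).
Qed.

Lemma weil_factor_prod g : block_diagonal Ws g ->
  (forall i, stabilizer (sbeta i) (Bs i) (restr Ws i g)) ->
  weil_factor psi g theta = \prod_i weil_factor psi (restr Ws i g) (thetas i).
Proof.
move=> gW gBs; rewrite /weil_factor big_split /=.
have theta0 i := theta_reduction_neq0 betaP WsP gBs thetasP i.
have thetaE := theta_reduction_prod betaP WsP chains gW gBs thetaP thetasP.
have jE := rs_j_reduction_sum betaP WsP chains Q gW gBs thetasP.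
by rewrite prodrXr /mfactor jE (omega_factor_prod psiP _ theta0 thetaE).
Qed.

Lemma weil_op_tensor (phi : forall i, subvs_of (Ws i) -> R[i]) g w :
  block_diagonal Ws g ->
  (forall i, stabilizer (sbeta i) (Bs i) (restr Ws i g)) ->
  (forall i, quasiperiodic psi (sbeta i) (As i) (@phi i)) ->
  weil_op psi theta g (tensor phi) w =
  \prod_i weil_op psi (thetas i) (restr Ws i g) (@phi i) (comp i w).
Proof.
move=> gW gBs phiA; have gSs i : Sp (sbeta i) (restr Ws i g) by case: (gBs i).
have gS := block_diagonal_Sp WsP betaP gW gSs.
have /fin_all_exists[I_ /fin_all_exists[x_ xT]] i := exists_transversal (gBs i).
have comp_x (t : fprod I_) i : comp i (\sum_i vsval (x_ i (t i))) = x_ i (t i).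
  exact: (component_sum WsP (fun i => x_ i (t i))).
rewrite (weil_op_transversal psiP betaP AP gS theta w A_isotropic
  (quasiperiodic_tensor phiA) (coset_transversal_sum betaP WsP gW gSs xT)).
rewrite card_fprod natr_prod -prodfV weil_factor_prod //.
have -> : \sum_(t : fprod I_) psi (2^-1 * beta (\sum_i vsval (x_ i (t i))) w) *
    tensor phi ((g^-1)%VF (\sum_i vsval (x_ i (t i)) + w)) =
    \sum_(t : fprod I_) \prod_i (psi (2^-1 * sbeta i (x_ i (t i)) (comp i w))
      * phi i ((restr Ws i g)^-1%VF (x_ i (t i) + comp i w))).
  apply: eq_bigr => t _; rewrite big_split /= (form_componentE WsP betaP).
  rewrite mulr_sumr (psi_sum psiP); congr (_ * _).
    by apply: eq_bigr => i _; rewrite comp_x.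
  apply: eq_bigr => i _.
  by rewrite (component_inv WsP betaP gW gSs) linearD /= comp_x.
rewrite -(prod_sum_fprod (fun i j => psi (2^-1 * sbeta i (x_ i j) (comp i w))
  * phi i ((restr Ws i g)^-1%VF (x_ i j + comp i w)))) -!big_split /=.
apply: eq_bigr => i _.
by rewrite (weil_op_transversal psiP (sbetaP i) (AsP i) (@gSs i) (thetas i) _
  (@As_isotropic i) (@phiA i) (xT i)).
Qed.

Lemma weil_factor_embed i (t : 'End(subvs_of (Ws i))) :
  stabilizer (sbeta i) (Bs i) t ->
  weil_factor psi (embed Ws i t) theta = weil_factor psi t (thetas i).
Proof.
move=> tB; rewrite weil_factor_prod => [||j].
- rewrite (bigD1 i) //= (restr_embed WsP) big1 ?mulr1 // => j ji.
  by rewrite (restr_embed_neq WsP) // (weil_factor1 psiP (sbetaP j)).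
- exact: (block_diagonal_embed WsP).
- exact: stabilizer_restr_embed.
Qed.

Lemma weil_op_embed (phi : W -> R[i]) i (t : 'End(subvs_of (Ws i))) c y :
  stabilizer (sbeta i) (Bs i) t -> quasiperiodic psi beta A phi ->
  comp i c = 0 ->
  weil_op psi theta (embed Ws i t) phi (vsval y + c) =
  weil_op psi (thetas i) t (fun z => phi (vsval z + c)) y.
Proof.
move=> tB phiA c0; have [tS _] := tB.
have eW := block_diagonal_embed WsP t.
have eSs j : Sp (sbeta j) (restr Ws j (embed Ws i t)) := restr_embed_Sp WsP tS.
have eS := block_diagonal_Sp WsP betaP eW eSs.
have [I [x xT]] := exists_transversal tB.
rewrite (weil_op_transversal psiP (sbetaP i) (AsP i) tS (thetas i) _
  (@As_isotropic i) (slice_quasiperiodic phiA c0) xT).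
rewrite (weil_op_transversal psiP betaP AP eS theta _ A_isotropic phiA
  (coset_transversal_embed betaP WsP AsP tS xT)).
rewrite weil_factor_embed //; congr (_ * _); apply: eq_bigr => j _.
congr (psi (_ * _) * phi _).
  by rewrite (form_vsvall WsP betaP) linearD /= c0 addr0 (component_vsval WsP).
apply: (component_inj WsP) => m;
  rewrite (component_inv WsP betaP eW eSs) !linearD /=.
have [E|mi] := eqVneq m i.
  subst m; rewrite c0 linear0 !addr0 !(component_vsval WsP).
  by rewrite (restr_embed WsP).
rewrite !(component_vsval_neq WsP) // linear0 !add0r (restr_embed_neq WsP) //.
by rewrite -{1}(id_lfunE (comp m c)) lker0_lfunK // (lker0_Sp (sbetaP m)) //
  => u u'; rewrite !id_lfunE.
Qed.

Variables (T : set 'End(W)) (v : k -> int) (chi : 'End(W) -> R[i]).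
Hypotheses (Tgroup : subgroup T) (TP : torus_decomposition beta T Ws).
Hypothesis TBs : forall i g, T g -> stabilizer (sbeta i) (Bs i) (restr Ws i g).
Hypothesis chiP : character v T chi.

Lemma eigenfunction_tensor (phi : forall i, subvs_of (Ws i) -> R[i]) :
  (forall i, eigenfunction psi (thetas i) (sub_torus T Ws i)
               (fun t => chi (embed Ws i t)) (@phi i)) ->
  eigenfunction psi theta T chi (tensor phi).
Proof.
move=> phiE; have phiH i : hilbert psi (sbeta i) (As i) (@phi i).
  by case: (phiE i).
split; first exact: hilbert_tensor.
  have [|w w0] := tensor_neq0 (phi := phi).
    by move=> i; have [_ /fun_neq0] := phiE i.
  by move/(congr1 (fun f => f w)); apply/eqP.
move=> g Tg; apply/funext => w; rewrite /weil /= weil_op_tensor.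
- rewrite (character_prod Tgroup TP chiP Tg) -big_split.
  apply: eq_bigr => i _; have [_ _ phiT] := phiE i.
  have Ti : sub_torus T Ws i (restr Ws i g) by exists g.
  exact: (congr1 (fun f => f (comp i w)) (phiT _ Ti)).
- exact: (torus_block_diagonal TP).
- by move=> i; apply: TBs.
- by move=> i; case: (phiH i).
Qed.

Lemma eigenfunction_slice (phi : W -> R[i]) i w0 :
  eigenfunction psi theta T chi phi -> phi w0 != 0 ->
  eigenfunction psi (thetas i) (sub_torus T Ws i)
    (fun t => chi (embed Ws i t))
    (fun z => phi (vsval z + (w0 - vsval (comp i w0)))).
Proof.
move=> [[phiA phi_fin] _ phiT] w00; set c := w0 - _.
have c0 : comp i c = 0 by rewrite linearB /= (component_vsval WsP) subrr.
split; first split.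
- exact: slice_quasiperiodic.
- apply: le_lt_trans phi_fin.
  apply: (sqnorm_comp_le psiP (beta' := beta) (f := fun z => vsval z + c)
    (AsP i) AP _ phiA) => x y.
  rewrite opprD addrACA subrr addr0 -linearB => /(_ i).
  by rewrite (component_vsval WsP).
- move/(congr1 (fun f => f (comp i w0))) => /eqP.
  by rewrite addrC subrK (negPf w00).
- move=> _ [g Tg <-]; apply/funext => z.
  rewrite /weil /= -(weil_op_embed z (TBs i Tg) phiA c0).
  have Te := torus_embed Tgroup TP i Tg.
  exact: (congr1 (fun f => f (vsval z + c)) (phiT _ Te)).
Qed.

Lemma occurs_iff_components : occurs psi theta T chi <->
  forall i, occurs psi (thetas i) (sub_torus T Ws i)
              (fun t => chi (embed Ws i t)).
Proof.
split=> [[phi phiE] i|/fin_all_exists[phi phiE]]; last first.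
  by exists (tensor phi); apply: eigenfunction_tensor.
have [w0 w00] : exists w0, phi w0 != 0 by have [_ /fun_neq0] := phiE.
by eexists; apply: eigenfunction_slice phiE w00.
Qed.

End WeilTensor.

Theorem mainTheorem16 (R : realType) (k : fieldType) (Fq : finFieldType)
  (K : localField k Fq) (psi : k -> R[i]) (lam : int)
  (psiP : unitary_character K psi lam)
  (W : vectType k) (beta : W -> W -> k) (betaP : symplectic_form beta)
  (W_neq0 : (0 < \dim {:W})%N)
  (T : set 'End(W)) (TP : maximal_elliptic_torus beta T)
  (n : nat) (Ws : 'I_n -> {vspace W}) (WsP : torus_decomposition beta T Ws)
  (D : forall i : 'I_n, irreducibleTorus K (sub_form beta Ws i) (sub_torus T Ws i))
  (Bs := fun i : 'I_n => it_B lam (D i))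
  (As := fun i : 'I_n => it_A lam (D i))
  (B := sum_lattice Bs) (A := sum_lattice As)
  (Q : residualSpace K lam beta A B)
  (theta : 'End(rs_space Q) -> Fq) (thetaP : theta_function theta)
  (Qs : forall i : 'I_n,
     residualSpace K lam (sub_form beta Ws i) (As i) (Bs i))
  (thetas : forall i : 'I_n, 'End(rs_space (Qs i)) -> Fq)
  (thetasP : forall i : 'I_n, theta_function (thetas i)) :
  forall chi : 'End(W) -> R[i], character (lf_val K) T chi ->
  (occurs psi theta T chi <->
     forall i : 'I_n,
       occurs psi (thetas i) (sub_torus T Ws i) (fun t => chi (embed Ws i t)))
  /\
  (occurs psi theta T chi ->
     forall phi : forall i : 'I_n, subvs_of (Ws i) -> R[i],
       (forall i : 'I_n, eigenfunction psi (thetas i) (sub_torus T Ws i)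
                           (fun t => chi (embed Ws i t)) (phi i)) ->
       eigenfunction psi theta T chi (tensor phi)).
Proof.
move=> chi chiP; have [[[_ Tgroup _ _ _] _] _] := TP.
have orth := torus_orthogonal_decomposition WsP.
have chains i := lattice_chain_it lam (D i).
have TBs i g : T g -> stabilizer (sub_form beta Ws i) (Bs i) (restr Ws i g).
  by move=> Tg; apply: stabilizer_it_B; exists g.
split; first exact: (occurs_iff_components psiP betaP orth chains thetaP thetasP
  Tgroup WsP TBs chiP).
by move=> _ phi; apply: (eigenfunction_tensor psiP betaP orth chains thetaP
  thetasP Tgroup WsP TBs chiP).
Qed.
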